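(* Let $k\ge1$, $k_1,\dots,k_p,\bar k_1,\dots,\bar k_{\bar p}\in\{0,\dots,k\}$, $\mathbf M=(M_a)$ with $M_a=\#\{i\mid k_i=a\}$, $\overline{\mathbf M}=(\overline M_a)$ with $\overline M_a=\#\{i\mid\bar k_i=a\}$, $\zeta_1,\dots,\zeta_{p+\bar p}$ pairwise distinct, and $V_{\mathbf M,\overline{\mathbf M}}=\Pi_{k_1}*\cdots*\Pi_{k_p}*\overline\Pi_{\bar k_1}*\cdots*\overline\Pi_{\bar k_{\bar p}}$. There is a filtration $H$ of $\mathrm{gr}^GV_{\mathbf M,\overline{\mathbf M}}$ by $\mathbb{C}[Z_i\ (i\ge0)]$-submodules such that, as $\mathbb{C}[Z_i\ (i\ge0)]$-modules, \[ \mathrm{gr}^H\mathrm{gr}^GV_{\mathbf M,\overline{\mathbf M}}\simeq\bigoplus_{\mathbf m,\overline{\mathbf m}\in\mathbb{Z}^k_{\ge0}}\mathcal M_{\mathbf M\mathbf m;\overline{\mathbf M}\overline{\mathbf m}}\otimes\pi_{\mathbf m+\overline{\mathbf m}}, \] where $Z_i$ acts as $e_i$ on $\pi_{\mathbf m+\overline{\mathbf m}}$ and $\mathcal M_{\mathbf M\mathbf m;\overline{\mathbf M}\overline{\mathbf m}}$ is a trivial module with $\mathrm{ch}_q\mathcal M_{\mathbf M\mathbf m;\overline{\mathbf M}\overline{\mathbf m}}=F_{\mathbf M,\mathbf m}(q)F_{\overline{\mathbf M},\overline{\mathbf m}}(q)$. Moreover \[ \mathrm{ch}_{q,z_1,z_2}V_{\mathbf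 M,\overline{\mathbf M}}=\sum_{\mathbf m,\overline{\mathbf m}}F_{\mathbf M,\mathbf m}(q)F_{\overline{\mathbf M},\overline{\mathbf m}}(q)\,\mathrm{ch}_{q,z_1z_2}\pi_{\mathbf m+\overline{\mathbf m}}\,(z_1^{-1}z_2)^{(|\mathbf M|-|\overline{\mathbf M}|)/3-(|\mathbf m|-|\overline{\mathbf m}|)/2}. \]
   Context: $e_{ab}$: $3\times3$ matrix units, $h_{ab}=e_{aa}-e_{bb}$; $\mathfrak n=\mathrm{span}(e_{12},e_{13},e_{23})$, $\mathfrak b=\mathbb{C}e_{13}$, $e_{ab,i}=e_{ab}\otimes t^i$, $Z_i:=e_{13,i}$. $\Pi_m$ (resp. $\overline\Pi_m$): irreducible $\mathfrak{sl}_3$-module of highest weight $m\omega_1$ (resp. $m\omega_2$), lowest weight vector $v^{(m)}$ (resp. $\bar v^{(m)}$); $\mathbf v=\otimes v^{(k_i)}$, $\bar{\mathbf v}=\otimes\bar v^{(\bar k_i)}$. $V_{\mathbf M,\overline{\mathbf M}}$: $\mathfrak{sl}_3[t]$ acts on $\bigotimes\Pi_{k_i}\otimes\bigotimes\overline\Pi_{\bar k_i}$ with $x\otimes t^j$ acting on the $r$-th factor by $\zeta_r^jx$; $V_{\mathbf M,\overline{\mathbf M}}$ is the associated graded of the filtration $U^{\le d}(\mathfrak n[t])(\mathbf v\otimes\bar{\mathbf v})$ ($U^{\le d}$: monomials of total $t$-degree $\le d$). It is graded by $D_0$ ($t$-degree), $D_1=(2h_{12}+h_{23})/3$, $D_2=(h_{12}+2h_{23})/3$: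 $\deg e_{12,i}=(i,1,0)$, $\deg e_{23,i}=(i,0,1)$, $\deg e_{13,i}=(i,1,1)$, $\deg(\mathbf v\otimes\bar{\mathbf v})=(0,-(|\mathbf M|+2|\overline{\mathbf M}|)/3,-(2|\mathbf M|+|\overline{\mathbf M}|)/3)$; $\mathrm{ch}_{q,z_1,z_2}=\mathrm{tr}\,q^{D_0}z_1^{D_1}z_2^{D_2}$. Filtration $G$: $L$ = span of $e_{12,i},e_{23,i}$; $U_{\le-1}=0$, $U_{\le0}=U(\mathfrak b[t])$, $U_{\le i}=LU_{\le i-1}+U_{\le i-1}$; $G^iV=U_{\le i}(\mathbf v\otimes\bar{\mathbf v})$, $\mathrm{gr}^GV=\oplus G^i/G^{i-1}$, on which $Z_i$ acts. $\pi_a$: $(a+1)$-dim irreducible $\mathfrak{sl}_2$-module with lowest weight vector $u_a$; $\pi_{\mathbf m}=\pi_1^{*m_1}*\cdots*\pi_k^{*m_k}$ the $\mathfrak{sl}_2$ fusion product (defined analogously) with cyclic vector $\otimes u_a$, graded by $\deg e_i=(i,1)$ and cyclic vector degree $(0,-|\mathbf m|/2)$; $\mathrm{ch}_{q,w}\pi_{\mathbf m}=\sum q^dw^s\dim(\pi_{\mathbf m})_{(d,s)}$, here with $w=z_1z_2$. Notation: $|\mathbf m|=\sum_iim_i$, $\lambda_a(\mathbf m)=\sum_{i\ge a}m_i$, $\lambda_{k+1}=0$, $\left[{m\atop n}\right]=\frac{(q^{m-n+1})_n}{(q)_n}$ ($0\le n\le m$, else $0$), $(z)_n=\prod_{j<n}(1-zq^j)$,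 and with $\lambda=\lambda(\mathbf M),\mu=\lambda(\mathbf m)$: $F_{\mathbf M,\mathbf m}(q)=q^{\sum_{a=1}^{k-1}\mu_{a+1}(\lambda_a-\mu_a)}\prod_{a=1}^k\left[{\lambda_a-\mu_{a+1}\atop\mu_a-\mu_{a+1}}\right]$. *)

(* Defs.v *)
From HB Require Import structures.
From mathcomp Require Import all_boot all_order all_algebra.
From Stdlib Require Import ClassicalEpsilon.
Set Implicit Arguments. Unset Strict Implicit. Unset Printing Implicit Defensive.
Import Order.TTheory GRing.Theory Num.Theory.
Local Open Scope ring_scope.

(* Vectors are row vectors 'rV_n; operators act on the right: u *m A.       *)
(* Subspaces are square matrices (row spaces), mxalgebra %MS operations.    *)
Section Generic.
Variable F : fieldType.

Section Ambient.
Variable n : nat.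

(* An index from which a chain of subspaces is constant (it exists for every *)
(* increasing chain, by finite dimensionality).                              *)
Definition stab (f : nat -> 'M[F]_n) : nat :=
  epsilon (inhabits 0%N) (fun r => forall r', (r <= r')%N -> (f r' == f r)%MS).

(* The union of an (increasing) chain of subspaces = its eventual value. *)
Definition eventual (f : nat -> 'M[F]_n) : 'M[F]_n := f (stab f).

(* Associated graded of a filtration Fl (Fl (-1) = 0), realized inside the  *)
(* same ambient space through the complements  C j := Fl j :\: Fl (j-1);    *)
(* J is an index such that Fl (J-1) is the whole filtered space.            *)
Definition prevsp (Fl : nat -> 'M[F]_n) (j : nat) : 'M[F]_n :=
  if j is j'.+1 then Fl j' else 0.
Definition grC (Fl : nat -> 'M[F]_n) (j : nat) : 'M[F]_n :=
  (Fl j :\: prevsp Fl j)%MS.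
Definition grP (J : nat) (Fl : nat -> 'M[F]_n) (j : nat) : 'M[F]_n :=
  proj_mx (grC Fl j) (\sum_(j' < J | val j' != j) grC Fl j')%MS.
(* projection of Fl k onto C k along Fl (k-1): the quotient map Fl k -> gr_k *)
Definition grQ (Fl : nat -> 'M[F]_n) (k : nat) : 'M[F]_n :=
  proj_mx (grC Fl k) (prevsp Fl k).
(* the operator induced on gr by A, where A maps Fl j into Fl (j + s) *)
Definition gr_op (J : nat) (Fl : nat -> 'M[F]_n) (s : nat) (A : 'M[F]_n) : 'M[F]_n :=
  \sum_(j < J) grP J Fl j *m A *m grQ Fl (j + s).
Definition gr_deg (J : nat) (Fl : nat -> 'M[F]_n) : 'M[F]_n :=
  \sum_(j < J) (j%:R : F) *: grP J Fl j.

(* Fusion filtration U^{<= d}(n[t]) v : E x i is the action of the letter   *)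
(* x \otimes t^i.  wspan r d = span of the words of length <= r and total   *)
(* t-degree <= d applied to v.                                              *)
Section Fusion.
Variable I : finType.
Variable E : I -> nat -> 'M[F]_n.
Variable v : 'rV[F]_n.

Fixpoint wspan (r d : nat) : 'M[F]_n :=
  match r with
  | 0 => <<v>>%MS
  | r'.+1 => (<<v>> + \sum_(i < d.+1) \sum_(x : I) (wspan r' (d - i) *m E x i))%MS
  end.

Definition ufilt (d : nat) : 'M[F]_n := eventual (fun r => wspan r d).
Definition fus_space : 'M[F]_n := eventual ufilt.
Definition fus_top : nat := (stab ufilt).+1.
Definition fus_op (s : nat) (A : 'M[F]_n) : 'M[F]_n := gr_op fus_top ufilt s A.
Definition fus_deg : 'M[F]_n := gr_deg fus_top ufilt.
End Fusion.

Definition joint_dim (S : 'M[F]_n) (Ds : seq ('M[F]_n * F)) : nat :=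
  \rank (foldr (fun Dl W => W :&: kermx (Dl.1 - Dl.2%:M))%MS S Ds).

Definition intertwining_iso m (K : Type) (S : 'M[F]_n) (A : K -> 'M[F]_n)
   (T : 'M[F]_m) (B : K -> 'M[F]_m) (Phi : 'M[F]_(n, m)) : Prop :=
  [/\ (S *m Phi == T)%MS, \rank (S *m Phi) = \rank S &
      forall x, S *m (A x *m Phi - Phi *m B x) = 0].

End Ambient.

(* Tensor products of L slots, each a copy of F^dd.                         *)
Definition tidx (L dd : nat) := {ffun 'I_L -> 'I_dd}.
Definition tdim (L dd : nat) : nat := #|{: tidx L dd}|.

(* the operator acting by rho j on the j-th tensor slot, summed over j      *)
Definition tens_op (L dd : nat) (rho : 'I_L -> 'M[F]_dd) : 'M[F]_(tdim L dd) :=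
  \matrix_(r, c)
    \sum_(j < L)
      (if [forall l, (l != j) ==> (@enum_val _ {: tidx L dd} r l
                                   == @enum_val _ {: tidx L dd} c l)]
       then rho j (@enum_val _ {: tidx L dd} r j) (@enum_val _ {: tidx L dd} c j)
       else 0).

Definition tbasis (L dd : nat) (f : tidx L dd) : 'rV[F]_(tdim L dd) :=
  delta_mx 0 (enum_rank f).

(* sl_3 side.  e_ab (1-based a,b) as 3x3 matrix units.                      *)
(* Pi_m is realized as the sl_3-submodule of (C^3)^{\otimes m} generated by *)
(* e_3^{\otimes m} (= Sym^m C^3, highest weight m w_1, lowest weight vector *)
(* e_3^{\otimes m}); bar Pi_m as the one of ((C^3)^* )^{\otimes m}          *)
(* generated by eps_1^{\otimes m} (highest weight m w_2).                   *)
(* With row vectors, x acts on C^3 by x^T and on (C^3)^* by -x.             *)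
Definition eab (a b : nat) : 'M[F]_3 := delta_mx (inord a.-1) (inord b.-1).
Definition hab (a b : nat) : 'M[F]_3 := eab a a - eab b b.
Definition slot_rep (dual : bool) (x : 'M[F]_3) : 'M[F]_3 :=
  if dual then - x else x^T.

Definition nletter (x : 'I_3) : 'M[F]_3 :=
  if val x == 0%N then eab 1 2 else if val x == 1%N then eab 1 3 else eab 2 3.

Section SL3.
Variables (p pbar : nat) (ks : 'I_p -> nat) (kbs : 'I_pbar -> nat)
          (zeta : 'I_(p + pbar) -> F).

(* slots: (is_dual, evaluation point) *)
Definition slots3 : seq (bool * F) :=
  flatten [seq nseq (ks i) (false, zeta (lshift pbar i)) | i <- enum 'I_p]
  ++ flatten [seq nseq (kbs i) (true, zeta (rshift p i)) | i <- enum 'I_pbar].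
Definition L3 : nat := size slots3.
Definition slot3 (j : 'I_L3) : bool * F := nth (false, 0) slots3 j.
Definition n3 : nat := tdim L3 3.

(* action of x \otimes t^i on the tensor product *)
Definition act3 (x : 'M[F]_3) (i : nat) : 'M[F]_n3 :=
  tens_op (fun j => ((slot3 j).2 ^+ i) *: slot_rep (slot3 j).1 x).
Definition E3 (x : 'I_3) (i : nat) : 'M[F]_n3 := act3 (nletter x) i.
Definition v3 : 'rV[F]_n3 :=
  tbasis [ffun j : 'I_L3 => if (slot3 j).1 then (inord 0 : 'I_3) else inord 2].
Definition D1amb : 'M[F]_n3 := act3 ((2%:R *: hab 1 2 + hab 2 3) / 3%:R) 0.
Definition D2amb : 'M[F]_n3 := act3 ((hab 1 2 + 2%:R *: hab 2 3) / 3%:R) 0.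

Definition V_space : 'M[F]_n3 := fus_space E3 v3.
Definition V_op (x : 'I_3) (i : nat) : 'M[F]_n3 := fus_op E3 v3 i (E3 x i).
Definition V_D0 : 'M[F]_n3 := fus_deg E3 v3.
Definition V_D1 : 'M[F]_n3 := fus_op E3 v3 0 D1amb.
Definition V_D2 : 'M[F]_n3 := fus_op E3 v3 0 D2amb.
Definition V_Z (i : nat) : 'M[F]_n3 := V_op (inord 1) i.          (* e_{13,i} *)
Definition V_L (b : bool) (i : nat) : 'M[F]_n3 :=
  V_op (if b then inord 0 else inord 2) i.                         (* e_{12,i}, e_{23,i} *)

Definition chV (d : nat) (s1 s2 : rat) : nat :=
  joint_dim V_space [:: (V_D0, d%:R); (V_D1, ratr s1); (V_D2, ratr s2)].

(* Filtration G on V: G^0 = U(b[t]) v, G^i = L G^{i-1} + G^{i-1}. *)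
Fixpoint zspan (r : nat) : 'M[F]_n3 :=
  match r with
  | 0 => <<v3>>%MS
  | r'.+1 => (<<v3>> + \sum_(i < r) (zspan r' *m V_Z i))%MS
  end.
Fixpoint Gfilt (i : nat) : 'M[F]_n3 :=
  match i with
  | 0 => eventual zspan
  | i'.+1 => eventual (fun r =>
       (Gfilt i' + \sum_(j < r) \sum_(b : bool) (Gfilt i' *m V_L b j))%MS)
  end.
Definition G_top : nat := (stab Gfilt).+1.
(* gr^G V : same underlying space, induced operators *)
Definition grG_Z (i : nat) : 'M[F]_n3 := gr_op G_top Gfilt 0 (V_Z i).
Definition grG_D0 : 'M[F]_n3 := gr_op G_top Gfilt 0 V_D0.
Definition grG_D1 : 'M[F]_n3 := gr_op G_top Gfilt 0 V_D1.
Definition grG_D2 : 'M[F]_n3 := gr_op G_top Gfilt 0 V_D2.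

Definition is_Zfiltration (H : nat -> 'M[F]_n3) (J : nat) : Prop :=
  [/\ forall j, (H j <= H j.+1)%MS,
      forall j, (H j <= V_space)%MS,
      (H J == V_space)%MS,
      forall j i, (H j *m grG_Z i <= H j)%MS &
      forall j, [/\ (H j *m grG_D0 <= H j)%MS, (H j *m grG_D1 <= H j)%MS
                  & (H j *m grG_D2 <= H j)%MS]].

End SL3.

(* sl_2 side: pi_a = sl_2-submodule of (C^2)^{\otimes a} generated by       *)
(* e_2^{\otimes a} (lowest weight vector u_a); e acts by E_12.              *)
(* pi_m = pi_1^{* m_1} * ... * pi_k^{* m_k}, the factors being evaluated at *)
(* the pairwise distinct points 0, 1, 2, ... (in characteristic 0).         *)
Section SL2.
Variables (k : nat) (mv : nat -> nat).

Definition pi_factors : seq nat := flatten [seq nseq (mv a) a | a <- iota 1 k].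
Definition slots2 : seq F :=
  flatten [seq nseq (nth 0%N pi_factors r) (r%:R : F) | r <- iota 0 (size pi_factors)].
Definition L2 : nat := size slots2.
Definition n2 : nat := tdim L2 2.
Definition act2 (x : 'M[F]_2) (i : nat) : 'M[F]_n2 :=
  tens_op (fun j : 'I_L2 => (nth 0 slots2 j ^+ i) *: x^T).
Definition e2 : 'M[F]_2 := delta_mx 0 1.
Definition h2 : 'M[F]_2 := delta_mx 0 0 - delta_mx 1 1.
Definition E2 (x : unit) (i : nat) : 'M[F]_n2 := act2 e2 i.
Definition u2 : 'rV[F]_n2 := tbasis [ffun j : 'I_L2 => (1 : 'I_2)].

Definition pi_space : 'M[F]_n2 := fus_space E2 u2.
Definition pi_e (i : nat) : 'M[F]_n2 := fus_op E2 u2 i (E2 tt i).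
Definition pi_D0 : 'M[F]_n2 := fus_deg E2 u2.
(* the sl_2 weight grading: h/2 (deg e_i = (i,1), deg u = (0,-|m|/2)) *)
Definition pi_Dw : 'M[F]_n2 := fus_op E2 u2 0 (act2 (2%:R^-1 *: h2) 0).
Definition chpi (d : nat) (s : rat) : nat :=
  joint_dim pi_space [:: (pi_D0, d%:R); (pi_Dw, ratr s)].
End SL2.

End Generic.

(* Tuples M, m in Z^k_{>=0} are functions nat -> nat read on 1..k.          *)
Definition qpoch (s n : nat) : {poly rat} := \prod_(j < n) (1 - 'X^(s + j)).
Definition qbin (m n : int) : {poly rat} :=
  if (0 <= n) && (n <= m) then qpoch (absz (m - n + 1)) (absz n) %/ qpoch 1 (absz n) else 0.

Definition lam (k : nat) (M : nat -> nat) (a : nat) : nat := \sum_(a <= i < k.+1) M i.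
Definition tnorm (k : nat) (M : nat -> nat) : nat := \sum_(1 <= a < k.+1) a * M a.

Definition Fpoly (k : nat) (M m : nat -> nat) : {poly rat} :=
  let l := lam k M in let mu := lam k m in
  'X^(\sum_(1 <= a < k) mu a.+1 * (l a - mu a))
  * \prod_(1 <= a < k.+1) qbin ((l a)%:Z - (mu a.+1)%:Z) ((mu a)%:Z - (mu a.+1)%:Z).

Definition mult (p : nat) (ks : 'I_p -> nat) (a : nat) : nat := #|[set i | ks i == a]|.
(* a finite k-tuple (bounded entries) seen as nat -> nat on 1..k *)
Definition tup (k B : nat) (m : {ffun 'I_k -> 'I_B}) (a : nat) : nat :=
  if a is a'.+1 then odflt 0%N (omap (fun i : 'I_k => val (m i)) (insub a')) else 0%N.

(* Only tuples with entries <= p (resp. <= pbar) are listed: for larger     *)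
(* entries F_{M,m} = 0 (the q-binomial [lambda_a - mu_{a+1}, m_a] vanishes  *)
(* since lambda_a <= p), so these terms of the sum are zero.                *)
Definition midx (k p pbar : nat) : finType :=
  ({ffun 'I_k -> 'I_p.+1} * {ffun 'I_k -> 'I_pbar.+1})%type.

Section Pairs.
Variables (k p pbar : nat) (M Mb : nat -> nat).

Definition mpl (mm : midx k p pbar) (a : nat) : nat := (tup mm.1 a + tup mm.2 a)%N.
Definition FF (mm : midx k p pbar) : {poly rat} :=
  Fpoly k M (tup mm.1) * Fpoly k Mb (tup mm.2).
Definition cexp (mm : midx k p pbar) : rat :=
  ((tnorm k M)%:R - (tnorm k Mb)%:R) / 3%:R
  - ((tnorm k (tup mm.1))%:R - (tnorm k (tup mm.2))%:R) / 2%:R.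

Variable F : fieldType.

(* The module  (+)_{m, bar m} M_{m, bar m} \otimes pi_{m + bar m}, where the *)
(* trivial graded module M_{m,bar m} has a homogeneous basis whose q-degrees *)
(* are listed in Ms (m, bar m).  It is realized as a block-diagonal sum of   *)
(* copies of pi_{m + bar m}, one per basis vector of M_{m, bar m}.           *)
Variable Ms : midx k p pbar -> seq nat.

Definition dflt_midx : midx k p pbar := ([ffun => ord0], [ffun => ord0]).
Definition summands : seq (midx k p pbar * nat) :=
  flatten [seq [seq (mm, d) | d <- Ms mm] | mm <- enum (midx k p pbar)].
Definition summand (i : 'I_(size summands)) : midx k p pbar * nat :=
  nth (dflt_midx, 0%N) summands i.
Definition tgt_dim (i : 'I_(size summands)) : nat := n2 F k (mpl (summand i).1).

Definition tgt_space : 'M[F]_(\sum_i tgt_dim i) :=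
  mxdiag (fun i => pi_space F k (mpl (summand i).1)).

(* operators: inl i = Z_i (acting as e_i on pi), inr 0/1/2 = D0/D1/D2.      *)
(* Gradings: D0 = (q-degree in M) + D0 on pi; with s the w = z1 z2 degree    *)
(* on pi and c = cexp, the monomial (z1 z2)^s (z1^{-1} z2)^c has            *)
(* D1 = s - c, D2 = s + c.                                                  *)
Definition tgt_op (x : nat + 'I_3) : 'M[F]_(\sum_i tgt_dim i) :=
  match x with
  | inl i => mxdiag (fun j => pi_e F k (mpl (summand j).1) i)
  | inr y =>
    if val y == 0%N then
      mxdiag (fun j => pi_D0 F k (mpl (summand j).1) + ((summand j).2%:R)%:M)
    else if val y == 1%N then
      mxdiag (fun j => pi_Dw F k (mpl (summand j).1) - (ratr (cexp (summand j).1))%:M)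
    else
      mxdiag (fun j => pi_Dw F k (mpl (summand j).1) + (ratr (cexp (summand j).1))%:M)
  end.
End Pairs.

Definition grH_op (F : fieldType) p pbar ks kbs zeta (H : nat -> 'M[F]_(n3 ks kbs zeta))
   (J : nat) (x : nat + 'I_3) : 'M[F]_(n3 ks kbs zeta) :=
  gr_op J.+1 H 0
    (match x with
     | inl i => @grG_Z F p pbar ks kbs zeta i
     | inr y => if val y == 0%N then grG_D0 ks kbs zeta
                else if val y == 1%N then grG_D1 ks kbs zeta
                else grG_D2 ks kbs zeta
     end).

(* Main.v *)
(* Write X, Y, Z for the generating series (currents) of the operators e_12, e_23, e_13, and put
   P_r = sum_i min(k_i, r), Pb_r = sum_i min(kb_i, r).  Everything follows from an explicit basis of
   the fusion product V.

   Relations.  In the tensor product the coefficients of X^a applied to the cyclic vector v become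
   polynomial after multiplication by prod_s (1 - zeta_s xi)^min(k_s, a); hence in V the coefficient
   of degree N of v X^a vanishes as soon as N + a > Pb_a, and likewise for Y with P.  Since X, Y, Z
   generate a Heisenberg algebra, normal ordering turns these two families of relations into
   v [Y^b X^a Z^c]_N = 0 in gr^G V whenever N + a + b + c > P_{b+c} + Pb_{a+c}.

   Leaves.  The operators induced on gr^G V commute, so that gr^G V is a quotient of a polynomial
   ring by an ideal containing these relations.  Splitting off one variable Y_0 at a time (through
   the derivation d/dY_0 and the shift Y_i -> Y_{i+1}) produces finitely many monomials in the Y_i,
   each with a list rho of site multiplicities, such that modulo the previous monomials each one
   generates a quotient of an sl_2 fusion product; doing this for Y and then for X leaves Z-modules
   that are quotients of pi_rho.  The same argument provides a monomial basis of pi_rho.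

   Conclusion.  The dimensions of these quotients add up to prod C(k_i + 2, 2) prod C(kb_i + 2, 2),
   and evaluation at distinct points exhibits as many independent vectors in V, so no further
   relation exists: the order of the leaves gives the filtration H, and the generating function of
   the leaves of a given type satisfies the q-Pascal recursion that defines F_{M,m}. *)

Require Import Defs.
From HB Require Import structures.
From mathcomp Require Import all_boot all_order all_algebra.
From mathcomp Require Import reals complex zify ring lra mpoly.
From Stdlib Require Import ClassicalEpsilon.
Set Implicit Arguments. Unset Strict Implicit. Unset Printing Implicit Defensive.
Import Order.TTheory GRing.Theory Num.Theory.
Local Open Scope ring_scope.

(** * Leaves and the ideal of one family of currents *)

(** Splitting off Y_0 imitates a short exact sequence. Let k + 1 be the largest site and ka' the
    others. The shift carries the relations for ka' (with min(., k + 1) added to the bound on the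
    remaining currents) to relations for k + 1, ka', and its image is the kernel of d/dY_0; the
    relations for k, ka' lift along d/dY_0 to relations for k + 1, ka'. So the quotient for k + 1,
    ka' is bounded by the quotients for ka' and for k, ka'. Maximality of k + 1 is needed for the
    lift: past the exponent k + 1 all the minima are constant. Each such step gives only an upper
    bound, so no ideal is ever computed exactly. The count C(k+3, 2) = C(k+2, 2) + (k+2), compared
    once with the rank of V, turns all the bounds into equalities. The obstacle is that X and Y do
    not commute on V: the relation for Y^b X^a Z^c is not a product of the two separate relations
    and holds only modulo a smaller step of G. It is obtained from a two-variable generating
    function, by comparing its degree in each variable with its order of vanishing on the
    diagonal. *)

Definition pmin (ka : seq nat) (r : nat) : nat := \sum_(k <- ka) minn k r.

Lemma pmin_cons k ka r : pmin (k :: ka) r = (minn k r + pmin ka r)%N.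
Proof. by rewrite /pmin big_cons. Qed.

Lemma pmin_perm ka kb r : perm_eq ka kb -> pmin ka r = pmin kb r.
Proof. exact: perm_big. Qed.

Lemma pmin_mono ka r s : (r <= s)%N -> (pmin ka r <= pmin ka s)%N.
Proof. by move=> rs; apply: leq_sum => k _; lia. Qed.

Lemma pmin_stable ka k r s :
  all (fun x => x <= k)%N ka -> (k <= r)%N -> (k <= s)%N -> pmin ka r = pmin ka s.
Proof.
move=> + kr ks; elim: ka => [|x ka IH]; first by rewrite /pmin !big_nil.
by case/andP=> xk /IH; rewrite !pmin_cons => ->; lia.
Qed.

Lemma pmin0 ka r : all (pred1 0%N) ka -> pmin ka r = 0%N.
Proof.
elim: ka => [|x ka IH]; first by rewrite /pmin big_nil.
by case/andP=> /eqP -> /IH; rewrite pmin_cons min0n.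
Qed.

(* Each leaf (l, rho) stands for the monomial in Y_0, Y_1, ... whose letters are listed in l, and for the
   multiset rho of sites that is left to the Z-currents once this monomial has been applied. *)
Inductive lvs : seq nat -> seq (seq nat * seq nat) -> Prop :=
| lvs_base ka : all (pred1 0%N) ka -> lvs ka [:: ([::], [::])]
| lvs_step ka k ka' L1 L2 : perm_eq ka (k.+1 :: ka') -> all (fun x => x <= k.+1)%N ka' ->
    lvs ka' L1 -> lvs (k :: ka') L2 ->
    lvs ka ([seq (map S lr.1, k.+1 :: lr.2) | lr <- L1] ++ [seq (0%N :: lr.1, lr.2) | lr <- L2]).

Lemma lvs_exists ka : exists L, lvs ka L.
Proof.
have [m] := ubnP (sumn ka + size ka)%N; elim: m ka => // m IH ka lem.
have [z|] := boolP (all (pred1 0%N) ka); first by eexists; exact: lvs_base.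
move=> nz.
have : exists2 x, x \in ka & all (fun y => y <= x)%N ka.
  have kn : ka != [::] by case: (ka) nz.
  elim: (ka) kn => // a s IHs _; case: s IHs => [|b s] IHs.
    by exists a; rewrite ?inE //= leqnn.
  have [//|x xs xm] := IHs; have [ax|xa] := leqP a x.
    by exists x; [rewrite inE xs orbT | apply/andP].
  exists a; first by rewrite inE eqxx.
  apply/andP; split => //; apply: sub_all xm => y /= yx; lia.
case=> -[|k] xk xm.
  by case/negP: nz; apply: sub_all xm => y; rewrite leqn0.
have P := perm_to_rem xk.
have M : all (fun x => x <= k.+1)%N (rem k.+1 ka).
  by move: xm; rewrite (perm_all _ P) => /andP[].
have sm : (sumn ka + size ka = k.+1 + sumn (rem k.+1 ka) + (@size nat (rem k.+1 ka)).+1)%N.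
  by rewrite (perm_sumn P) (perm_size P).
have [|L1 H1] := IH (rem k.+1 ka); first by lia.
have [|L2 H2] := IH (k :: rem k.+1 ka); first by rewrite /=; lia.
by eexists; exact: (lvs_step P M H1 H2).
Qed.

Section Ideals.
Variable A : comNzRingType.

(** The ideal generated by [G], given through its finite presentations, so that a property of the
    generators passes to the ideal by induction. *)
Inductive idl (G : A -> Prop) : A -> Prop :=
| idl0 : idl G 0
| idlMD a q u : G a -> idl G u -> idl G (q * a + u).

Lemma idl_gen G a : G a -> idl G a.
Proof. by move=> ga; rewrite -[a]mul1r -[1 * a]addr0; apply: idlMD => //; exact: idl0. Qed.

Lemma idlD G u w : idl G u -> idl G w -> idl G (u + w).
Proof. by elim=> [|a q x ga _ IH] iw; rewrite ?add0r // -addrA; apply: idlMD => //; exact: IH. Qed.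

Lemma idlM G q u : idl G u -> idl G (q * u).
Proof.
elim=> [|a r x ga _ IH]; first by rewrite mulr0; exact: idl0.
by rewrite mulrDr mulrA; apply: idlMD.
Qed.

Lemma idlN G u : idl G u -> idl G (- u).
Proof. by move=> iu; rewrite -mulN1r; exact: idlM. Qed.

Lemma idl_sum G I (r : seq I) (P : pred I) (f : I -> A) :
  (forall i, P i -> idl G (f i)) -> idl G (\sum_(i <- r | P i) f i).
Proof. by move=> H; apply: big_ind => //; [exact: idl0 | exact: idlD]. Qed.

End Ideals.

Section Gen.
Variables (C : comNzRingType) (A : comAlgType C).

(** Generation modulo [I] over the coefficient ring [C]. For the Y-family [C] is the polynomial ring
    in the X and Z variables, so the coefficients still carry the other currents. *)
Inductive gen (I : A -> Prop) (ys : seq A) : A -> Prop :=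
| gen_id u : I u -> gen I ys u
| gen_add c y u : y \in ys -> gen I ys u -> gen I ys (c *: y + u).

Variable G : A -> Prop.
Notation I := (idl G).

Lemma gen_mem ys y c : y \in ys -> gen I ys (c *: y).
Proof. by move=> yy; rewrite -[_ *: _]addr0; apply: gen_add => //; apply: gen_id; exact: idl0. Qed.

Lemma genD ys u w : gen I ys u -> gen I ys w -> gen I ys (u + w).
Proof.
move=> gu gw; elim: gu => [x ix|c y x yy _ IH].
  elim: gw => [z iz|c y z yy _ IH]; first by apply: gen_id; exact: idlD.
  by rewrite addrCA; apply: gen_add.
by rewrite -addrA; apply: gen_add.
Qed.

Lemma genZ ys a u : gen I ys u -> gen I ys (a *: u).
Proof.
elim=> [x ix|c y x yy _ IH]; first by apply: gen_id; rewrite -mulr_algl; exact: idlM.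
by rewrite scalerDr scalerA; apply: gen_add.
Qed.

Lemma gen_sub ys zs u : {subset ys <= zs} -> gen I ys u -> gen I zs u.
Proof.
move=> s; elim=> [x ix|c y x yy _ IH]; first exact: gen_id.
by apply: gen_add => //; exact: s.
Qed.

End Gen.

Section Family.
Variables (C : comNzRingType) (n : nat).
Hypothesis char0 : forall m, exists c : C, m.+1%:R * c = 1.
Local Notation A := {mpoly C[n.+1]}.

Definition yv (i : nat) : A := if insub i is Some j then 'X_(j : 'I_n.+1) else 0.
Definition ycur : {poly A} := \poly_(i < n.+1) yv i.
Definition monom (l : seq nat) : A := \prod_(i <- l) yv i.
(** Truncation at [n] makes the shift kill the last variable, so [sigma] is not injective; what
    counts is its image, the kernel of d/dY_0. *)
Definition sigma : A -> A := mmap (@mpolyC n.+1 C) (fun i : 'I_n.+1 => yv i.+1).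
HB.instance Definition _ := GRing.RMorphism.on sigma.
Local Notation d := (@mderiv n.+1 C ord0).

Lemma yvE (i : 'I_n.+1) : yv i = 'X_i.
Proof. by rewrite /yv valK. Qed.

Lemma yv_out i : (n < i)%N -> yv i = 0.
Proof. by move=> h; rewrite /yv insubF //; apply/negbTE; rewrite -leqNgt. Qed.

Lemma coef_ycur i : ycur`_i = yv i.
Proof. by rewrite coef_poly; case: ltnP => // h; rewrite yv_out. Qed.

Lemma sigma_yv i : sigma (yv i) = yv i.+1.
Proof.
have [h|h] := ltnP i n.+1; last by rewrite !yv_out ?rmorph0 // ltnW.
by rewrite -[ i ]/(val (Ordinal h)) yvE /sigma mmapX mmap1U.
Qed.

Lemma sigmaC c : sigma c%:MP = c%:MP.
Proof. by rewrite /sigma mmapC. Qed.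

Lemma sigmaZ c u : sigma (c *: u) = c *: sigma u.
Proof. by rewrite -!mul_mpolyC rmorphM /= sigmaC. Qed.

Lemma sigma_monom l : sigma (monom l) = monom (map S l).
Proof. by rewrite /monom rmorph_prod big_map; apply: eq_bigr => i _; exact: sigma_yv. Qed.

Lemma d_yv i : d (yv i) = (i == 0%N)%:R.
Proof.
have [h|h] := ltnP i n.+1; last by rewrite yv_out // raddf0; case: i h.
rewrite -[i in LHS]/(val (Ordinal h)) yvE mderivX mnm1E -[_ == ord0]val_eqE /=.
case: eqP => [i0|_]; last by rewrite scale0r.
have -> : Ordinal h = ord0 :> 'I_n.+1 by apply/val_inj.
by rewrite scale1r -[X in (X - _)%MM]add0m addmK mpolyX0.
Qed.

Lemma char0_eq0 (c : C) m : c *+ m.+1 = 0 -> c = 0.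
Proof.
case: (char0 m) => x hx h.
by rewrite -[c]mulr1 -hx mulrA mulr_natr h mul0r.
Qed.

(** In characteristic 0 a monomial containing Y_0 survives in the derivative, so only shifted
    variables can occur in [u]. *)
Lemma ker_d u : d u = 0 -> exists w, u = sigma w.
Proof.
move=> du; rewrite (mpolyE u).
have H0 m : m \in msupp u -> m ord0 = 0%N.
  move=> mu; case E: (m ord0) => [|k] //; exfalso.
  have := mcoeff_deriv ord0 (m - U_(ord0))%MM u.
  rewrite du mcoeff0 submK; last by rewrite lep1mP E.
  by move/esym/char0_eq0/eqP; rewrite mcoeff_eq0 mu.
rewrite big_seq; apply: (big_ind (fun x => exists w, x = sigma w)).
- by exists 0; rewrite rmorph0.
- by move=> _ _ [x ->] [y ->]; exists (x + y); rewrite rmorphD.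
move=> m /H0 m0.
suff [w ->] : exists w, 'X_[m] = sigma w by exists (u@_m *: w); rewrite sigmaZ.
rewrite mpolyXE_id; apply: (big_ind (fun x => exists w, x = sigma w)).
- by exists 1; rewrite rmorph1.
- by move=> _ _ [x ->] [y ->]; exists (x * y); rewrite rmorphM.
move=> i _; have [->|] := eqVneq i ord0; first by exists 1; rewrite m0 expr0 rmorph1.
case: i => -[|i] hi // _; exists (yv i ^+ m (Ordinal hi)).
by rewrite rmorphXn /= sigma_yv -yvE.
Qed.

Lemma d_surj u : exists w, d w = u.
Proof.
elim/mpolyind: u => [|c m p _ _ [w <-]]; first by exists 0; rewrite raddf0.
case: (char0 (m ord0)) => x hx.
exists ((c * x) *: 'X_[m + U_(ord0)] + w).
rewrite raddfD /= linearZ /= mderivX addmK mnmDE mnm1E eqxx addn1 scalerA; congr (_ *: _ + _).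
by rewrite -mulrA [x * _]mulrC hx mulr1.
Qed.

Lemma d_nilp u : exists t, iter t d u = 0.
Proof.
elim/mpolyind: u => [|c m p _ _ [t ht]]; first by exists 0%N.
have E s (x y : A) a : iter s d (a *: x + y) = a *: iter s d x + iter s d y.
  by elim: s => //= s ->; rewrite raddfD /= linearZ.
have Z s : iter s d (0 : A) = 0 by elim: s => //= s ->; rewrite raddf0.
exists ((m ord0).+1 + t)%N; rewrite E [in X in _ + X]iterD ht Z addr0 addnC iterD.
suff H k (m' : 'X_{1.. n.+1}) : (m' ord0 <= k)%N -> iter k.+1 d 'X_[m'] = 0 by rewrite H ?Z ?scaler0.
elim: k m' => [|k IH] m' hm'.
  by move: hm'; rewrite leqn0 => /eqP m0; rewrite iterS mderivX m0 scale0r.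
rewrite iterSr mderivX -[_ *: _]addr0 E Z addr0 IH ?scaler0 //.
by rewrite mnmBE mnm1E eqxx; lia.
Qed.

Lemma monom_cons i l : monom (i :: l) = yv i * monom l.
Proof. by rewrite /monom big_cons. Qed.

Lemma d_monom0 l : d (monom (0%N :: l)) = (count_mem 0%N l).+1%:R *: monom l.
Proof.
elim: l => [|i l IH].
  by rewrite /monom big_seq1 d_yv big_nil scale1r.
rewrite !monom_cons mulrCA mderivM -(monom_cons 0) d_yv IH monom_cons -scalerAr /=.
case: (eqVneq i 0%N) => [->|_] /=; last by rewrite mul0r add0r.
rewrite mul1r -[X in X + _]scale1r -scalerDl. congr (_ *: _).
Qed.

Variables (T : Type) (g : T -> {poly C}) (co of_ : T -> nat).

(** The index [t] carries the currents outside this family: [g t] is a product of their powers,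
    [of_ t] its total exponent, [co t] the part of it that competes with [r] for the sites [ka], and
    [be t] the bound coming from all other sites. For t = (a, c), g = X^a Z^c, co = c, of_ = a + c,
    be = Pb_{a+c} this is the relation for Y^r X^a Z^c. *)
Definition ygen (ka : seq nat) (be : T -> nat) (a : A) : Prop :=
  exists t r N, (pmin ka (r + co t) + be t < N + r + of_ t)%N /\
    a = (ycur ^+ r * map_poly (@mpolyC n.+1 C) (g t))`_N.

Definition cgen (be : T -> nat) (a : C) : Prop :=
  exists t N, (be t < N + of_ t)%N /\ a = (g t)`_N.

Local Notation gt t := (map_poly (@mpolyC n.+1 C) (g t)).

Lemma ygenP ka be t r N : (pmin ka (r + co t) + be t < N + r + of_ t)%N ->
  ygen ka be (ycur ^+ r * gt t)`_N.
Proof. by move=> h; exists t, r, N. Qed.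

Lemma ycur_shift : map_poly sigma ycur * 'X = ycur - (yv 0)%:P.
Proof.
apply/polyP => -[|i]; rewrite coefMX coefB coefC coef_ycur /= ?subrr //.
by rewrite coef_map_id0 ?rmorph0 // coef_ycur sigma_yv subr0.
Qed.

(** As sigma(Y) = (Y - Y_0) / xi, the coefficient of degree [N] of Y^r g becomes the one of degree N
    + r of (Y - Y_0)^r g. The gain of r in degree pays for the site [k], since min(k, s + co) <=
    min(k, co) + s. *)
Lemma sigma_ygen ka k be a : ygen ka (fun t => be t + minn (co t) k)%N a ->
  idl (ygen (k :: ka) be) (sigma a).
Proof.
case=> t [r [N [h ->]]].
have -> : sigma (ycur ^+ r * gt t)`_N = ((ycur - (yv 0)%:P) ^+ r * gt t)`_(N + r).
  rewrite -ycur_shift exprMn mulrAC coefMXn ltnNge leq_addl /= addnK.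
  rewrite -[LHS](coef_map_id0 _ _ (rmorph0 _)) rmorphM rmorphXn /=; congr (nth 0 (polyseq (_ * _)) N).
  apply/polyP => i; rewrite !coef_map_id0 ?rmorph0 ?mpolyC0 //; exact: sigmaC.
rewrite exprBn mulr_suml coef_sum; apply: idl_sum => /= i _.
rewrite mulrnAl coefMn -mulr_natl; apply: idlM.
have -> : ((-1) ^+ i * ycur ^+ (r - i) * (yv 0)%:P ^+ i * gt t)`_(N + r)
   = (-1) ^+ i * yv 0 ^+ i * (ycur ^+ (r - i) * gt t)`_(N + r).
  have -> : (-1 : {poly A}) ^+ i = ((-1) ^+ i)%:P by rewrite polyC_exp polyCN.
  by rewrite -polyC_exp mulrAC coefMC -[_%:P * _ * gt t]mulrA coefCM mulrAC.
apply: idlM; apply: idl_gen; apply: ygenP.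
have := pmin_mono ka (_ : r - i + co t <= r + co t)%N; rewrite pmin_cons.
have := ltn_ord i; lia.
Qed.

Lemma sigma_idl ka k be a : idl (ygen ka (fun t => be t + minn (co t) k)%N) a ->
  idl (ygen (k :: ka) be) (sigma a).
Proof.
elim=> [|x q u gx _ IH]; first by rewrite rmorph0; exact: idl0.
by rewrite rmorphD rmorphM; apply: idlD => //; apply: idlM; exact: sigma_ygen.
Qed.

(** d/dY_0 sends the current Y to the constant polynomial 1, hence Y^r to r Y^(r-1) with the same
    degree index [N]. *)
Lemma d_ycurX r t N q : d ((ycur ^+ r * gt t)`_N * q) =
  r%:R * (ycur ^+ r.-1 * gt t)`_N * q + (ycur ^+ r * gt t)`_N * d q.
Proof.
rewrite mderivM; congr (_ * _ + _).
have dY : map_poly d ycur = 1.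
  by apply/polyP => i; rewrite coef_map_id0 ?raddf0 // coef_ycur d_yv coef1.
have dM (x y : {poly A}) : map_poly d (x * y) = map_poly d x * y + x * map_poly d y.
  apply/polyP => i; rewrite coef_map_id0 ?raddf0 // coefD !coefM raddf_sum -big_split /=.
  by apply: eq_bigr => j _; rewrite mderivM !coef_map_id0 ?raddf0.
have dX s : map_poly d (ycur ^+ s) = s%:R * ycur ^+ s.-1.
  elim: s => [|s IHs].
    by apply/polyP => i; rewrite mul0r coef0 coef_map_id0 ?raddf0 // coef1 -mpolyC_nat mderivC.
  rewrite exprS dM dY IHs /= mul1r; case: s {IHs} => [|s]; first by rewrite mul0r mulr0 addr0 mul1r.
  by rewrite /= mulrCA -exprS -[X in X + _]mul1r -mulrDl -[in RHS]nat1r.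
rewrite -[LHS](coef_map_id0 _ _ (raddf0 _)) dM dX.
have -> : map_poly d (gt t) = 0.
  by apply/polyP => i; rewrite !coef_map_id0 ?raddf0 // ?mpolyC0 // mderivC coef0.
by rewrite mulr0 addr0 -mulrA -polyC_natr coefCM.
Qed.

(** A primitive of a relation times [q] is built by integration by parts, in a direction that
    depends on the size of the exponent. *)
Lemma d_ygen ka k be a q : all (fun x => x <= k.+1)%N ka -> ygen (k :: ka) be a ->
  exists2 w, idl (ygen (k.+1 :: ka) be) w & d w = a * q.
Proof.
move=> mx [t [r [N [h ->]]]]; move: h; rewrite pmin_cons => h.
(* Small exponent: min(k, r + co) = r + co, so every power Y^s with s <= r still satisfies the bound
   at degree [N] for the site k + 1. The error term r Y^(r-1) q1 is absorbed by descending to r =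
   0. *)
have [rk|kr] := ltnP (r + co t) k.+1.
  have H s : (s <= r)%N -> (pmin (k.+1 :: ka) (s + co t) + be t < N + s + of_ t)%N.
    move=> sr; rewrite pmin_cons; have := pmin_mono ka (_ : s + co t <= r + co t)%N; lia.
  elim: r H {h rk} q => [|r IH] H q.
    have [q1 dq1] := d_surj q.
    exists ((ycur ^+ 0 * gt t)`_N * q1); last by rewrite d_ycurX !mul0r add0r dq1.
    by rewrite mulrC; apply: idlM; apply: idl_gen; apply: ygenP; exact: H.
  have [q1 dq1] := d_surj q.
  have [|w iw dw] := IH _ (r.+1%:R * q1); first by move=> s sr; apply: H; rewrite ltnW.
  exists ((ycur ^+ r.+1 * gt t)`_N * q1 - w).
    apply: idlD; last exact: idlN.
    by rewrite mulrC; apply: idlM; apply: idl_gen; apply: ygenP; exact: H.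
  by rewrite raddfB /= d_ycurX dq1 dw /= mulrCA mulrA addrAC subrr add0r.
(* Large exponent: the minima over [k.+1 :: ka] are saturated, so a higher power keeps the bound and
   gains at least one, which pays for k + 1 in place of k. The error term Y^(r+1) d q disappears
   because d is locally nilpotent. *)
have H s : (r < s)%N -> (pmin (k.+1 :: ka) (s + co t) + be t < N + s + of_ t)%N.
  move=> sr; rewrite pmin_cons.
  by rewrite (@pmin_stable ka k.+1 (s + co t) (r + co t)) //; lia.
have [m] := d_nilp q; elim: m q r H {h kr} => [|m IH] q r H.
  by move=> /= ->; exists 0; [exact: idl0 | rewrite raddf0 mulr0].
rewrite iterSr => hm; case: (char0 r) => c hc.
have [||w iw dw] := IH (c *: d q) r.+1.
- by move=> s rs; apply: H; exact: ltnW.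
- have E s (x : A) : iter s d (c *: x) = c *: iter s d x.
    by elim: s => //= s ->; rewrite linearZ.
  by rewrite E hm scaler0.
exists (c *: ((ycur ^+ r.+1 * gt t)`_N * q) - w).
  apply: idlD; last exact: idlN.
  rewrite -mul_mpolyC mulrCA mulrC; apply: idlM.
  by apply: idl_gen; apply: ygenP; exact: H.
rewrite raddfB /= linearZ /= d_ycurX dw /= scalerDr -scalerAr addrK.
by rewrite -mulrA mulr_natl -scaler_nat scalerA [c * _]mulrC hc scale1r.
Qed.

Lemma d_idl ka k be u : all (fun x => x <= k.+1)%N ka -> idl (ygen (k :: ka) be) u ->
  exists2 w, idl (ygen (k.+1 :: ka) be) w & d w = u.
Proof.
move=> mx; elim=> [|a q x ga _ [w iw <-]]; first by exists 0; [exact: idl0 | rewrite raddf0].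
have [w' iw' dw'] := d_ygen q mx ga; exists (w' + w); first exact: idlD.
by rewrite raddfD /= dw' mulrC.
Qed.

Lemma idl_perm ka kb be u : perm_eq ka kb -> idl (ygen ka be) u -> idl (ygen kb be) u.
Proof.
move=> P; elim=> [|a q x [t [r [N [h ->]]]] _ IH]; first exact: idl0.
by apply: idlMD => //; apply: ygenP; rewrite -(pmin_perm _ P).
Qed.

Lemma gen_perm ka kb be ys u : perm_eq ka kb ->
  gen (idl (ygen ka be)) ys u -> gen (idl (ygen kb be)) ys u.
Proof.
move=> P; elim=> [x ix|c y x yy _ IH]; last exact: gen_add.
by apply: gen_id; exact: idl_perm ix.
Qed.

Lemma gen_sigma ka k be ls u :
  gen (idl (ygen ka (fun t => be t + minn (co t) k)%N)) [seq monom l | l <- ls] u ->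
  gen (idl (ygen (k :: ka) be)) [seq monom (map S l) | l <- ls] (sigma u).
Proof.
elim=> [x ix|c y x /mapP[l ll ->] _ IH]; first by apply: gen_id; exact: sigma_idl.
by rewrite rmorphD /= sigmaZ sigma_monom; apply: gen_add => //; exact: map_f.
Qed.

Lemma gen_d ka k be ls u : all (fun x => x <= k.+1)%N ka ->
  gen (idl (ygen (k :: ka) be)) [seq monom l | l <- ls] u ->
  exists2 w, gen (idl (ygen (k.+1 :: ka) be)) [seq monom (0%N :: l) | l <- ls] w & d w = u.
Proof.
move=> mx; elim=> [x ix|c y x /mapP[l ll ->] _ [w gw <-]].
  by have [w iw <-] := d_idl mx ix; exists w => //; exact: gen_id.
case: (char0 (count_mem 0%N l)) => e he.
exists ((c * e) *: monom (0%N :: l) + w); first by apply: gen_add => //; exact: map_f.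
by rewrite raddfD /= linearZ /= d_monom0 scalerA -mulrA [e * _]mulrC he mulr1.
Qed.

Hypothesis unit_t : exists t, [/\ g t = 1, co t = 0%N & of_ t = 0%N].

(* Induction on lvs: the image of sigma is the kernel of d, the first branch comes from sigma and the
   second one from d, along which relations can be lifted (d_idl). *)
Theorem family_leaves ka L : lvs ka L -> forall be,
  (forall t, co t = 0%N -> of_ t = 0%N -> be t = 0%N) ->
  let I := idl (ygen ka be) in
  (forall u, gen I [seq monom lr.1 | lr <- L] u) /\
  (forall j x, (j < size L)%N ->
     idl (cgen (fun t => be t + pmin (nth ([::], [::]) L j).2 (co t))%N) x ->
     gen I [seq monom lr.1 | lr <- take j L] (x *: monom (nth ([::], [::]) L j).1)).
Proof.
elim=> {ka L} [ka z|ka k ka' L1 L2 P mx _ IH1 _ IH2] be be0 I.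
  case: unit_t => t0 [g1 c0 o0].
  (* With all sites equal to 0 the bound for r = 1 reads 0 < i + 1: every variable is a relation and
     only the empty monomial survives. *)
  have iX (i : 'I_n.+1) : I 'X_i.
    apply: idl_gen; rewrite -yvE -coef_ycur; exists t0, 1%N, i.
    by rewrite pmin0 // be0 // o0 g1 expr1 rmorph1 mulr1 addn0; split => //; lia.
  split=> [u|j x].
    rewrite [u]mpolyE; apply: big_ind => [|x y hx hy|m _]; first by apply: gen_id; exact: idl0.
      exact: genD.
    apply: genZ; have [->|] := eqVneq m 0%MM.
      by rewrite mpolyX0 -[1]scale1r; apply: gen_mem; rewrite inE /monom big_nil.
    move=> m0; have [i mi] : exists i, m i != 0%N.
      apply/existsP; apply: contraNT m0; rewrite negb_exists => /forallP h.
      by apply/eqP/mnmP => i; apply/eqP; rewrite mnm0E; have := h i; rewrite negbK.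
    apply: gen_id; rewrite -(@submK _ U_(i) m); last by rewrite lep1mP.
    rewrite mpolyXD; apply: idlM; exact: iX.
  rewrite ltnS leqn0 => /eqP -> /= ix; apply: gen_id.
  rewrite /monom big_nil -mul_mpolyC mulr1.
  elim: ix => [|a q y [t [N [h ->]]] _ IH]; first by rewrite mpolyC0; exact: idl0.
  rewrite mpolyCD mpolyCM; apply: idlD => //; apply: idlM; apply: idl_gen.
  exists t, 0%N, N; rewrite pmin0 // expr0 mul1r coef_map_id0 ?mpolyC0 //; split=> //.
  by move: h; rewrite /pmin big_nil; lia.
have PI u ys : gen (idl (ygen (k.+1 :: ka') be)) ys u -> gen I ys u.
  by apply: gen_perm; rewrite perm_sym.
have [|E1 R1] := IH1 (fun t => be t + minn (co t) k.+1)%N.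
  by move=> t c0 o0; rewrite be0 // c0 min0n.
have [|E2 R2] := IH2 be => //.
have map1 (L : seq (seq nat * seq nat)) : [seq monom lr.1 | lr <- L]
   = [seq monom l | l <- unzip1 L] by rewrite -map_comp.
have mapS1 (L : seq (seq nat * seq nat)) :
  [seq monom lr.1 | lr <- [seq (map S lr.1, k.+1 :: lr.2) | lr <- L]]
   = [seq monom (map S l) | l <- unzip1 L] by rewrite -!map_comp.
have map02 (L : seq (seq nat * seq nat)) :
  [seq monom lr.1 | lr <- [seq (0%N :: lr.1, lr.2) | lr <- L]]
   = [seq monom (0%N :: l) | l <- unzip1 L] by rewrite -!map_comp.
have K u : d u = 0 -> gen I [seq monom (map S l) | l <- unzip1 L1] u.
  by case/ker_d=> w ->; apply: PI; apply: gen_sigma; rewrite -map1.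
(* Subtracting a lift of the derivative leaves an element of the kernel of d, which the first branch
   generates. *)
have S2 ls u : gen (idl (ygen (k :: ka') be)) [seq monom l | l <- ls] (d u) ->
   gen I ([seq monom (map S l) | l <- unzip1 L1] ++ [seq monom (0%N :: l) | l <- ls]) u.
  case/(gen_d mx)=> w gw dw; rewrite -[u](subrK w); apply: genD.
    apply: gen_sub (K _ _); first by move=> y yy; rewrite mem_cat yy.
    by rewrite raddfB /= dw subrr.
  by apply: gen_sub (PI _ _ gw) => y yy; rewrite mem_cat yy orbT.
split=> [u|j x].
  by rewrite map_cat mapS1 map02; apply: S2; rewrite -map1.
rewrite size_cat !size_map => jl.
rewrite nth_cat take_cat size_map; case: ltnP => j1.
  rewrite (nth_map ([::], [::])) // -map_take mapS1 /= => ix.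
  apply: PI; rewrite -sigma_monom -sigmaZ; apply: gen_sigma; rewrite -map1; apply: R1 => //.
  (* The entry [k.+1] at the head of the site list of these leaves is the summand min(co t, k + 1)
     that the induction hypothesis adds to [be]. *)
  elim: ix => [|a q y [t [N [h ->]]] _ IH]; [exact: idl0 | apply: idlMD => //].
  by exists t, N; split => //; move: h; rewrite pmin_cons minnC; lia.
have j2 : (j - size L1 < size L2)%N by lia.
rewrite (nth_map ([::], [::])) //= map_cat mapS1 -map_take map02 => ix.
apply: S2; rewrite linearZ /= d_monom0 scalerA mulrC -scalerA -map1; apply: genZ.
exact: R2.
Qed.

End Family.

(** * Associated graded spaces and fusion products *)

Section Chains.
Variables (F : fieldType) (n : nat).
Implicit Types f : nat -> 'M[F]_n.

Lemma chain_le f : (forall r, f r <= f r.+1)%MS -> forall r s, (r <= s)%N -> (f r <= f s)%MS.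
Proof.
move=> H r s rs; rewrite -(subnK rs); elim: (s - r)%N => [|m IH] //=.
exact: submx_trans IH (H _).
Qed.

(** [stab] is chosen by epsilon, so an index of stabilization has to be exhibited: the codimension
    of [f r] can drop only finitely often. *)
Lemma stabP f : (forall r, f r <= f r.+1)%MS ->
  forall r, (stab f <= r)%N -> (f r == f (stab f))%MS.
Proof.
move=> H; apply: (epsilon_spec (inhabits 0%N) (fun r => forall r', (r <= r')%N -> (f r' == f r)%MS)).
suff W d : forall r, (n - \rank (f r) < d)%N ->
    exists r0, forall r', (r0 <= r')%N -> (f r' == f r0)%MS by exact: (W _ 0%N (ltnSn _)).
elim: d => // d IH r hr.
case: (classic (forall r', (r <= r')%N -> (f r' == f r)%MS)) => [|h]; first by exists r.
have [r' rr' nr'] : exists2 r', (r <= r')%N & ~~ (f r' == f r)%MS.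
  apply: NNPP => h'; apply: h => r' rr'; apply/negP => /negP nr'; by apply: h'; exists r'.
apply: (IH r'); have := mxrank_leqif_eq (chain_le H rr').
have := rank_leq_row (f r'); rewrite /leqif.
have -> : (f r == f r')%MS = false by rewrite andbC; apply: negbTE.
by move=> ? [? /negbT/eqP]; lia.
Qed.

Lemma eventual_sup f : (forall r, f r <= f r.+1)%MS -> forall r, (f r <= eventual f)%MS.
Proof.
move=> H r; have [h|h] := leqP (stab f) r; first by case/andP: (stabP H h).
exact: chain_le (ltnW h).
Qed.

End Chains.

Section Graded.
Variables (F : fieldType) (n : nat) (Fl : nat -> 'M[F]_n).
Hypothesis incr : forall j, (Fl j <= Fl j.+1)%MS.

(** The symbol map: the class of [u] modulo the previous step, represented in the chosen
    complement. *)
Definition sym m (j : nat) (u : 'M[F]_(m, n)) : 'M[F]_(m, n) := u *m grQ Fl j.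

Lemma prevsp_le j : (prevsp Fl j <= Fl j)%MS.
Proof. by case: j => [|j] /=; rewrite ?sub0mx. Qed.

Lemma Fl_prevsp i j : (i < j)%N -> (Fl i <= prevsp Fl j)%MS.
Proof. by case: j => // j; rewrite ltnS; exact: chain_le. Qed.

Lemma grC_cap j : (grC Fl j :&: prevsp Fl j)%MS = 0.
Proof. exact: capmx_diff. Qed.

Lemma grC_sub j : (grC Fl j <= Fl j)%MS.
Proof. exact: diffmxSl. Qed.

Lemma grC_adds j : (grC Fl j + prevsp Fl j :=: Fl j)%MS.
Proof.
apply/eqmxP/andP; split; first by rewrite addsmx_sub grC_sub prevsp_le.
by rewrite -{1}(addsmx_diff_cap_eq (Fl j) (prevsp Fl j)) addsmxS // capmxSr.
Qed.

Lemma grC0 : (grC Fl 0 :=: Fl 0)%MS.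
Proof. exact: eqmx_trans (eqmx_sym (addsmx0 n _)) (grC_adds 0). Qed.

Lemma sym_sub m j (u : 'M_(m, n)) : (sym j u <= grC Fl j)%MS.
Proof. exact: proj_mx_sub. Qed.

Lemma sym_compl m j (u : 'M_(m, n)) : (u <= Fl j)%MS -> (u - sym j u <= prevsp Fl j)%MS.
Proof. by move=> uj; apply: proj_mx_compl_sub; rewrite grC_adds. Qed.

Lemma sym_id m j (u : 'M_(m, n)) : (u <= grC Fl j)%MS -> sym j u = u.
Proof. by move=> uj; apply: proj_mx_id => //; exact: grC_cap. Qed.

Lemma sym_low m j (u : 'M_(m, n)) : (u <= prevsp Fl j)%MS -> sym j u = 0.
Proof. by move=> uj; apply: proj_mx_0 => //; exact: grC_cap. Qed.

Lemma sym_eq0 m j (u : 'M_(m, n)) : (u <= Fl j)%MS -> sym j u = 0 -> (u <= prevsp Fl j)%MS.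
Proof. by move=> uj s0; have := sym_compl uj; rewrite s0 subr0. Qed.

Lemma symD m j (u w : 'M_(m, n)) : sym j (u + w) = sym j u + sym j w.
Proof. exact: mulmxDl. Qed.
Lemma symB m j (u w : 'M_(m, n)) : sym j (u - w) = sym j u - sym j w.
Proof. exact: mulmxBl. Qed.
Lemma symZ m j a (u : 'M_(m, n)) : sym j (a *: u) = a *: sym j u.
Proof. by rewrite /sym -scalemxAl. Qed.
Lemma symM m m' j (x : 'M_(m', m)) (u : 'M_(m, n)) : sym j (x *m u) = x *m sym j u.
Proof. by rewrite /sym mulmxA. Qed.
Lemma sym_sum m j I (r : seq I) (P : pred I) (u : I -> 'M_(m, n)) :
  sym j (\sum_(i <- r | P i) u i) = \sum_(i <- r | P i) sym j (u i).
Proof. by rewrite /sym mulmx_suml. Qed.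

Variable J : nat.
Hypothesis top : forall j, (J <= j)%N -> (Fl j.+1 <= Fl j)%MS.

Lemma grC_top j : (J < j)%N -> grC Fl j = 0.
Proof.
case: j => // j; rewrite ltnS => Jj; apply/eqP; rewrite -submx0 -(grC_cap j.+1) sub_capmx submx_refl /=.
exact: submx_trans (grC_sub _) (top Jj).
Qed.

Lemma sym_top m j (u : 'M_(m, n)) : (J < j)%N -> sym j u = 0.
Proof. by move=> /grC_top g0; apply/eqP; rewrite -submx0 -g0; exact: sym_sub. Qed.

Lemma sum_grC k : (\sum_(j < k.+1) grC Fl j :=: Fl k)%MS.
Proof.
elim: k => [|k IH]; first by rewrite big_ord1; exact: grC0.
rewrite big_ord_recr /=; apply: eqmx_trans (grC_adds k.+1).
by rewrite addsmxC; apply: adds_eqmx.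
Qed.

Lemma grC_direct k : mxdirect (\sum_(j < k.+1) grC Fl j).
Proof.
rewrite mxdirectE /= sum_grC; apply/eqP; elim: k => [|k IH].
  by rewrite big_ord1 grC0.
rewrite big_ord_recr /= -IH -(mxrank_cap_compl (Fl k.+1) (Fl k)); congr (_ + _)%N.
by apply/eqP; rewrite (mxrank_leqif_sup (capmxSr _ _)) sub_capmx submx_refl incr.
Qed.

Lemma grP_id m j (u : 'M_(m, n)) : (j <= J)%N -> (u <= grC Fl j)%MS -> u *m grP J.+1 Fl j = u.
Proof.
move=> jJ uj; rewrite /grP proj_mx_id //.
have /mxdirect_sumsP := grC_direct J => /(_ (Ordinal (jJ : j < J.+1)%N) isT) /= h; rewrite -[RHS]h.
by congr (_ :&: _)%MS; apply: eq_bigl => i.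
Qed.

Lemma grP_0 m i j (u : 'M_(m, n)) : (i <= J)%N -> (j <= J)%N -> i != j ->
  (u <= grC Fl i)%MS -> u *m grP J.+1 Fl j = 0.
Proof.
move=> iJ jJ ij ui; rewrite /grP proj_mx_0 //.
  have /mxdirect_sumsP := grC_direct J => /(_ (Ordinal (jJ : j < J.+1)%N) isT) /= h; rewrite -[RHS]h.
  by congr (_ :&: _)%MS; apply: eq_bigl => i'.
by apply: submx_trans ui _; apply: (sumsmx_sup (Ordinal (iJ : i < J.+1)%N)).
Qed.

Lemma gr_op_grC m j s A (u : 'M_(m, n)) : (u <= grC Fl j)%MS ->
  u *m gr_op J.+1 Fl s A = sym (j + s) (u *m A).
Proof.
have [jJ|Jj] := leqP j J; last first.
  rewrite (grC_top Jj) submx0 => /eqP ->; rewrite !mul0mx; apply/esym; exact: mul0mx.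
move=> uj; rewrite /gr_op mulmx_sumr (bigD1 (Ordinal (jJ : j < J.+1)%N)) //= mulmxA [u *m _]mulmxA grP_id //.
rewrite big1 ?addr0 // => i ij; rewrite mulmxA [u *m _]mulmxA (@grP_0 _ j) ?mul0mx //.
- by rewrite -ltnS.
- by rewrite eq_sym; apply: contra ij => /eqP ij; apply/eqP/val_inj.
Qed.

(** A vector and its symbol differ by an element of the previous step, which [A] sends below level j
    + s; so on symbols the induced operator does not depend on the complements. *)
Lemma gr_opE m j s A (u : 'M_(m, n)) : (forall i, Fl i *m A <= Fl (i + s))%MS ->
  (u <= Fl j)%MS -> sym j u *m gr_op J.+1 Fl s A = sym (j + s) (u *m A).
Proof.
move=> HA uj; rewrite (gr_op_grC _ _ (sym_sub j u)) //; apply/eqP; rewrite -subr_eq0 -symB -mulmxBl.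
apply/eqP; apply: sym_low; rewrite -opprB mulNmx eqmx_opp.
apply: submx_trans (submxMr _ (sym_compl uj)) _.
by case: j {uj} => [|j] /=; rewrite ?mul0mx ?sub0mx // addSn.
Qed.

Lemma gr_degE m j (u : 'M_(m, n)) : (u <= grC Fl j)%MS -> u *m gr_deg J.+1 Fl = j%:R *: u.
Proof.
have [jJ|Jj] := leqP j J; last first.
  by rewrite (grC_top Jj) submx0 => /eqP ->; rewrite mul0mx scaler0.
move=> uj; rewrite /gr_deg mulmx_sumr (bigD1 (Ordinal (jJ : j < J.+1)%N)) //=.
rewrite -scalemxAr grP_id // big1 ?addr0 // => i ij; rewrite -scalemxAr (@grP_0 _ j) ?scaler0 //.
- by rewrite -ltnS.
- by rewrite eq_sym; apply: contra ij => /eqP ij; apply/eqP/val_inj.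
Qed.

Lemma sym0E m (u : 'M_(m, n)) : (u <= Fl 0)%MS -> sym 0 u = u.
Proof. by move=> u0; apply: sym_id; rewrite grC0. Qed.

(** This brings the basis found in gr^G V back to V, where the character is computed. *)
Lemma span_of_symbols (I : finType) (lv : I -> nat) (e : I -> 'rV_n) :
  (forall i, e i <= Fl (lv i))%MS ->
  (Fl J <= \sum_i <<sym (lv i) (e i)>>)%MS -> (Fl J <= \sum_i <<e i>>)%MS.
Proof.
move=> el sp.
have W j : (j <= J)%N -> (prevsp Fl j <= \sum_i <<e i>>)%MS -> (Fl j <= \sum_i <<e i>>)%MS.
  move=> jJ pj; apply/rV_subP => u uj.
  have /sub_sumsmxP[c cE] : (sym j u <= \sum_i <<sym (lv i) (e i)>>)%MS.
    by apply: submx_trans sp; apply: submx_trans (sym_sub _ _) (submx_trans (grC_sub _) _); exact: chain_le.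
  have D i : exists a : 'M_1, c i *m <<sym (lv i) (e i)>>%MS = a *m sym (lv i) (e i).
    by apply/submxP; rewrite mulmx_sub // genmxE.
  have [a aE] := fin_all_exists D.
  (* Projection to degree j: only the symbols with [lv i == j] contribute. *)
  have E : sym j u = \sum_(i | lv i == j) a i *m sym j (e i).
    rewrite -(grP_id jJ (sym_sub j u)) {1}cE mulmx_suml big_mkcond /= [RHS]big_mkcond /=.
    apply: eq_bigr => i _; rewrite aE -mulmxA; case: eqP => [<-|/eqP ij].
      have [h|h] := leqP (lv i) J; first by rewrite grP_id ?sym_sub.
      by rewrite sym_top // mul0mx.
    have [h|h] := leqP (lv i) J; first by rewrite (grP_0 h) ?mulmx0 ?sym_sub.
    by rewrite sym_top // mul0mx mulmx0.
  rewrite -(subrK (\sum_(i | lv i == j) a i *m e i) u) addmx_sub //.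
    apply: submx_trans pj; apply: sym_eq0.
      rewrite addmx_sub // eqmx_opp summx_sub // => i /eqP <-; exact: mulmx_sub.
    by rewrite symB E sym_sum; apply/eqP; rewrite subr_eq0; apply/eqP/eq_bigr => i _; rewrite symM.
  by rewrite summx_sub // => i _; rewrite mulmx_sub // (sumsmx_sup i) // genmxE.
suff H j : (j <= J)%N -> (Fl j <= \sum_i <<e i>>)%MS by exact: H.
elim: j => [|j IH] jJ; apply: W => //=; [exact: sub0mx | exact: IH (ltnW jJ)].
Qed.

End Graded.

Section GradedMore.
Variables (F : fieldType) (n : nat) (Fl : nat -> 'M[F]_n).
Hypothesis incr : forall j, (Fl j <= Fl j.+1)%MS.
Variable J : nat.
Hypothesis top : forall j, (J <= j)%N -> (Fl j.+1 <= Fl j)%MS.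

Lemma gr_ind (T : 'M_n) : (forall j (u : 'rV_n), (u <= Fl j)%MS -> (sym Fl j u <= T)%MS) ->
  (Fl J <= T)%MS.
Proof.
move=> H; rewrite -(sum_grC incr J); apply/sumsmx_subP => j _.
apply/rV_subP => u uj; rewrite -(sym_id uj); apply: H.
exact: submx_trans uj (grC_sub _ _).
Qed.

Lemma chain_top j : (Fl j <= Fl J)%MS.
Proof.
have [|/ltnW h] := leqP j J; first exact: chain_le.
by rewrite -(subnK h); elim: (j - J)%N => //= i; apply: submx_trans; apply: top; rewrite leq_addl.
Qed.

Lemma gr_op_sub m s A (u : 'M_(m, n)) : (u *m gr_op J.+1 Fl s A <= Fl J)%MS.
Proof.
apply: mulmx_sub; rewrite /gr_op; apply: summx_sub => j _.
exact: submx_trans (proj_mx_sub _ _ _) (submx_trans (grC_sub _ _) (chain_top _)).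
Qed.

Lemma gr_op0 s : gr_op J.+1 Fl s 0 = 0.
Proof. by rewrite /gr_op big1 // => j _; rewrite mulmx0 mul0mx. Qed.

Lemma gr_comm s t A B (u : 'rV_n) : (forall i, Fl i *m A <= Fl (i + s))%MS ->
  (forall i, Fl i *m B <= Fl (i + t))%MS ->
  (forall j (w : 'rV_n), (w <= Fl j)%MS -> (w *m A *m B - w *m B *m A <= prevsp Fl (j + s + t))%MS) ->
  (u <= Fl J)%MS ->
  u *m gr_op J.+1 Fl s A *m gr_op J.+1 Fl t B = u *m gr_op J.+1 Fl t B *m gr_op J.+1 Fl s A.
Proof.
move=> HA HB HC uJ; set GA := gr_op J.+1 Fl s A; set GB := gr_op J.+1 Fl t B.
apply/eqP; rewrite -subr_eq0 -!mulmxA -mulmxBr; apply/eqP/sub_kermxP; apply: submx_trans uJ _.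
apply: gr_ind => j w wj; apply/sub_kermxP; rewrite mulmxBr !mulmxA.
have wA := submx_trans (submxMr A wj) (HA _); have wB := submx_trans (submxMr B wj) (HB _).
rewrite /GA /GB !(gr_opE incr top) //; rewrite [(j + t + s)%N]addnAC -symB.
by apply: sym_low; exact: HC.
Qed.

End GradedMore.

Section FusionFacts.
Variables (F : fieldType) (n : nat) (I : finType).
Variables (E : I -> nat -> 'M[F]_n) (v : 'rV[F]_n).
Local Notation wsp := (wspan E v).
Local Notation Fl := (ufilt E v).
Local Notation J := (stab (ufilt E v)).

Lemma wspan_sub r d (T : 'M_n) : (v <= T)%MS ->
  (forall i x, (i <= d)%N -> (wsp r (d - i) *m E x i <= T)%MS) -> (wsp r.+1 d <= T)%MS.
Proof.
move=> vT H; rewrite /= addsmx_sub genmxE vT /=.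
by apply/sumsmx_subP => i _; apply/sumsmx_subP => x _; apply: H; rewrite -ltnS.
Qed.

Lemma v_wspan r d : (v <= wsp r d)%MS.
Proof.
case: r => [|r] /=; first by rewrite genmxE.
by apply: submx_trans (addsmxSl _ _); rewrite genmxE.
Qed.

Lemma wspan_E r d i x : (wsp r d *m E x i <= wsp r.+1 (d + i))%MS.
Proof.
apply: submx_trans (addsmxSr _ _); have h : (i < (d + i).+1)%N by rewrite ltnS leq_addl.
by apply: (sumsmx_sup (Ordinal h)) => //; apply: (sumsmx_sup x) => //=; rewrite addnK.
Qed.

Lemma wspan_r r d : (wsp r d <= wsp r.+1 d)%MS.
Proof.
elim: r d => [|r IH] d; first by rewrite [X in (X <= _)%MS]/= genmxE v_wspan.
apply: wspan_sub => [|i x id]; first exact: v_wspan.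
by apply: submx_trans (submxMr _ (IH _)) _; have := wspan_E r.+1 (d - i) i x; rewrite subnK.
Qed.

Lemma wspan_d r d : (wsp r d <= wsp r d.+1)%MS.
Proof.
elim: r d => [|r IH] d //; apply: wspan_sub => [|i x id]; first exact: v_wspan.
apply: submx_trans (submxMr _ (IH _)) _.
by have := wspan_E r (d - i).+1 i x; rewrite addSn subnK.
Qed.

Lemma wspan_ufilt r d : (wsp r d <= Fl d)%MS.
Proof. by apply: (eventual_sup (f := fun r => wsp r d)) => s; exact: wspan_r. Qed.

Lemma ufilt_incr d : (Fl d <= Fl d.+1)%MS.
Proof. exact: submx_trans (wspan_d _ _) (wspan_ufilt _ _). Qed.

Lemma ufilt_E d i x : (Fl d *m E x i <= Fl (d + i))%MS.
Proof. exact: submx_trans (wspan_E _ _ _ _) (wspan_ufilt _ _). Qed.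

Lemma v_ufilt d : (v <= Fl d)%MS.
Proof. exact: v_wspan. Qed.

Lemma ufilt_top j : (J <= j)%N -> (Fl j.+1 <= Fl j)%MS.
Proof.
move=> Jj; have /andP[h _] := stabP ufilt_incr (leqW Jj).
have /andP[_ h'] := stabP ufilt_incr Jj; exact: submx_trans h h'.
Qed.

Lemma ufilt_fus d : (Fl d <= fus_space E v)%MS.
Proof. exact: (eventual_sup ufilt_incr). Qed.

Lemma fus_space_E x i : (fus_space E v *m E x i <= fus_space E v)%MS.
Proof. exact: submx_trans (ufilt_E _ _ _) (ufilt_fus _). Qed.

Lemma v_fus : (v <= fus_space E v)%MS.
Proof. exact: v_ufilt. Qed.

Local Notation sy := (sym Fl).

Lemma fus_opE m j s A (u : 'M_(m, n)) : (forall i, Fl i *m A <= Fl (i + s))%MS ->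
  (u <= Fl j)%MS -> sy j u *m fus_op E v s A = sy (j + s) (u *m A).
Proof. exact: (gr_opE ufilt_incr ufilt_top). Qed.

Lemma fus_sym m j (u : 'M_(m, n)) : (sy j u <= fus_space E v)%MS.
Proof. exact: submx_trans (sym_sub _ _ _) (submx_trans (grC_sub _ _) (ufilt_fus _)). Qed.

Lemma fus_ind (T : 'M_n) : (forall j (u : 'rV_n), (u <= Fl j)%MS -> (sy j u <= T)%MS) ->
  (fus_space E v <= T)%MS.
Proof. exact: (gr_ind ufilt_incr). Qed.

Lemma fus_op_sub m s A (u : 'M_(m, n)) : (u *m fus_op E v s A <= fus_space E v)%MS.
Proof. exact: (gr_op_sub ufilt_incr ufilt_top). Qed.

(** Only finitely many induced operators are nonzero; hence the currents are polynomials, and rings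
    with finitely many variables suffice. *)
Lemma fus_op_high s A : (J < s)%N -> fus_op E v s A = 0.
Proof.
move=> Js; rewrite /fus_op /gr_op big1 // => j _; rewrite -[_ *m grQ _ _]/(sy _ _).
by rewrite (sym_top ufilt_top) // ltn_addl.
Qed.

(** Cyclicity of the fusion product: the symbol of a word applied to [v] is the same word in the
    induced operators, and [v] has symbol zero in positive degree. *)
Lemma fus_min (T : 'M_n) : (v <= T)%MS ->
  (forall x i, T *m fus_op E v i (E x i) <= T)%MS -> (fus_space E v <= T)%MS.
Proof.
move=> vT H; apply: fus_ind => j u.
rewrite /ufilt /eventual; move: (stab _) => r ur.
elim: r j u ur => [|r IH] j u.
  rewrite /= genmxE => uv; case: j => [|j].
    by rewrite (sym0E ufilt_incr) ?(submx_trans uv) ?v_ufilt.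
  by rewrite sym_low ?sub0mx //; exact: submx_trans uv (v_ufilt _).
move=> ur; rewrite -[sy j u]/(u *m grQ Fl j); apply: submx_trans (submxMr _ ur) _.
rewrite /= addsmxMr addsmx_sub; apply/andP; split.
  rewrite (eqmxMr _ (genmxE v)); case: (j) => [|j'].
    by rewrite -[_ *m _]/(sy 0 v) (sym0E ufilt_incr) ?v_ufilt.
  by rewrite -[_ *m _]/(sy j'.+1 v) sym_low ?sub0mx //=; exact: v_ufilt.
rewrite sumsmxMr; apply/sumsmx_subP => i _; rewrite sumsmxMr; apply/sumsmx_subP => x _.
apply/row_subP => k; rewrite row_mul -[_ *m grQ _ _]/(sy j _).
have ij : (i <= j)%N by rewrite -ltnS.
have -> (y : 'rV_n) : sy j y = sy (j - i + i)%N y by rewrite subnK.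
rewrite row_mul -fus_opE.
- by apply: submx_trans (H x i); apply: submxMr; apply: IH; exact: row_sub.
- by move=> d; exact: ufilt_E.
- exact: submx_trans (row_sub _ _) (wspan_ufilt _ _).
Qed.

Lemma fus_degE m j (u : 'M_(m, n)) : sy j u *m fus_deg E v = j%:R *: sy j u.
Proof. by apply: (gr_degE ufilt_incr ufilt_top); exact: sym_sub. Qed.

Lemma wspan_D A (al : I -> F) c : v *m A = c *: v ->
  (forall x i, E x i *m A = A *m E x i + al x *: E x i) ->
  forall r d, (wsp r d *m A <= wsp r d)%MS.
Proof.
move=> vA EA; elim=> [|r IH] d; first by rewrite /= (eqmxMr _ (genmxE v)) vA genmxE scalemx_sub.
rewrite /= addsmxMr addsmxS //; first by rewrite (eqmxMr _ (genmxE v)) vA genmxE scalemx_sub.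
rewrite sumsmxMr; apply: sumsmxS => i _; rewrite sumsmxMr; apply: sumsmxS => x _.
rewrite -mulmxA EA mulmxDr mulmxA -scalemxAr addmx_sub ?scalemx_sub //.
exact: submxMr.
Qed.

Lemma ufilt_D A (al : I -> F) c : v *m A = c *: v ->
  (forall x i, E x i *m A = A *m E x i + al x *: E x i) ->
  forall d, (Fl d *m A <= Fl (d + 0))%MS.
Proof. by move=> vA EA d; rewrite addn0; exact: (wspan_D vA EA). Qed.

End FusionFacts.

(** * Tensor products of evaluation slots *)

Section PowV.
Variables (F : fieldType) (n : nat).

(* The coefficient of degree N of v * (sum_i ops i * xi^i)^a. *)
Fixpoint powv (ops : nat -> 'M[F]_n) (v : 'rV[F]_n) (a N : nat) : 'rV[F]_n :=
  if a is a'.+1 then \sum_(i < N.+1) powv ops v a' (N - i) *m ops i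
  else if N == 0%N then v else 0.

Lemma powvS ops v a N : powv ops v a.+1 N = \sum_(i < N.+1) powv ops v a (N - i) *m ops i.
Proof. by []. Qed.
End PowV.

Section Tensor.
Variables (F : fieldType) (L dd : nat).
Local Notation n := (tdim L dd).
Local Notation tix := (tidx L dd).

Definition co (u : 'rV[F]_n) (f : tix) : F := u 0 (enum_rank f).
Definition upd (f : tix) (j : 'I_L) (b : 'I_dd) : tix := [ffun l => if l == j then b else f l].

Lemma co_inj (u w : 'rV[F]_n) : (forall f, co u f = co w f) -> u = w.
Proof. by move=> H; apply/rowP => r; have := H (enum_val r); rewrite /co enum_valK. Qed.

Lemma coB u w f : co (u - w) f = co u f - co w f. Proof. by rewrite /co !mxE. Qed.
Lemma coZ a u f : co (a *: u) f = a * co u f. Proof. by rewrite /co mxE. Qed.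
Lemma co_sum I (r : seq I) (P : pred I) (u : I -> 'rV_n) f :
  co (\sum_(i <- r | P i) u i) f = \sum_(i <- r | P i) co (u i) f.
Proof. by rewrite /co summxE. Qed.
Lemma co_tbasis g f : co (tbasis F g) f = (f == g)%:R.
Proof. by rewrite /co /tbasis mxE eqxx /= (inj_eq enum_rank_inj). Qed.

Lemma upd_id f j : upd f j (f j) = f.
Proof. by apply/ffunP => l; rewrite ffunE; case: eqP => // ->. Qed.

Lemma updE f j b : upd f j b j = b. Proof. by rewrite ffunE eqxx. Qed.

Lemma updN f j b l : l != j -> upd f j b l = f l. Proof. by rewrite ffunE => /negbTE ->. Qed.

Lemma upd_upd f j b c : upd (upd f j b) j c = upd f j c.
Proof. by apply/ffunP => l; rewrite !ffunE; case: eqP. Qed.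

Lemma upd_comm f j l b c : l != j -> upd (upd f j b) l c = upd (upd f l c) j b.
Proof.
move=> lj; apply/ffunP => i; rewrite !ffunE; case: (eqVneq i l) => // ->.
by rewrite (negbTE lj).
Qed.

Lemma co_tens (u : 'rV[F]_n) (rho : 'I_L -> 'M[F]_dd) f :
  co (u *m tens_op rho) f = \sum_j \sum_b co u (upd f j b) * rho j b (f j).
Proof.
rewrite /co mxE (reindex (@enum_rank tix)) /=; last by apply: onW_bij; exact: enum_rank_bij.
under eq_bigr => g _ do rewrite mxE !enum_rankK big_distrr /=.
rewrite exchange_big; apply: eq_bigr => j _ /=.
transitivity (\sum_(g : tix | [forall l, (l != j) ==> (g l == f l)])
   u 0 (enum_rank g) * rho j (g j) (f j)).
  by rewrite [RHS]big_mkcond; apply: eq_bigr => g _ /=; case: ifP => // _; rewrite mulr0.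
rewrite (reindex_onto (fun b => upd f j b) (fun g : tix => g j)) /=; last first.
  move=> g /forallP h; apply/ffunP => l; rewrite ffunE; case: eqP => [->//|/eqP lj].
  by have /implyP/(_ lj)/eqP := h l.
apply: eq_big => [b|b _]; last by rewrite updE.
rewrite updE eqxx andbT; apply/forallP => l; apply/implyP => lj; by rewrite updN.
Qed.

Lemma tens_op_ext (rho rho' : 'I_L -> 'M[F]_dd) : rho =1 rho' -> tens_op rho = tens_op rho'.
Proof. by move=> E; apply/matrixP => r c; rewrite !mxE; apply: eq_bigr => j _; rewrite E. Qed.

Lemma mx_ext (A B : 'M[F]_n) : (forall u : 'rV_n, u *m A = u *m B) -> A = B.
Proof. by move=> H; apply/row_matrixP => i; rewrite !rowE. Qed.

Lemma tens_op_lin (K : finType) (a : K -> F) (rho : K -> 'I_L -> 'M[F]_dd) :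
  \sum_i a i *: tens_op (rho i) = tens_op (fun j => \sum_i a i *: rho i j).
Proof.
apply: mx_ext => u; apply: co_inj => f; rewrite mulmx_sumr co_sum co_tens.
under eq_bigr => i _ do rewrite -scalemxAr coZ co_tens big_distrr /=.
rewrite exchange_big; apply: eq_bigr => j _ /=.
under eq_bigr => i _ do rewrite big_distrr /=.
rewrite exchange_big; apply: eq_bigr => b _ /=; rewrite summxE big_distrr /=.
by apply: eq_bigr => i _; rewrite mxE mulrCA.
Qed.

Lemma tens_opZ a (rho : 'I_L -> 'M[F]_dd) : a *: tens_op rho = tens_op (fun j => a *: rho j).
Proof.
have := tens_op_lin (fun _ : 'I_1 => a) (fun _ => rho); rewrite big_ord1 => ->.
by apply: tens_op_ext => j; rewrite big_ord1.
Qed.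

Lemma tens_op0 : tens_op (fun _ : 'I_L => 0 : 'M[F]_dd) = 0.
Proof.
apply/matrixP => r c; rewrite !mxE big1 // => j _; by case: ifP; rewrite ?mxE.
Qed.

(** The terms acting in two different slots ([cross]) are symmetric in the two operators and
    cancel. *)
Lemma tens_comm (rho sg : 'I_L -> 'M[F]_dd) :
  tens_op rho *m tens_op sg - tens_op sg *m tens_op rho
    = tens_op (fun j => rho j *m sg j - sg j *m rho j).
Proof.
pose cross (u : 'rV[F]_n) f (r s : 'I_L -> 'M[F]_dd) := \sum_j \sum_(l | l != j) \sum_b \sum_c
  co u (upd (upd f j b) l c) * r l c (f l) * s j b (f j).
have P (r s : 'I_L -> 'M[F]_dd) (u : 'rV[F]_n) f : co (u *m tens_op r *m tens_op s) f =
    cross u f r s + \sum_j \sum_c co u (upd f j c) * (r j *m s j) c (f j).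
  rewrite co_tens /cross -big_split; apply: eq_bigr => j _ /=.
  under eq_bigr => b _ do rewrite co_tens big_distrl /= (bigD1 j) //= addrC.
  rewrite big_split /=; congr (_ + _).
    rewrite exchange_big; apply: eq_bigr => l lj; apply: eq_bigr => b _.
    by rewrite big_distrl; apply: eq_bigr => c _ /=; rewrite updN.
  under eq_bigr => b _ do rewrite big_distrl /=.
  rewrite exchange_big; apply: eq_bigr => c _ /=; rewrite mxE big_distrr.
  by apply: eq_bigr => b _ /=; rewrite upd_upd updE mulrA.
apply: mx_ext => u; apply: co_inj => f; rewrite mulmxBr coB !mulmxA !P.
have -> : cross u f rho sg = cross u f sg rho.
  rewrite /cross (exchange_big_dep predT) //=; apply: eq_bigr => l _.
  apply: eq_big => [j|j lj]; first by rewrite eq_sym.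
  rewrite exchange_big; apply: eq_bigr => c _; apply: eq_bigr => b _.
  by rewrite upd_comm // mulrAC.
rewrite opprD addrACA subrr add0r co_tens -sumrB; apply: eq_bigr => j _.
by rewrite -sumrB; apply: eq_bigr => b _; rewrite !mxE mulrBr.
Qed.

Lemma tbasis_eigen (g : tix) (rho : 'I_L -> 'M[F]_dd) :
  (forall j b, b != g j -> rho j (g j) b = 0) ->
  tbasis F g *m tens_op rho = (\sum_j rho j (g j) (g j)) *: tbasis F g.
Proof.
move=> H; apply: co_inj => f; rewrite co_tens coZ co_tbasis.
have T j : \sum_b co (tbasis F g) (upd f j b) * rho j b (f j)
   = (f == g)%:R * rho j (g j) (g j).
  rewrite (bigD1 (g j)) //= [X in _ + X]big1 ?addr0 => [|b bg].
    rewrite co_tbasis; case: (eqVneq f g) => [->|fg]; first by rewrite upd_id eqxx.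
    rewrite mul0r; have [e|] := eqVneq (upd f j (g j)) g; last by rewrite mul0r.
    rewrite H ?mulr0 //; apply: contra_neq fg => fj; rewrite -e; apply/ffunP => l.
    by rewrite ffunE; case: eqP => // ->.
  rewrite co_tbasis; case: eqP => [e|]; last by rewrite mul0r.
  by move: bg; rewrite -e updE eqxx.
by under eq_bigr => j _ do rewrite T; rewrite -big_distrr /= mulrC.
Qed.

End Tensor.

(** * Powers of an evaluated current on the vacuum vector *)

Section Current.
Variables (F : fieldType) (L dd : nat) (Site : finType) (site : 'I_L -> Site) (zeta : Site -> F).
Variables (rho : 'I_L -> 'M[F]_dd) (vac tgt : tidx L dd) (act : {set 'I_L}) (eps : 'I_L -> F).
Local Notation n := (tdim L dd).
Local Notation z j := (zeta (site j)).
Hypothesis rho_vac : forall j b, rho j (vac j) b = if (j \in act) && (b == tgt j) then eps j else 0.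
Hypothesis rho_tgt : forall j b, j \in act -> rho j (tgt j) b = 0.
Hypothesis vt : forall j, j \in act -> tgt j != vac j.

Let E (i : nat) : 'M[F]_n := tens_op (fun j => z j ^+ i *: rho j).
Local Notation U := (powv E (tbasis F vac)).
Definition conf (J : {set 'I_L}) : tidx L dd := [ffun j => if j \in J then tgt j else vac j].

Let co_E u i f : co (u *m E i) f =
  \sum_j \sum_b co u (upd f j b) * (z j ^+ i *: rho j) b (f j).
Proof. exact: co_tens. Qed.

(** [rho] kills [tgt], so no slot is excited twice: the a-th power lives on configurations with
    exactly [a] excited slots. *)
Lemma U_supp a N f : co (U a N) f != 0 -> exists2 J : {set 'I_L}, J \subset act & #|J| = a /\ f = conf J.
Proof.
elim: a N f => [|a IH] N f /=.
  case: (N == 0%N); last by rewrite /co mxE eqxx.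
  rewrite co_tbasis; case: (eqVneq f vac) => [->|]; last by rewrite eqxx.
  move=> _; exists set0; rewrite ?sub0set ?cards0 //; split=> //.
  by apply/ffunP => j; rewrite ffunE in_set0.
move=> nz; suff : exists i j b, co (U a i) (upd f j b) * rho j b (f j) != 0.
  case=> i [j [b]]; rewrite mulf_eq0 negb_or => /andP[/IH[J Ja [cJ fE]] rn].
  have bE : b = conf J j by rewrite -fE updE.
  have jJ : j \notin J.
    by apply: contraNN rn => jJ; rewrite bE ffunE jJ rho_tgt ?eqxx // (subsetP Ja).
  move: rn; rewrite bE ffunE (negbTE jJ) rho_vac.
  case: ifP => [/andP[ja /eqP fj] _|]; last by rewrite eqxx.
  exists (j |: J); first by rewrite subUset sub1set ja Ja.
  split; first by rewrite cardsU1 jJ cJ.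
  apply/ffunP => l; rewrite ffunE in_setU1; case: eqP => [->//|/eqP lj] /=.
  by have /ffunP/(_ l) := fE; rewrite updN // ffunE.
apply: NNPP => h; case/eqP: nz; rewrite co_sum; apply: big1 => i _.
rewrite co_tens; apply: big1 => j _; apply: big1 => b _; rewrite mxE mulrCA.
have [->|nz] := eqVneq (co (U a (N - i)) (upd f j b) * rho j b (f j)) 0; first by rewrite mulr0.
by case: h; exists (N - i)%N, j, b.
Qed.

Lemma U_conf a N (J : {set 'I_L}) : J \subset act ->
  co (U a.+1 N) (conf J) =
  \sum_(j in J) eps j * \sum_(i < N.+1) z j ^+ i * co (U a (N - i)) (conf (J :\ j)).
Proof.
move=> Ja; rewrite powvS co_sum; under eq_bigr => i _ do rewrite co_E.
rewrite exchange_big [RHS]big_mkcond /=; apply: eq_bigr => j _.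
have cJ : conf J j = if j \in J then tgt j else vac j by rewrite ffunE.
have Z i b : b != vac j -> co (U a i) (upd (conf J) j b) * rho j b (conf J j) = 0.
  move=> bv; have [->|] := eqVneq (co (U a i) (upd (conf J) j b)) 0; first by rewrite mul0r.
  case/U_supp=> J' J'a [_ fE].
  have : b = conf J' j by rewrite -fE updE.
  rewrite ffunE; case: ifP => [jJ' ->|_ bE]; last by rewrite bE eqxx in bv.
  by rewrite rho_tgt ?mulr0 // (subsetP J'a).
have S i : \sum_b co (U a (N - i)) (upd (conf J) j b) * (z j ^+ i *: rho j) b (conf J j)
    = z j ^+ i * (co (U a (N - i)) (upd (conf J) j (vac j)) * rho j (vac j) (conf J j)).
  rewrite (bigD1 (vac j)) //= big1 ?addr0 => [|b bv]; first by rewrite mxE mulrCA.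
  by rewrite mxE mulrCA Z ?mulr0.
under eq_bigr => i _ do rewrite S rho_vac cJ.
case jJ: (j \in J); last first.
  apply: big1 => i _; case: ifP; rewrite ?mulr0 // => /andP[ja /eqP e].
  by have := vt ja; rewrite e eqxx.
rewrite (subsetP Ja) // eqxx big_distrr; apply: eq_bigr => i _ /=.
have -> : upd (conf J) j (vac j) = conf (J :\ j).
  by apply/ffunP => l; rewrite !ffunE !inE; case: eqP => [->|].
by rewrite mulrA mulrC.
Qed.

(** At [conf J] the series in xi is a! prod eps_j / prod (1 - z_j xi), because each of the a! orders
    of excitation gives the same product of geometric series. This is that identity with
    denominators cleared, modulo xi^K. *)
Lemma U_conf_poly K a (J : {set 'I_L}) : J \subset act -> #|J| = a ->
  'X^K %| (\prod_(j in J) (1 - z j *: 'X)) * (\poly_(N < K) co (U a N) (conf J))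
          - ((\prod_(j in J) eps j) * a`!%:R)%:P.
Proof.
have geo x : 'X^K %| (1 - x *: 'X) * (\poly_(i < K) x ^+ i) - (1 : {poly F}).
  have -> : (1 - x *: 'X) * (\poly_(i < K) x ^+ i) - 1 = - ((x ^+ K) *: 'X^K).
    elim: K => [|K IH]; first by rewrite poly_def big_ord0 mulr0 sub0r expr0 scale1r expr0.
    rewrite poly_def big_ord_recr /= mulrDr -poly_def addrAC IH mulrBl mul1r addrA addNr sub0r.
    by rewrite -scalerAl -scalerAr scalerA -!exprS.
  by rewrite -scaleNr -mul_polyC dvdp_mulIr.
elim: a J => [|a IH] J Ja cJ.
  move/cards0_eq: cJ => J0; have cE : conf J = vac.
    by apply/ffunP => j; rewrite ffunE J0 in_set0.
  rewrite cE J0 !big_set0 !mul1r; case: K {geo} => [|K]; first by rewrite expr0 dvd1p.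
  suff -> : \poly_(N < K.+1) co (U 0 N) vac = 1 by rewrite subrr dvdp0.
  apply/polyP => -[|i]; rewrite coef_poly coef1 //=; first by rewrite co_tbasis eqxx.
  by case: ifP; rewrite // /co mxE.
have W j : j \in J -> 'X^K %| (\prod_(l in J) (1 - z l *: 'X)) *
     (\poly_(i < K) z j ^+ i * (\poly_(N < K) co (U a N) (conf (J :\ j))))
   - ((\prod_(l in J :\ j) eps l) * a`!%:R)%:P.
  move=> jJ; have Jj : J :\ j \subset act by apply: subset_trans Ja; exact: subD1set.
  have cj : #|J :\ j| = a by move: cJ; rewrite (cardsD1 j) jJ => -[].
  have := IH _ Jj cj; rewrite (bigD1 j jJ) /=.
  have -> : \prod_(i in J | i != j) (1 - z i *: 'X) = \prod_(i in J :\ j) (1 - z i *: 'X).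
    by apply: eq_bigl => i; rewrite !inE andbC.
  set P := \prod_(i in _) _; set c := \poly_(N < K) co _ _; set e := _%:P.
  set g := \poly_(i < K) _ => h.
  have -> : (1 - z j *: 'X) * P * (g * c) - e = ((1 - z j *: 'X) * g - 1) * (P * c) + (P * c - e).
    by ring.
  by rewrite dvdp_add // dvdp_mulr.
have C : 'X^K %| \poly_(N < K) co (U a.+1 N) (conf J) -
   \sum_(j in J) (eps j)%:P *
     (\poly_(i < K) z j ^+ i * (\poly_(N < K) co (U a N) (conf (J :\ j)))).
  set D := (X in 'X^K %| X); suff : take_poly K D = 0.
    by move=> t0; rewrite -(poly_take_drop K D) t0 add0r dvdp_mulIr.
  apply/polyP => N; rewrite coef_take_poly coef0; case: ltnP => // NK.
  rewrite coefB coef_sum coef_poly NK U_conf // -sumrB big1 // => j _.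
  rewrite coefCM coefM; apply/eqP; rewrite subr_eq0; apply/eqP; congr (_ * _); apply: eq_bigr => i _.
  by rewrite !coef_poly (leq_ltn_trans _ NK) ?(leq_ltn_trans (leq_subr _ _) NK) // -ltnS.
set P := \prod_(j in J) (1 - _); set c := \poly_(N < K) _.
have -> : P * c - ((\prod_(j in J) eps j) * a.+1`!%:R)%:P =
   P * (c - \sum_(j in J) (eps j)%:P *
     (\poly_(i < K) z j ^+ i * (\poly_(N < K) co (U a N) (conf (J :\ j))))) +
   \sum_(j in J) (eps j)%:P * (P * (\poly_(i < K) z j ^+ i *
      (\poly_(N < K) co (U a N) (conf (J :\ j)))) - ((\prod_(l in J :\ j) eps l) * a`!%:R)%:P).
  rewrite mulrBr -addrA; congr (_ + _); under [X in _ = _ + X]eq_bigr => j _ do rewrite mulrBr.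
  rewrite sumrB [P * _]mulr_sumr.
  under [X in - X + (_ - _)]eq_bigr => j _ do rewrite mulrCA.
  rewrite addrA addNr sub0r; congr (- _).
  under [RHS]eq_bigr => j jJ.
    rewrite -polyCM mulrA; have -> : eps j * \prod_(l in J :\ j) eps l = \prod_(l in J) eps l.
      by rewrite [RHS](bigD1 j jJ) /=; congr (_ * _); apply: eq_bigl => i; rewrite !inE andbC.
    over.
  rewrite sumr_const cJ -polyCMn; congr (_%:P).
  by rewrite factS natrM -[RHS]mulr_natr -[RHS]mulrA; congr (_ * _); rewrite mulrC.
rewrite dvdp_add // ?dvdp_mull //; apply: (big_ind (fun x => 'X^K %| x)) => [|x y|j jJ]; rewrite ?dvdp0 //.
  exact: dvdp_add.
by rewrite dvdp_mull // W.
Qed.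

Variable kk : Site -> nat.
Hypothesis kkP : forall s, (#|[set j in act | site j == s]| <= kk s)%N.

(* Multiplying by prod_s (1 - zeta_s xi)^min(k_s, a) clears the denominators of the a-th power of
   the current, so that its coefficients obey a linear recurrence from this degree on. *)
Lemma current_recurrence a N : (\sum_s minn (kk s) a < N + a)%N ->
  exists q : nat -> F, U a N = \sum_(1 <= i < N.+1) q i *: U a (N - i).
Proof.
move=> big.
pose Q : {poly F} := \prod_s (1 - zeta s *: 'X) ^+ minn (kk s) a.
have Q0 : Q`_0 = 1.
  rewrite -horner_coef0 horner_prod big1 // => s _.
  by rewrite horner_exp !hornerE /= ?mulr0 ?subr0 ?expr1n.
exists (fun i => - Q`_i); apply: co_inj => f.
(* [Q] has constant term 1, so the vanishing of this coefficient is the recurrence. *)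
suff : (Q * \poly_(M < N.+1) co (U a M) f)`_N = 0.
  rewrite coefM -(big_mkord xpredT (fun i => Q`_i * (\poly_(M < N.+1) co (U a M) f)`_(N - i))).
  rewrite big_nat_recl // Q0 mul1r subn0 coef_poly ltnSn => /eqP; rewrite addr_eq0 => /eqP ->.
  rewrite co_sum big_add1 /= -sumrN; apply: eq_bigr => i _.
  by rewrite coZ mulNr coef_poly ltnS leq_subr.
case: (classic (exists2 J : {set 'I_L}, J \subset act & #|J| = a /\ f = conf J)); last first.
  move=> nJ; have -> : \poly_(M < N.+1) co (U a M) f = 0; last by rewrite mulr0 coef0.
  apply/polyP => i; rewrite coef_poly coef0; case: ifP => // _.
  by apply/eqP; apply/negPn/negP => /U_supp.
case=> J Ja [cJ ->].
pose m s := #|[set j in J | site j == s]|.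
have mk s : (m s <= minn (kk s) a)%N.
  rewrite leq_min; apply/andP; split.
    apply: leq_trans (kkP s); apply: subset_leq_card; apply/subsetP => j; rewrite !inE.
    by case/andP=> /(subsetP Ja) -> ->.
  by rewrite -cJ; apply: subset_leq_card; apply/subsetP => j; rewrite inE => /andP[].
have PJ : \prod_(j in J) (1 - z j *: 'X) = \prod_s (1 - zeta s *: 'X) ^+ m s.
  rewrite (partition_big site predT) //=; apply: eq_bigr => s _.
  rewrite -prodr_const; apply: eq_big => [j|j /andP[_ /eqP ->]] //; by rewrite inE.
pose Rr : {poly F} := \prod_s (1 - zeta s *: 'X) ^+ (minn (kk s) a - m s).
have QE : Q = (\prod_(j in J) (1 - z j *: 'X)) * Rr.
  by rewrite PJ -big_split /=; apply: eq_bigr => s _; rewrite -exprD subnKC.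
have sm : (\sum_s m s)%N = a.
  rewrite -cJ -sum1_card (partition_big site predT) //=; apply: eq_bigr => s _.
  by rewrite /m -sum1_card; apply: eq_bigl => j; rewrite inE.
(* The cofactor has degree at most sum_s min(k_s, a) - a, which the assumption [big] makes smaller
   than [N]. *)
have sR : (size Rr <= N)%N.
  have : (size Rr <= (\sum_s (minn (kk s) a - m s)).+1)%N.
    apply: (big_ind2 (fun (p : {poly F}) k => size p <= k.+1)%N).
    - by rewrite size_poly1.
    - move=> p1 k1 p2 k2 h1 h2; apply: leq_trans (size_mul_leq _ _) _; lia.
    move=> s _; apply: leq_trans (size_exp_leq _ _) _; rewrite ltnS.
    have : (size ((1 - zeta s *: 'X)%R : {poly F}) <= 2)%N.
      rewrite (leq_trans (size_polyD _ _)) // geq_max size_poly1 /= size_polyN.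
      by rewrite (leq_trans (size_scale_leq _ _)) // size_polyX.
    by move=> h; rewrite -[X in (_ <= X)%N]mul1n leq_mul2r; apply/orP; right; rewrite -subn1 leq_subLR.
  move=> h; apply: leq_trans h _; rewrite sumnB // sm.
  have : (\sum_s m s <= \sum_s minn (kk s) a)%N by apply: leq_sum => s _; exact: mk.
  rewrite sm; lia.
(* Modulo xi^(N+1) the product of [Q] with the series is a constant times [Rr], whose coefficient at
   [N] is zero. *)
have /dvdpP[y yE] := U_conf_poly N.+1 Ja cJ.
rewrite QE mulrAC; move/eqP: yE; rewrite subr_eq => /eqP ->.
rewrite mulrDl coefD -mulrA [_ * Rr]mulrC mulrA coefMXn ltnSn add0r coefCM.
by rewrite nth_default ?mulr0.
Qed.

End Current.

(** * Independent vectors from operators acting on a single site *)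

Section LowerBound.
Variables (F : fieldType) (L dd : nat) (Site Lam : finType) (site : 'I_L -> Site).
Variables (vac : tidx L dd) (tgt : Lam -> tidx L dd) (T : 'M[F]_(tdim L dd)).
Hypothesis char0 : forall m, m.+1%:R != 0 :> F.
Hypothesis tgt_vac : forall x j, tgt x j != vac j.
Hypothesis tgt_inj : forall x y j, tgt x j = tgt y j -> x = y.
Hypothesis cover : forall j b, b != vac j -> exists x, b = tgt x j.
Hypothesis vT : (tbasis F vac <= T)%MS.
Hypothesis opT : forall s x, exists2 e, e != 0 &
  (T *m tens_op (fun j => if site j == s then e *: delta_mx (vac j) (tgt x j) else 0) <= T)%MS.

Definition cnt (f : tidx L dd) s x := #|[set j | (site j == s) && (f j == tgt x j)]|.

Lemma cnt_upd (f : tidx L dd) j x : f j = vac j -> forall s y,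
  cnt (upd f j (tgt x j)) s y = (cnt f s y + ((s == site j) && (y == x)))%N.
Proof.
move=> fj s y; rewrite /cnt (cardsD1 j) inE updE addnC; congr (_ + _)%N; last first.
  rewrite eq_sym; congr (nat_of_bool (_ && _)).
  by apply/eqP/eqP => [/tgt_inj ->|->].
apply: eq_card => l; rewrite !inE ffunE; case: (eqVneq l j) => [->|] //=.
by rewrite fj [vac j == _]eq_sym (negbTE (tgt_vac _ _)) andbF.
Qed.

Lemma cnt_upd_vac (f : tidx L dd) j x : f j = tgt x j -> forall s y,
  cnt f s y = (cnt (upd f j (vac j)) s y + ((s == site j) && (y == x)))%N.
Proof.
move=> fj s y; rewrite -(@cnt_upd _ j x) ?updE //.
by rewrite upd_upd -fj upd_id.
Qed.

(** Letters are applied one at a time. A configuration with counts [ga] arises from [ga s x]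
    configurations with one excitation fewer, so the common coefficient gets multiplied by e * ga s
    x, nonzero in characteristic 0. [f0] witnesses that such a configuration exists. *)
Lemma monomial_vector (ga : Site -> Lam -> nat) :
  (forall s, \sum_x ga s x <= #|[set j | site j == s]|)%N ->
  exists2 u : 'rV[F]_(tdim L dd), (u <= T)%MS & exists c f0, [/\ c != 0,
    forall s x, cnt f0 s x = ga s x &
    forall f, co u f = if [forall s, forall x, cnt f s x == ga s x] then c else 0].
Proof.
have [m] := ubnP (\sum_s \sum_x ga s x); elim: m ga => // m IH ga lem hga.
have [/existsP[s /existsP[x gsx]]|/existsPn all0] := boolP [exists s, exists x, ga s x != 0%N]; last first.
  have ga0 s x : ga s x = 0%N by have /existsPn/(_ x) := all0 s; rewrite negbK => /eqP.
  exists (tbasis F vac) => //; exists 1, vac; split; first exact: oner_neq0.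
    move=> s x; rewrite ga0; apply/eqP; rewrite cards_eq0; apply/eqP/setP => j; rewrite !inE.
    by rewrite [vac j == _]eq_sym (negbTE (tgt_vac _ _)) andbF.
  move=> f; rewrite co_tbasis; case: (eqVneq f vac) => [->|fv].
    case: ifP => // /negP[]; apply/forallP => s; apply/forallP => x; rewrite ga0 cards_eq0.
    by apply/eqP/setP => j; rewrite !inE [vac j == _]eq_sym (negbTE (tgt_vac _ _)) andbF.
  case: ifP => // /forallP h.
  have [j fj] : exists j, f j != vac j.
    apply/existsP; apply: contraNT fv; rewrite negb_exists => /forallP e.
    by apply/eqP/ffunP => j; apply/eqP; have := e j; rewrite negbK.
  have [x fx] := cover fj; have /forallP/(_ x) := h (site j).
  rewrite ga0 cards_eq0 => /eqP/setP/(_ j); by rewrite !inE eqxx fx eqxx.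
pose ga' t y := (ga t y - ((t == s) && (y == x)))%N.
have gaE t y : ga t y = (ga' t y + ((t == s) && (y == x)))%N.
  rewrite /ga' subnK //; case: eqP => // ->; case: eqP => // ->; by rewrite lt0n.
have sub t : (\sum_y ga t y = \sum_y ga' t y + (t == s))%N.
  rewrite (eq_bigr _ (fun y _ => gaE t y)) big_split /=; congr (_ + _)%N.
  case: (t == s) => /=; last by rewrite big1.
  by rewrite (bigD1 x) //= eqxx big1 // => y /negbTE ->.
have [|t|u uT [c [f0 [cn f0E uE]]]] := IH ga'.
- move: lem; rewrite (eq_bigr _ (fun t _ => sub t)) big_split /=.
  by rewrite (bigD1 s (F := fun t => nat_of_bool (t == s))) //= eqxx; lia.
- by apply: leq_trans (hga t); rewrite sub leq_addr.
have [e en eT] := opT s x.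
exists (u *m tens_op (fun j => if site j == s then e *: delta_mx (vac j) (tgt x j) else 0)).
  by apply: submx_trans eT; exact: submxMr.
(* Otherwise every slot of the site [s] would be excited in [f0], and the counts [ga'] would already
   exhaust the site. *)
have [j sj fj] : exists2 j, site j = s & f0 j = vac j.
  apply: NNPP => h; have := hga s; rewrite sub eqxx addn1 leqNgt => /negP[]; rewrite ltnS.
  under [X in (_ <= X)%N]eq_bigr => y _ do rewrite -f0E /cnt -sum1_card.
  rewrite -sum1_card; under [X in (_ <= X)%N]eq_bigr => y _ do rewrite big_mkcond /=.
  rewrite exchange_big [X in (X <= _)%N]big_mkcond /=; apply: leq_sum => j _.
  rewrite inE; case: eqP => // sj; have [|y fy] := cover (_ : f0 j != vac j).
    by apply/eqP => fj; apply: h; exists j.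
  by rewrite (bigD1 y) //= inE sj eqxx fy eqxx.
have gp : (0 < ga s x)%N by rewrite lt0n.
exists (e * c * (ga s x)%:R), (upd f0 j (tgt x j)); split.
- by rewrite !mulf_neq0 // -(prednK gp).
- by move=> t y; rewrite cnt_upd // sj f0E -gaE.
move=> f; rewrite co_tens.
transitivity (\sum_(j | (site j == s) && (f j == tgt x j)) e * co u (upd f j (vac j))).
  rewrite [RHS]big_mkcond; apply: eq_bigr => l _ /=; case: (site l == s) => /=; last first.
    by apply: big1 => b _; rewrite mxE mulr0.
  case: (eqVneq (f l) (tgt x l)) => [fl|nfl].
    rewrite (bigD1 (vac l)) //= big1 ?addr0 => [|b bv].
      by rewrite !mxE fl !eqxx mulr1 mulrC.
    by rewrite !mxE (negbTE bv) /= !mulr0.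
  by apply: big1 => b _; rewrite !mxE (negbTE nfl) andbF !mulr0.
have T1 l : site l = s -> f l = tgt x l ->
   [forall t, forall y, cnt (upd f l (vac l)) t y == ga' t y] = [forall t, forall y, cnt f t y == ga t y].
  move=> sl fl; apply/forallP/forallP => h t; apply/forallP => y.
    by rewrite (cnt_upd_vac fl) gaE sl eqn_add2r; have /forallP := h t.
  by have /forallP/(_ y) := h t; rewrite (cnt_upd_vac fl) gaE sl eqn_add2r.
case: ifP => [h|h]; last first.
  by apply: big1 => l /andP[/eqP sl /eqP fl]; rewrite uE T1 // h mulr0.
rewrite (eq_bigr (fun => e * c)) => [|l /andP[/eqP sl /eqP fl]]; last by rewrite uE T1 // h.
have /forallP/(_ s)/forallP/(_ x)/eqP <- := h.
by rewrite sumr_const /cnt mulr_natr; congr (_ *+ _); apply: eq_card => l; rewrite inE.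
Qed.

(** Vectors with different counts have disjoint supports; reading each at its witness configuration
    gives an invertible diagonal matrix. *)
Lemma rank_lower_bound (K : finType) (ga : K -> Site -> Lam -> nat) :
  (forall k s, \sum_x ga k s x <= #|[set j | site j == s]|)%N ->
  (forall k k', (forall s x, ga k s x = ga k' s x) -> k = k') -> (#|K| <= \rank T)%N.
Proof.
move=> hga ginj.
have H (k : K) : exists u : 'rV[F]_(tdim L dd) * F * tidx L dd, [/\ (u.1.1 <= T)%MS, u.1.2 != 0,
    forall s x, cnt u.2 s x = ga k s x &
    forall f, co u.1.1 f = if [forall s, forall x, cnt f s x == ga k s x] then u.1.2 else 0].
  by have [u uT [c [f0 [cn f0E uE]]]] := monomial_vector (hga k); exists (u, c, f0).
have [w wP] := fin_all_exists H.
pose A : 'M[F]_(#|K|, tdim L dd) := \matrix_i (w (enum_val i)).1.1.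
pose B : 'M[F]_(tdim L dd, #|K|) := \matrix_(r, i) (r == enum_rank (w (enum_val i)).2)%:R.
have AB : A *m B = diag_mx (\row_i (w (enum_val i)).1.2).
  apply/matrixP => i j; rewrite !mxE (bigD1 (enum_rank (w (enum_val j)).2)) //= big1 => [|r rn].
    rewrite !mxE eqxx mulr1 addr0; have [_ _ _ uE] := wP (enum_val i).
    have [_ _ fE _] := wP (enum_val j).
    rewrite -[X in X = _]/(co (w (enum_val i)).1.1 _) uE.
    case: ifP => [/forallP h|h].
      have -> : i = j; last by rewrite eqxx.
      apply: enum_val_inj; apply: ginj => s x; rewrite -fE.
      by have /forallP/(_ x)/eqP := h s.
    case: eqP => // ij; move/negP: h; case; apply/forallP => s; apply/forallP => x.
    by rewrite fE ij.
  by rewrite !mxE (negbTE rn) mulr0.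
have AT : (A <= T)%MS by apply/row_subP => i; rewrite rowK; have [] := wP (enum_val i).
apply: leq_trans (mxrankS AT); apply: leq_trans (mxrankM_maxl A B); rewrite AB.
rewrite mxrank_unit // unitmxE det_diag unitfE prodf_seq_neq0; apply/allP => i _.
by rewrite mxE; have [] := wP (enum_val i).
Qed.

End LowerBound.

(** * Normal ordering of Heisenberg currents *)

Section NormalOrder.
Variables (S : nzRingType) (X Y z1 z2 : S).
Hypotheses (z1X : z1 * X = X * z1) (z1Y : z1 * Y = Y * z1).
Hypotheses (z2X : z2 * X = X * z2) (z2Y : z2 * Y = Y * z2) (z12 : z1 * z2 = z2 * z1).
Hypothesis YX : Y * X = X * Y + z1 - z2.

(** Normally ordered product of Y^b and X^a with contractions by [z1]. It is made to satisfy two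
    recursions: this one, appending X, and [nordY], appending Y with contractions by [z2]. At b = 0
    the value of [b.-1] is harmless, since the term has multiplicity b. *)
Fixpoint nord (a b : nat) : S :=
  if a is a'.+1 then nord a' b * X - (z1 * nord a' b.-1) *+ b else Y ^+ b.

(** Equals j! C(a, j) C(b, j), the number of ways to contract j factors X with j factors Y. *)
Fixpoint ncoef (a b j : nat) : nat :=
  if j is j'.+1 then
    if a is a'.+1 then (ncoef a' b j + b * ncoef a' b.-1 j')%N else 0%N
  else 1%N.

Lemma ncoef_gt0 a b j : (j <= a)%N -> (j <= b)%N -> (0 < ncoef a b j)%N.
Proof.
elim: a b j => [|a IH] b [|j] //= ja jb; rewrite addn_gt0 muln_gt0; apply/orP; right.
by rewrite (IH b.-1 j) ?andbT; lia.
Qed.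

Lemma ncoef_out a b j : (a < j)%N -> ncoef a b j = 0%N.
Proof.
elim: a b j => [|a IH] b [|j] //= ja; rewrite !IH ?muln0 //; lia.
Qed.

Lemma nord_comm z a b : z * X = X * z -> z * Y = Y * z -> z * z1 = z1 * z ->
  z * nord a b = nord a b * z.
Proof.
move=> zX zY zz; elim: a b => [|a IH] b /=.
  by elim: b => [|b IH]; rewrite ?expr0 ?mulr1 ?mul1r // exprS mulrA zY -mulrA IH mulrA.
rewrite mulrBr mulrBl mulrA IH -!mulrA zX mulrnAr mulrnAl; congr (_ - _ *+ _).
by rewrite mulrA zz -!mulrA IH.
Qed.

Lemma nord_sum a b : nord a b =
  \sum_(j < a.+1) (-1) ^+ j * (z1 ^+ j * (Y ^+ (b - j) * X ^+ (a - j))) *+ ncoef a b j.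
Proof.
elim: a b => [|a IH] b; first by rewrite big_ord1 /= !expr0 !mul1r mulr1 subn0.
rewrite [LHS]/= !IH.
have -> : (\sum_(j < a.+1) (-1) ^+ j * (z1 ^+ j * (Y ^+ (b - j) * X ^+ (a - j))) *+ ncoef a b j) * X
    = \sum_(j < a.+2) (-1) ^+ j * (z1 ^+ j * (Y ^+ (b - j) * X ^+ (a.+1 - j))) *+ ncoef a b j.
  rewrite [RHS]big_ord_recr /= ncoef_out // mulr0n addr0 mulr_suml; apply: eq_bigr => j _.
  by rewrite mulrnAl -!mulrA -exprSr subSn // -ltnS.
rewrite [X in _ - X *+ _]mulr_sumr -sumrMnl -sumrN [in RHS]big_ord_recl.
rewrite [X in X + _]big_ord_recl -addrA /=; congr (_ + _); first by case: (a).
rewrite -big_split /=; apply: eq_bigr => j _; rewrite /bump /= !add1n subSS mulrnDr; congr (_ + _).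
rewrite mulrnAr -!mulrnA -mulNrn [(ncoef _ _ _ * _)%N]mulnC; congr (_ *+ _).
rewrite -subn1 -subnDA add1n [(-1) ^+ j.+1]exprS mulN1r mulNr; congr (- _).
rewrite exprS -!mulrA mulrA [(-1) ^+ j * (z1 * _)]mulrA mulrA; congr (_ * _).
exact: commr_sign.
Qed.

(** Moving Y past X produces z1 - z2. The [z1] part cancels the contraction of X with the additional
    Y, so that only contractions by [z2] with the a factors X remain. *)
Lemma nordY a b : nord a b.+1 = nord a b * Y - (z2 * nord a.-1 b) *+ a.
Proof.
elim: a b => [|a IH] b; first by rewrite /= mulr0n subr0 -exprSr.
have E1 : (nord a.-1 b * X) *+ a = (nord a b + (z1 * nord a.-1 b.-1) *+ b) *+ a.
  by case: (a) => [|a'] /=; rewrite ?mulr0n // subrK.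
have E2 : (nord a b.-1 * Y) *+ b = (nord a b + (z2 * nord a.-1 b.-1) *+ a) *+ b.
  by case: b {E1} => [|b] /=; rewrite ?mulr0n // IH subrK.
rewrite [LHS]/= [nord a.+1 b]/= IH.
have -> : (nord a b * Y - (z2 * nord a.-1 b) *+ a) * X =
   nord a b * X * Y + z1 * nord a b - z2 * nord a b
    - z2 * ((nord a b + (z1 * nord a.-1 b.-1) *+ b) *+ a).
  rewrite mulrBl -[nord a b * Y * X]mulrA YX mulrBr mulrDr mulrA.
  rewrite -(nord_comm _ _ z1X z1Y erefl) -(nord_comm _ _ z2X z2Y (esym z12)).
  by rewrite -E1 mulrnAl mulrnAr mulrA.
have -> : (nord a b * X - (z1 * nord a b.-1) *+ b) * Y =
   nord a b * X * Y - z1 * ((nord a b + (z2 * nord a.-1 b.-1) *+ a) *+ b).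
  by rewrite mulrBl -E2 mulrnAl mulrnAr mulrA.
rewrite [in X in _ - X = _]mulrS [in X in _ = _ - X]mulrS !mulrnDl !mulrDr -!mulrnAr.
rewrite -[X in z2 * (z1 * X)]mulrnA mulrA -[X in z1 * (z2 * X)]mulrnA [z1 * (z2 * _)]mulrA z12.
rewrite [(b * a)%N]mulnC; move: (_ * X * Y) (z1 * nord a b) (z2 * nord a b).
move: (z2 * z1 * _) (z2 * (_ *+ _)) (z1 * (_ *+ _)) => m be al T p q.
rewrite !opprD !addrA [_ - m - p]addrAC [_ - be - p]addrAC [_ - q - p]addrAC addrK.
rewrite [T - al - m]addrAC [T - m - al - q]addrAC [T - m - q - al - be]addrAC.
by rewrite [T - m - q]addrAC [T - q - m - be]addrAC.
Qed.

End NormalOrder.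

Section Mixed.
Variables (F : fieldType) (R : nzRingType) (lam : {additive R -> F}) (nn : nat).
Variables (x y z : nat -> R).
Hypotheses (x0 : forall i, (nn <= i)%N -> x i = 0) (y0 : forall i, (nn <= i)%N -> y i = 0)
  (z0 : forall i, (nn <= i)%N -> z i = 0).
Hypotheses (xz : forall i j, z i * x j = x j * z i) (yz : forall i j, z i * y j = y j * z i)
  (zz : forall i j, z i * z j = z j * z i).
Hypothesis yx : forall i j, y j * x i = x i * y j + z (i + j)%N.
Let X := \poly_(i < nn) x i.
Let Y := \poly_(i < nn) y i.
Let Z := \poly_(i < nn) z i.

Lemma coefX_cur i : X`_i = x i. Proof. by rewrite coef_poly; case: ltnP => // /x0. Qed.
Lemma coefY_cur i : Y`_i = y i. Proof. by rewrite coef_poly; case: ltnP => // /y0. Qed.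
Lemma coefZ_cur i : Z`_i = z i. Proof. by rewrite coef_poly; case: ltnP => // /z0. Qed.

(** In [S] the inner variable ['X%:P] is xi and the outer variable ['X] is eta; thus [z1] is xi
    Z(xi) and [z2] is eta Z(eta). *)
Local Notation S := {poly {poly R}}.
Let de : S := 'X%:P - 'X.
Let X' : S := de * X%:P.
Let Y' : S := map_poly polyC Y.
Let z1 : S := ('X * Z)%:P.
Let z2 : S := 'X * map_poly polyC Z.

Lemma comm_poly2 (p : {poly R}) (q : {poly R}) : (forall i j, p`_i * q`_j = q`_j * p`_i) -> p * q = q * p.
Proof.
move=> H; apply/polyP => k; rewrite coefM coefMr; apply: eq_bigr => i _; exact: H.
Qed.

Lemma XP_comm (e : S) : 'X%:P * e = e * 'X%:P.
Proof. by apply/polyP => i; rewrite coefCM coefMC commr_polyX. Qed.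

Lemma de_comm (e : S) : de * e = e * de.
Proof. by rewrite /de mulrBl mulrBr XP_comm commr_polyX. Qed.

Lemma XZ_comm : X * Z = Z * X.
Proof. by apply: comm_poly2 => i j; rewrite coefX_cur coefZ_cur xz. Qed.

Lemma z1X : z1 * X' = X' * z1.
Proof.
rewrite /X' mulrA -de_comm -!mulrA; congr (_ * _); rewrite -!polyCM; congr (_%:P).
by rewrite -mulrA -XZ_comm !mulrA (commr_polyX X).
Qed.

Lemma map_comm (p q : {poly R}) : (forall i j, p`_i * q`_j = q`_j * p`_i) ->
  (p%:P : S) * map_poly polyC q = map_poly polyC q * p%:P.
Proof.
move=> H; apply/polyP => j; rewrite coefCM coefMC coef_map_id0 ?polyC0 //.
by apply/polyP => i; rewrite coefMC coefCM.
Qed.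

Lemma z1Y : z1 * Y' = Y' * z1.
Proof.
apply: map_comm => i j; rewrite coefXM coefY_cur; case: eqP => _; rewrite ?mul0r ?mulr0 //.
by rewrite coefZ_cur yz.
Qed.

Lemma z2X : z2 * X' = X' * z2.
Proof.
rewrite /z2 /X' !mulrA -[_ * de]de_comm mulrA -!mulrA; congr (_ * _).
rewrite [RHS]mulrA commr_polyX -mulrA; congr (_ * _).
by apply/esym/map_comm => i j; rewrite coefX_cur coefZ_cur xz.
Qed.

Lemma z2Y : z2 * Y' = Y' * z2.
Proof.
rewrite /z2 [RHS]mulrA commr_polyX -!mulrA; congr (_ * _); rewrite -!rmorphM; congr (map_poly _ _).
by apply: comm_poly2 => i j; rewrite coefY_cur coefZ_cur yz.
Qed.

Lemma z12 : z1 * z2 = z2 * z1.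
Proof.
rewrite /z2 [LHS]mulrA commr_polyX -!mulrA; congr (_ * _); apply: map_comm => i j.
by rewrite coefXM coefZ_cur; case: eqP => _; rewrite ?mul0r ?mulr0 // coefZ_cur zz.
Qed.

(** The commutator of Y(eta) and X(xi) is the sum of z_(i+j) xi^i eta^j, that is (xi Z(xi) - eta
    Z(eta)) / (xi - eta); the factor [de] in [X'] removes the denominator. *)
Lemma YX' : Y' * X' = X' * Y' + z1 - z2.
Proof.
rewrite /X' mulrA -de_comm -!mulrA -addrA; apply/eqP; rewrite addrC -subr_eq -mulrBr; apply/eqP.
have -> : Y' * X%:P - X%:P * Y' = \poly_(j < nn) \poly_(i < nn) z (i + j)%N.
  apply/polyP => j; rewrite coefB coefMC coefCM [in RHS]coef_poly; apply/polyP => i.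
  rewrite /Y' coef_map_id0 ?polyC0 // coefB coefCM coefMC coefX_cur coefY_cur yx [_ + z _]addrC addrK.
  case: ltnP => jn; last by rewrite coef0 z0 // (leq_trans jn) ?leq_addl.
  by rewrite coef_poly; case: ltnP => // h; rewrite z0 // (leq_trans h) ?leq_addr.
apply/polyP => j; apply/polyP => i.
have E j' i' : (\poly_(j < nn) \poly_(i < nn) z (i + j)%N)`_j'`_i' = z (i' + j')%N.
  rewrite coef_poly; case: ltnP => jn; last by rewrite coef0 z0 // (leq_trans jn) ?leq_addl.
  by rewrite coef_poly; case: ltnP => // h; rewrite z0 // (leq_trans h) ?leq_addr.
rewrite /de mulrBl !coefB coefCM coefXM /z1 coefC /z2 coefXM coefXM coef_map_id0 ?polyC0 //.
case: j => [|j] /=; rewrite ?coef0 ?subr0 ?sub0r.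
  case: i => [|i] /=; first by rewrite coefXM.
  by rewrite E addn0 coefXM coefZ_cur.
rewrite coefC coefZ_cur E; case: i => [|i] /=; first by rewrite E sub0r.
by rewrite E addSnnS subrr oppr0.
Qed.

Local Notation L := (nord X' Y' z1).
Definition Lam (e : S) : {poly {poly F}} := map_poly (map_poly lam) e.

Lemma coef_Lam e j i : (Lam e)`_j`_i = lam (e`_j`_i).
Proof.
rewrite /Lam coef_map_id0; last by apply/polyP => k; rewrite coef_map_id0 ?raddf0 // !coef0 raddf0.
by rewrite coef_map_id0 ?raddf0.
Qed.

Lemma LamD e f : Lam (e + f) = Lam e + Lam f.
Proof. by apply/polyP => j; apply/polyP => i; rewrite !(coefD, coef_Lam) raddfD. Qed.
Lemma LamN e : Lam (- e) = - Lam e.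
Proof. by apply/polyP => j; apply/polyP => i; rewrite !(coefN, coef_Lam) raddfN. Qed.
Lemma LamMn e k : Lam (e *+ k) = Lam e *+ k.
Proof. by apply/polyP => j; apply/polyP => i; rewrite !(coefMn, coef_Lam) raddfMn. Qed.
Lemma Lam0 : Lam 0 = 0.
Proof. by apply/polyP => j; apply/polyP => i; rewrite coef_Lam !coef0 raddf0. Qed.
Lemma LamX e : Lam ('X * e) = 'X * Lam e.
Proof.
apply/polyP => j; apply/polyP => i; rewrite !(coefXM, coef_Lam).
by case: j => [|j] /=; rewrite ?coef0 ?raddf0 // coef_Lam.
Qed.
Lemma LamXP e : Lam ('X%:P * e) = 'X%:P * Lam e.
Proof.
apply/polyP => j; apply/polyP => i; rewrite coef_Lam !coefCM !coefXM.
by case: i => [|i] /=; rewrite ?raddf0 // coef_Lam.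
Qed.
Let deF : {poly {poly F}} := 'X%:P - 'X.
Lemma Lam_de e k : Lam (de ^+ k * e) = deF ^+ k * Lam e.
Proof.
elim: k => [|k IH]; first by rewrite !expr0 !mul1r.
by rewrite !exprS -!mulrA /de mulrBl LamD LamN LamXP LamX IH -mulrBl.
Qed.
Lemma Lam_XPn e k : Lam ('X%:P ^+ k * e) = 'X%:P ^+ k * Lam e.
Proof.
by elim: k => [|k IH]; rewrite ?expr0 ?mul1r // !exprS -!mulrA LamXP IH.
Qed.

Variables Px Py : nat -> nat.
Hypotheses (Pxm : forall a, (Px a <= Px a.+1)%N) (Pym : forall a, (Py a <= Py a.+1)%N).
Hypotheses (hX : forall a N u, (Px a < N + a)%N -> lam ((X ^+ a)`_N * u) = 0)
           (hY : forall b N u, (Py b < N + b)%N -> lam ((Y ^+ b)`_N * u) = 0).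

(** Degree in eta at most Py B - B + A: in the recursion that appends X only the factor xi - eta
    involves eta, and it raises the degree by one. The free factor [w], a polynomial in xi, absorbs
    X(xi) and [z1]. *)
Lemma nord_degY A B w j : (Py B + A < j + B)%N -> (Lam (L A B * w%:P))`_j = 0.
Proof.
elim: A B w j => [|A IH] B w j h.
  apply/polyP => i; rewrite coef_Lam coefMC coef0 /= -rmorphXn coef_map_id0 ?polyC0 //.
  by rewrite coefCM hY //; lia.
rewrite [L _ _]/= mulrBl LamD LamN /X' /de mulrA -de_comm /de -!mulrA mulrBl LamD LamN LamXP LamX.
rewrite -polyCM mulrnAl LamMn -/z1 (nord_comm (X := X') (Y := Y') (z1 := z1) _ _ z1X z1Y erefl).
rewrite -mulrA /z1 -polyCM !coefB coefCM coefXM IH ?mulr0; last by lia.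
rewrite sub0r; case: eqP => [j0|j0].
  rewrite oppr0 sub0r coefMn; case: B h => [|B] h; first by rewrite mulr0n oppr0.
  by rewrite /= IH ?mul0rn ?oppr0 //; have := Pym B; lia.
rewrite IH; last by lia.
rewrite oppr0 sub0r coefMn; case: B h => [|B] h; first by rewrite mulr0n oppr0.
by rewrite /= IH ?mul0rn ?oppr0 //; have := Pym B; lia.
Qed.

(** Degree in xi at most Px A. The recursion that appends Y introduces no xi, and for B = 0 the
    product is (xi - eta)^A X(xi)^A, where the A factors compensate the bound Px A - A for
    X(xi)^A. *)
Lemma nord_degX A B w j i : (Px A < i)%N -> (Lam (L A B * map_poly polyC w))`_j`_i = 0.
Proof.
elim: B A w j => [|B IH] A w j h.
  have -> : L A 0 = X' ^+ A.
    by elim: (A) => //= A' ->; rewrite mulr0n subr0 exprSr.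
  have -> : X' ^+ A * map_poly polyC w = de ^+ A * ((X ^+ A)%:P * map_poly polyC w).
    rewrite mulrA; congr (_ * _); rewrite polyC_exp /X' exprMn_comm //; exact: de_comm.
  rewrite Lam_de.
  have : forall j i, (Px A < i + A)%N -> (Lam ((X ^+ A)%:P * map_poly polyC w))`_j`_i = 0.
    by move=> j' i' h'; rewrite coef_Lam coefCM coef_map_id0 ?polyC0 // coefMC hX.
  move: (Lam _) => e He.
  have : forall k j i, (Px A + k < i + A)%N -> (deF ^+ k * e)`_j`_i = 0.
    elim=> [|k IHk] j' i' h'; first by rewrite expr0 mul1r He //; lia.
    rewrite exprS -mulrA mulrBl !coefB coefCM !coefXM.
    case: i' h' => [|i'] h' /=; case: j' => [|j'] /=; rewrite ?coef0 ?IHk ?subr0 //; lia.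
  by apply; lia.
rewrite (nordY z1X z1Y z2X z2Y z12 YX') mulrBl LamD LamN -mulrA -rmorphM coefB coefB IH // sub0r.
rewrite mulrnAl LamMn (nord_comm _ _ z2X z2Y (esym z12)) /z2.
rewrite [_ * ('X * _)]mulrA commr_polyX -!mulrA -rmorphM LamX !coefMn coefXM.
case: A h => [|A] h; first by rewrite mulr0n oppr0.
by case: j => [|j] /=; rewrite ?coef0 ?mul0rn ?oppr0 // IH ?mul0rn ?oppr0 //; have := Pxm A; lia.
Qed.

Variables a b c : nat.
Hypothesis char0 : forall m, m.+1%:R != 0 :> F.
Hypothesis hlow : forall a' b' c', (a' + b' < a + b)%N -> forall i j k,
  lam ((Y ^+ b')`_i * (X ^+ a')`_j * (Z ^+ c')`_k) = 0.

(* With X' = (xi - eta) X(xi) one has [Y(eta), X'] = xi Z(xi) - eta Z(eta).  The normally ordered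
   product L of X'^A and Y^B, A = a + c, B = b + c, satisfies one recursion in A and one in B, which
   bound its degree in eta and in xi.  Modulo terms killed by lam, L is divisible by (xi - eta)^a, and
   the quotient at xi = eta is a nonzero multiple of Y^b X^a (xi Z)^c. *)
Theorem mixed_relation N : (Px (a + c) + Py (b + c) < N + a + b + c)%N ->
  lam (Y ^+ b * X ^+ a * Z ^+ c)`_N = 0.
Proof.
set A := (a + c)%N; set B := (b + c)%N => hN.
pose gj j := Lam (map_poly polyC (Y ^+ (B - j)) * (X ^+ (A - j) * Z ^+ j)%:P).
pose K := \sum_(j < c.+1) (-1) ^+ j * (deF ^+ (c - j) * ('X%:P ^+ j * gj j)) *+ ncoef A B j.
have GE : Lam (L A B) = deF ^+ a * K.
  have LamS (r : seq nat) (f : nat -> S) : Lam (\sum_(j <- r) f j) = \sum_(j <- r) Lam (f j).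
    by elim/big_ind2: _ => [|u1 u2 v1 v2 <- <-|//]; rewrite ?Lam0 ?LamD.
  have Lsign j e : Lam ((-1) ^+ j * e) = (-1) ^+ j * Lam e.
    by rewrite -signr_odd -[in RHS]signr_odd; case: odd; rewrite ?expr0 ?expr1 ?mul1r ?mulN1r ?LamN.
  have ZP : z1 = 'X%:P * Z%:P by rewrite /z1 polyCM.
  have tE j k m : Lam (z1 ^+ j * (Y' ^+ m * X' ^+ k)) =
     deF ^+ k * ('X%:P ^+ j * Lam (map_poly polyC (Y ^+ m) * (X ^+ k * Z ^+ j)%:P)).
    rewrite -Lam_XPn -Lam_de; congr Lam.
    rewrite ZP exprMn_comm; last exact: XP_comm.
    rewrite /X' exprMn_comm; last exact: de_comm.
    have dX (e e' : S) : e * (de ^+ k * e') = de ^+ k * (e * e').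
      have H : e * de ^+ k = de ^+ k * e by apply/commrX/esym/de_comm.
      by rewrite !mulrA H.
    rewrite !dX -!mulrA; congr (_ * (_ * _)).
    have ZY : Z%:P ^+ j * Y' ^+ m = Y' ^+ m * Z%:P ^+ j.
      apply: commrX; apply/esym/commrX; apply/esym/map_comm => i i'.
      by rewrite coefZ_cur coefY_cur yz.
    have ZX : Z ^+ j * X ^+ k = X ^+ k * Z ^+ j.
      by apply: commrX; apply/esym/commrX; exact: XZ_comm.
    by rewrite mulrA ZY -mulrA -!polyC_exp -polyCM ZX rmorphXn.
  (* Beyond j = c the contractions leave fewer than a + b letters X and Y, and [hlow] applies. *)
  have gj0 j : (c < j <= A)%N -> gj j = 0.
    case/andP=> cj jA; apply/polyP => p; apply/polyP => q; rewrite coef_Lam !coef0 coefMC.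
    rewrite coef_map_id0 ?polyC0 // coefCM coefM mulr_sumr raddf_sum big1 // => i _ /=.
    by rewrite mulrA hlow // /A /B; lia.
  rewrite (nord_sum X' Y' z1) -(big_mkord xpredT (fun j =>
    (-1) ^+ j * (z1 ^+ j * (Y' ^+ (B - j) * X' ^+ (A - j))) *+ ncoef A B j)) LamS.
  rewrite (@big_cat_nat _ _ _ c.+1) //=; last by rewrite ltnS /A leq_addl.
  rewrite [X in _ + X]big_nat_cond [X in _ + X]big1 ?addr0 => [|j /andP[/andP[cj jA] _]]; last first.
    by rewrite LamMn Lsign tE -/(gj j) gj0 ?mulr0 ?mul0rn // cj.
  rewrite big_mkord /K mulr_sumr; apply: eq_bigr => j _.
  rewrite LamMn Lsign tE -/(gj j) mulrnAr; congr (_ *+ _); rewrite [RHS]mulrCA; congr (_ * _).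
  rewrite [RHS]mulrA -exprD; congr (_ ^+ _ * _); rewrite /A.
  by have := ltn_ord j; lia.
have sz (d : {poly {poly F}}) k q : size d = 2%N -> q != 0 -> size (d ^+ k * q) = (size q + k)%N.
  move=> sd q0; have d0 : d != 0 by rewrite -size_poly_eq0 sd.
  elim: k => [|k IH]; first by rewrite expr0 mul1r addn0.
  by rewrite exprS -mulrA size_mul ?mulf_neq0 ?expf_neq0 // IH sd addnS.
have sd : size deF = 2%N by rewrite /deF -size_polyN opprB size_XsubC.
have sd' : size (swapXY deF) = 2%N by rewrite /deF rmorphB /= swapXY_Y swapXY_X size_XsubC.
(* Dividing by (xi - eta)^a lowers both degrees by a: [K] has degree at most Py B - b in eta and Px
   A - a in xi. *)
have Ksize : K != 0 -> ((size K).-1 + b <= Py B)%N /\ ((sizeY K).-1 + a <= Px A)%N.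
  move=> K0; have sK : (0 < size K)%N by rewrite size_poly_gt0.
  have sK' : (0 < sizeY K)%N by rewrite lt0n sizeY_eq0.
  have G0 : Lam (L A B) != 0 by rewrite GE mulf_neq0 // expf_neq0 // -size_poly_eq0 sd.
  split; rewrite leqNgt; apply/negP => h.
    have : lead_coef (Lam (L A B)) = 0.
      rewrite lead_coefE GE sz // -GE -[L A B]mulr1 -[1 : S]/(1%:P) nord_degY //.
      have eA : A = (a + c)%N by []; have eB : B = (b + c)%N by [].
      move: h sK; move: (size _) => q; lia.
    by move/eqP; rewrite lead_coef_eq0 (negbTE G0).
  have e : swapXY (Lam (L A B)) = (swapXY deF) ^+ a * swapXY K by rewrite GE rmorphM rmorphXn.
  have : lead_coef (swapXY (Lam (L A B))) = 0.
    apply/polyP => j; rewrite lead_coefE coef_swapXY coef0 e sz ?swapXY_eq0 // -sizeYE.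
    by have := @nord_degX A B 1 j (sizeY K + a).-1; rewrite rmorph1 mulr1; apply; lia.
  by move/eqP; rewrite lead_coef_eq0 swapXY_eq0 (negbTE G0).
(* On the diagonal every term with a positive power of xi - eta vanishes, so only j = c remains. *)
have KX : K.['X] = ((-1) ^+ c * ('X ^+ c * (gj c).['X])) *+ ncoef A B c.
  rewrite /K horner_sum big_ord_recr /= big1 ?add0r => [|j _].
    by rewrite hornerMn !hornerM subnn expr0 hornerC mul1r !horner_exp hornerN !hornerC.
  rewrite hornerMn !hornerM [(deF ^+ _).[_]]horner_exp /deF hornerD hornerN hornerC hornerX subrr.
  by rewrite expr0n subn_eq0 leqNgt ltn_ord /= mul0r mulr0 mul0rn.
have gN : ((gj c).['X])`_N = lam (Y ^+ b * X ^+ a * Z ^+ c)`_N.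
  have E j : ((gj c)`_j * 'X^j)`_N = if (j <= N)%N then
      lam ((Y ^+ b)`_j * (X ^+ a * Z ^+ c)`_(N - j)) else 0.
    rewrite coefMXn ltnNge; case: leqP => //= _; rewrite coef_Lam coefMC coef_map_id0 ?polyC0 //.
    by rewrite coefCM /A /B !addnK.
  rewrite (@horner_coef_wide _ (maxn (size (gj c)) N.+1)) ?leq_maxl // coef_sum -mulrA coefM raddf_sum.
  under eq_bigr => j _ do rewrite E.
  rewrite -big_mkcond /= [RHS](big_ord_widen (maxn (size (gj c)) N.+1)
    (fun j => lam ((Y ^+ b)`_j * (X ^+ a * Z ^+ c)`_(N - j)))) ?leq_maxr //.
(* The two degree bounds add up to Px A + Py B - a - b, which is less than N + c by [hN]. *)
have : (K.['X])`_(N + c) = 0.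
  have [->|K0] := eqVneq K 0; first by rewrite horner0 coef0.
  apply: nth_default; apply: leq_trans (max_size_evalX _) _.
  have [] := Ksize K0; have : (0 < sizeY K)%N by rewrite lt0n sizeY_eq0.
  by move: (size _) (sizeY _) => s1 s2; lia.
rewrite KX coefMn -signr_odd; set w := 'X ^+ c * _.
have wN : w`_(N + c) = lam (Y ^+ b * X ^+ a * Z ^+ c)`_N.
  by rewrite /w mulrC coefMXn ltnNge leq_addl /= addnK gN.
have nz : (ncoef A B c)%:R != 0 :> F.
  by rewrite -(prednK (ncoef_gt0 _ _)) // /A /B leq_addl.
case: odd; rewrite ?expr0 ?expr1 ?mul1r ?mulN1r ?coefN wN -mulr_natr => /eqP;
  by rewrite mulf_eq0 (negbTE nz) orbF ?oppr_eq0 => /eqP.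
Qed.

End Mixed.

(** * Modules over commuting currents *)

Section Eval.
Variables (C : comNzRingType) (S : nzRingType) (n : nat) (f : {rmorphism C -> S}) (h : 'I_n -> S).
Hypotheses (hh : forall i j, h i * h j = h j * h i) (fh : forall c i, f c * h i = h i * f c).

Lemma mmap1D m1 m2 : mmap1 h (m1 + m2) = mmap1 h m1 * mmap1 h m2.
Proof.
rewrite /mmap1; elim: (index_enum _) => [|i s IH]; first by rewrite !big_nil mulr1.
rewrite !big_cons IH mnmDE exprD -!mulrA; congr (_ * _); rewrite !mulrA; congr (_ * _).
have H (k : 'X_{1..n}) : h i ^+ m2 i * \prod_(j <- s) h j ^+ k j = \prod_(j <- s) h j ^+ k j * h i ^+ m2 i.
  elim: s {IH} => [|j s IH]; first by rewrite !big_nil mulr1 mul1r.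
  rewrite !big_cons mulrA; have -> : h i ^+ m2 i * h j ^+ k j = h j ^+ k j * h i ^+ m2 i.
    by apply: commrX; apply/esym/commrX; exact: hh.
  by rewrite -!mulrA IH.
exact: H.
Qed.

Lemma f_mmap1 c m : f c * mmap1 h m = mmap1 h m * f c.
Proof.
rewrite /mmap1; apply: (big_ind (fun x => f c * x = x * f c)).
- by rewrite mulr1 mul1r.
- by move=> x y hx hy; rewrite mulrA hx -mulrA hy mulrA.
- by move=> i _; apply: commrX; exact: fh.
Qed.

(** Evaluation in a noncommutative ring; it is multiplicative because the values commute with each
    other and with the images of the coefficients. *)
Definition ev (p : {mpoly C[n]}) : S := mmap f h p.

Lemma ev_is_additive : additive ev. Proof. exact: mmap_is_additive. Qed.
HB.instance Definition _ := GRing.isAdditive.Build _ _ ev ev_is_additive.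

Lemma evZ c p : ev (c *: p) = f c * ev p. Proof. exact: mmapZ. Qed.
Lemma evXm m : ev 'X_[m] = mmap1 h m. Proof. exact: mmapX. Qed.

Lemma ev_is_multiplicative : multiplicative ev.
Proof.
split=> [p q|]; last by rewrite -mpolyX0 evXm mmap11.
elim/mpolyind: p => [|c m p _ _ IH]; first by rewrite mul0r raddf0 mul0r.
rewrite mulrDl !raddfD /= IH mulrDl; congr (_ + _); rewrite -scalerAl !evZ -mulrA; congr (_ * _).
elim/mpolyind: q {IH} => [|d m' q _ _ IH]; first by rewrite mulr0 raddf0 mulr0.
rewrite mulrDr !raddfD /= IH mulrDr; congr (_ + _); rewrite -scalerAr !evZ !evXm -mpolyXD evXm mmap1D.
by rewrite mulrA f_mmap1 -mulrA.
Qed.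
HB.instance Definition _ := GRing.isMultiplicative.Build _ _ ev ev_is_multiplicative.

Lemma evC c : ev c%:MP = f c. Proof. exact: mmapC. Qed.
Lemma evX i : ev 'X_i = h i. Proof. by rewrite evXm mmap1U. Qed.
Definition ev_rm : {rmorphism {mpoly C[n]} -> S} := ev.
End Eval.

Lemma gen_coef (C : comNzRingType) (A : comAlgType C) (G : A -> Prop) (ys : seq A) u :
  gen (idl G) ys u -> exists c : nat -> C, idl G (u - \sum_(j < size ys) c j *: ys`_j).
Proof.
elim=> [x ix|a y x yy _ [c ic]].
  by exists (fun _ => 0); rewrite big1 ?subr0 // => j _; rewrite scale0r.
exists (fun j => c j + (if j == index y ys then a else 0)).
have h : (index y ys < size ys)%N by rewrite index_mem.
suff -> : \sum_(j < size ys) (c j + (if val j == index y ys then a else 0)) *: ys`_j =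
   a *: y + \sum_(j < size ys) c j *: ys`_j by rewrite opprD addrACA subrr add0r.
under eq_bigr => j _ do rewrite scalerDl.
rewrite big_split /= addrC; congr (_ + _).
rewrite (bigD1 (Ordinal h)) //= eqxx nth_index // big1 ?addr0 // => j jh.
case: eqP => [e|]; last by rewrite scale0r.
by move/eqP: jh; case; apply: val_inj.
Qed.

Definition lv ka := proj1_sig (constructive_indefinite_description _ (lvs_exists ka)).
Lemma lvP ka : lvs ka (lv ka).
Proof. exact: proj2_sig (constructive_indefinite_description _ (lvs_exists ka)). Qed.

(** The leaf monomials of a family with no further currents; they turn out to be a monomial basis of
    the sl_2 fusion product with factors [rho]. *)
Definition zb (rho : seq nat) : seq (seq nat) := unzip1 (lv rho).

Section ZRel.
Variables (F : fieldType) (n : nat).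
Hypothesis char0 : forall m, m.+1%:R != 0 :> F.
Local Notation Cz := {mpoly F[n.+1]}.

(** The ideal generated by the coefficients (Z^c)_N with N + c > P_c(rho), which annihilates the
    cyclic vector of pi_rho. *)
Definition Rel (rho : seq nat) : Cz -> Prop :=
  idl (ygen (T := unit) (fun=> 1) (fun=> 0%N) (fun=> 0%N) rho (fun=> 0%N)).

Lemma char0F m : exists c : F, m.+1%:R * c = 1.
Proof. by exists m.+1%:R^-1; rewrite mulfV. Qed.

Lemma char0M (C : comNzRingType) k : (forall m, exists c : C, m.+1%:R * c = 1) ->
  forall m, exists c : {mpoly C[k]}, m.+1%:R * c = 1.
Proof. by move=> H m; have [c hc] := H m; exists c%:MP; rewrite -mpolyC_nat -mpolyCM hc mpolyC1. Qed.

Lemma zb_span rho (p : Cz) : exists c : nat -> F,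
  Rel rho (p - \sum_(j < size (zb rho)) c j *: monom F n (nth [::] (zb rho) j)).
Proof.
have [|H _] := family_leaves n char0F (T := unit) (g := fun=> 1) (co := fun=> 0%N)
  (of_ := fun=> 0%N) _ (lvP rho) (be := fun=> 0%N) (fun _ _ _ => erefl).
  by exists tt.
have /gen_coef[c] := H p; rewrite size_map => hc; exists c; move: hc; rewrite /Rel.
congr (idl _ (_ - _)); rewrite /zb size_map; apply: eq_bigr => j _; congr (_ *: _).
by rewrite /unzip1 !(nth_map ([::], [::])).
Qed.

End ZRel.

Section Ops.
Variables (R : nzRingType).
Definition wop (ops : nat -> R) (l : seq nat) : R := \prod_(i <- l) ops i.
Definition cur n (ops : nat -> R) : {poly R} := \poly_(i < n.+1) ops i.
End Ops.

Section EvFam.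
Variables (C : comNzRingType) (R : nzRingType) (n : nat) (f : {rmorphism C -> R}) (ops : nat -> R).
Hypothesis ops0 : forall i, (n < i)%N -> ops i = 0.
Hypotheses (hh : forall i j, ops i * ops j = ops j * ops i) (fh : forall c i, f c * ops i = ops i * f c).
Local Notation Th := (ev_rm (n := n.+1) (h := fun i => ops i) (fun i j => hh i j) (fun c i => fh c i)).

Lemma ev_yv i : Th (yv C n i) = ops i.
Proof.
have [h|h] := ltnP i n.+1; last by rewrite yv_out // rmorph0 ops0.
by rewrite -[ i ]/(val (Ordinal h)) yvE [LHS]evX.
Qed.

Lemma ev_monom l : Th (monom C n l) = wop ops l.
Proof. by rewrite /monom rmorph_prod; apply: eq_bigr => i _; exact: ev_yv. Qed.

Lemma ev_ycur : map_poly Th (ycur C n) = cur n ops.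
Proof.
by apply/polyP => i; rewrite coef_map coef_ycur [LHS]ev_yv coef_poly; case: ltnP => // /ops0.
Qed.

Lemma ev_const c : Th c%:MP = f c. Proof. exact: evC. Qed.
Lemma ev_scale c p : Th (c *: p) = f c * Th p. Proof. exact: evZ. Qed.

Lemma ev_comm s : (forall c, f c * s = s * f c) -> (forall i, ops i * s = s * ops i) ->
  forall p, Th p * s = s * Th p.
Proof.
move=> fs os p; rewrite [p]mpolyE rmorph_sum mulr_suml mulr_sumr; apply: eq_bigr => m _.
have E : Th 'X_[m] = mmap1 (fun i : 'I_n.+1 => ops i) m by exact: evXm.
rewrite ev_scale E -mulrA; have -> : mmap1 (fun i : 'I_n.+1 => ops i) m * s = s * mmap1 (fun i : 'I_n.+1 => ops i) m.
  rewrite /mmap1; apply: (big_ind (fun x => x * s = s * x)).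
  - by rewrite mulr1 mul1r.
  - by move=> x y hx hy; rewrite -mulrA hy mulrA hx mulrA.
  - by move=> i _; apply/esym/commrX/esym/os.
by rewrite mulrA fs mulrA.
Qed.
End EvFam.

(** Brings a subspace given by a predicate into the matrix calculus: adjoining missing vectors must
    stop, since each raises the rank. *)
Lemma subspace_matrix (F : fieldType) n (W : 'rV[F]_n -> Prop) : W 0 ->
  (forall u w, W u -> W w -> W (u + w)) -> (forall a u, W u -> W (a *: u)) ->
  exists T : 'M[F]_n, forall w, (w <= T)%MS <-> W w.
Proof.
move=> W0 WD WZ.
suff H d : forall T : 'M[F]_n, (forall w, (w <= T)%MS -> W w) -> (n - \rank T < d)%N ->
    exists T' : 'M[F]_n, forall w, (w <= T')%MS <-> W w.
  by apply: (H n.+1 0); [move=> w; rewrite submx0 => /eqP -> | rewrite mxrank0 subn0].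
elim: d => // d IH T TW hd.
case: (classic (forall w, W w -> (w <= T)%MS)) => [h|h]; first by exists T => w; split=> [/TW|/h].
have [w Ww wT] : exists2 w, W w & ~~ (w <= T)%MS.
  by apply: NNPP => h'; apply: h => w Ww; apply: contraT => nw; case: h'; exists w.
apply: (IH (T + <<w>>)%MS).
  move=> x /sub_addsmxP[[y1 y2] /= ->]; apply: WD; first by apply: TW; exact: submxMl.
  have /sub_rVP[a ->] : (y2 *m <<w>> <= w)%MS by rewrite mulmx_sub // genmxE.
  exact: WZ.
have lt : (\rank T < \rank (T + <<w>>)%MS)%N.
  rewrite ltnNge; apply: contra wT => le.
  apply: submx_trans (_ : (T + <<w>> <= T)%MS).
    by apply: submx_trans (addsmxSr _ _); rewrite genmxE.
  by rewrite -(geq_leqif (mxrank_leqif_sup (addsmxSl T _))).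
have := rank_leq_row (T + <<w>>)%MS; lia.
Qed.

Lemma pmin_r0 ka : pmin ka 0 = 0%N.
Proof. by rewrite /pmin big1 // => k _; rewrite minn0. Qed.

Lemma pmin_cat ka kb c : pmin (ka ++ kb) c = (pmin ka c + pmin kb c)%N.
Proof. by rewrite /pmin big_cat. Qed.

Section ZModule.
Variables (F : fieldType) (r n : nat).
Hypothesis char0 : forall m, m.+1%:R != 0 :> F.
Local Notation R := 'M[F]_r.+1.
Variables (Z : nat -> R) (v : 'rV[F]_r.+1).
Hypothesis Z0 : forall i, (n < i)%N -> Z i = 0.
Hypothesis ZZ : forall i j, Z i * Z j = Z j * Z i.

Lemma scalar_comm (s : R) (c : F) : (scalar_mx c : R) * s = s * scalar_mx c.
Proof. by apply/esym; exact: scalar_mxC. Qed.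

Let scF (c : F) i : (scalar_mx c : R) * Z i = Z i * scalar_mx c.
Proof. exact: scalar_comm. Qed.

Definition Thz : {rmorphism {mpoly F[n.+1]} -> R} :=
  ev_rm (f := (@scalar_mx F r.+1 : {rmorphism F -> R})) (h := fun i : 'I_n.+1 => Z i) (fun i j => ZZ i j) (fun c i => scF c i).

Lemma Thz_yv i : Thz (yv F n i) = Z i. Proof. exact: (ev_yv Z0 ZZ scF). Qed.
Lemma Thz_monom l : Thz (monom F n l) = wop Z l. Proof. exact: (ev_monom Z0 ZZ scF). Qed.
Lemma Thz_ycur : map_poly Thz (ycur F n) = cur n Z. Proof. exact: (ev_ycur Z0 ZZ scF). Qed.
Lemma Thz_scale c p : Thz (c *: p) = c *: Thz p.
Proof. by rewrite -mul_scalar_mx; exact: (ev_scale ZZ scF). Qed.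
Lemma Thz_comm (s : R) : (forall i, Z i * s = s * Z i) -> forall p, Thz p * s = s * Thz p.
Proof. by move=> H p; exact: (ev_comm ZZ scF (fun c => scalar_comm s c) H). Qed.

Lemma Thz_Rel rho : (forall c N, (pmin rho c < N + c)%N -> v *m (cur n Z ^+ c)`_N = 0) ->
  forall p, Rel rho p -> v *m Thz p = 0.
Proof.
move=> H p; elim=> [|a q x [[] [c [N [h ->]]]] _ IH]; first by rewrite rmorph0 mulmx0.
rewrite rmorphD mulmxDr IH addr0 mulrC rmorphM -[_ * _]/(_ *m _) mulmxA.
suff -> : v *m Thz (ycur F n ^+ c * map_poly (mpolyC n.+1 (R:=F)) 1)`_N = 0 by rewrite mul0mx.
rewrite rmorph1 mulr1 -coef_map rmorphXn /= Thz_ycur H //.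
by move: h; rewrite !addn0.
Qed.
End ZModule.

Section Module.
Variables (F : fieldType) (r n : nat).
Hypothesis char0 : forall m, m.+1%:R != 0 :> F.
Local Notation R := 'M[F]_r.+1.
Variables (X Y Z : nat -> R) (v : 'rV[F]_r.+1) (ka kb : seq nat).
Hypotheses (X0 : forall i, (n < i)%N -> X i = 0) (Y0 : forall i, (n < i)%N -> Y i = 0)
  (Z0 : forall i, (n < i)%N -> Z i = 0).
Hypotheses (XX : forall i j, X i * X j = X j * X i) (YY : forall i j, Y i * Y j = Y j * Y i)
  (ZZ : forall i j, Z i * Z j = Z j * Z i) (YX : forall i j, X i * Y j = Y j * X i)
  (ZX : forall i j, Z i * X j = X j * Z i) (ZY : forall i j, Z i * Y j = Y j * Z i).
Hypothesis cyclic : forall T : R, (v <= T)%MS -> (forall i, (T *m X i <= T)%MS) ->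
  (forall i, (T *m Y i <= T)%MS) -> (forall i, (T *m Z i <= T)%MS) -> (1%:M <= T)%MS.
Hypothesis rel : forall a b c N, (pmin ka (b + c) + pmin kb (a + c) < N + a + b + c)%N ->
  v *m (cur n Y ^+ b * cur n X ^+ a * cur n Z ^+ c)`_N = 0.

Local Notation Cz := {mpoly F[n.+1]}.
Local Notation Cx := {mpoly Cz[n.+1]}.
Local Notation Cy := {mpoly Cx[n.+1]}.
Local Notation tz := (Thz n ZZ).

Let tzX c i : tz c * X i = X i * tz c. Proof. exact: Thz_comm. Qed.
Let tzY c i : tz c * Y i = Y i * tz c. Proof. exact: Thz_comm. Qed.
Let tx : {rmorphism Cx -> R} := ev_rm (f := tz) (h := fun i : 'I_n.+1 => X i) (fun i j => XX i j) (fun c i => tzX c i).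
Let txY c i : tx c * Y i = Y i * tx c.
Proof. by apply: (ev_comm XX tzX) => [c'|j]; [exact: tzY | rewrite YX]. Qed.
Let ty : {rmorphism Cy -> R} := ev_rm (f := tx) (h := fun i : 'I_n.+1 => Y i) (fun i j => YY i j) (fun c i => txY c i).

Let tx_const c : tx c%:MP = tz c. Proof. exact: (ev_const n XX tzX). Qed.
Let tx_scale c p : tx (c *: p) = tz c * tx p. Proof. exact: (ev_scale XX tzX). Qed.
Let tx_yv i : tx (yv Cz n i) = X i. Proof. exact: (ev_yv X0 XX tzX). Qed.
Let tx_monom l : tx (monom Cz n l) = wop X l. Proof. exact: (ev_monom X0 XX tzX). Qed.
Let tx_ycur : map_poly tx (ycur Cz n) = cur n X. Proof. exact: (ev_ycur X0 XX tzX). Qed.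
Let ty_const c : ty c%:MP = tx c. Proof. exact: (ev_const n YY txY). Qed.
Let ty_scale c p : ty (c *: p) = tx c * ty p. Proof. exact: (ev_scale YY txY). Qed.
Let ty_yv i : ty (yv Cx n i) = Y i. Proof. exact: (ev_yv Y0 YY txY). Qed.
Let ty_monom l : ty (monom Cx n l) = wop Y l. Proof. exact: (ev_monom Y0 YY txY). Qed.
Let ty_ycur : map_poly ty (ycur Cx n) = cur n Y. Proof. exact: (ev_ycur Y0 YY txY). Qed.

(** [t] is the pair of exponents (a, c) of X and Z. Z shares the bound P_{b+c} with Y and the bound
    Pb_{a+c} with X, hence [co] is the second entry, while [of_] and the argument of Pb are the
    sum. *)
Let gx (t : nat * nat) : {poly Cx} := ycur Cz n ^+ t.1 * map_poly (@mpolyC n.+1 Cz) (ycur F n ^+ t.2).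
Let Iy := idl (ygen (n := n) gx (fun t => t.2) (fun t => t.1 + t.2)%N ka (fun t => pmin kb (t.1 + t.2))).

Lemma ty_rel u : Iy u -> v *m ty u = 0.
Proof.
elim=> [|a q x [[s c] [b [N [h ->]]]] _ IH]; first by rewrite rmorph0 mulmx0.
rewrite rmorphD mulmxDr IH addr0 mulrC rmorphM -[_ * _]/(_ *m _) mulmxA.
set y := (_)`_N; suff -> : v *m ty y = 0 by rewrite mul0mx.
rewrite /y -coef_map rmorphM rmorphXn /= ty_ycur.
have -> : map_poly ty (map_poly (mpolyC n.+1 (R:=Cx)) (gx (s, c))) = cur n X ^+ s * cur n Z ^+ c.
  have -> : map_poly ty (map_poly (mpolyC n.+1 (R:=Cx)) (gx (s, c))) = map_poly tx (gx (s, c)).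
    by apply/polyP => i; rewrite !coef_map_id0 ?rmorph0 ?mpolyC0 //; exact: ty_const.
  rewrite rmorphM rmorphXn /= tx_ycur; congr (_ * _).
  have -> : map_poly tx (map_poly (mpolyC n.+1 (R:=Cz)) (ycur F n ^+ c)) = map_poly tz (ycur F n ^+ c).
    by apply/polyP => i; rewrite !coef_map_id0 ?rmorph0 ?mpolyC0 //; exact: tx_const.
  by rewrite rmorphXn /= Thz_ycur.
by rewrite mulrA rel //; move: h => /=; lia.
Qed.

Lemma ty_surj (w : 'rV[F]_r.+1) : exists u, w = v *m ty u.
Proof.
have [|||T TP] := @subspace_matrix F r.+1 (fun w => exists u, w = v *m ty u).
- by exists 0; rewrite rmorph0 mulmx0.
- by move=> _ _ [x ->] [y ->]; exists (x + y); rewrite rmorphD mulmxDr.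
- move=> a _ [x ->]; exists (((a%:MP)%:MP)%:MP * x); rewrite rmorphM.
  have -> : ty ((a%:MP)%:MP)%:MP = a%:M :> R.
    by rewrite ty_const tx_const; exact: evC.
  by rewrite -[_ * _]/(_ *m _) mul_scalar_mx scalemxAr.
have st (s : R) y : ty y = s -> (T *m s <= T)%MS.
  move=> ys; apply/rV_subP => x /submxP[c ->]; rewrite mulmxA.
  have /TP[x' ->] : (c *m T <= T)%MS by exact: submxMl.
  by apply/TP; exists (x' * y); rewrite rmorphM ys -mulmxA.
have : (1%:M <= T)%MS.
  apply: cyclic; first by apply/TP; exists 1; rewrite rmorph1 mulmx1.
  - by move=> i; apply: (st _ (yv Cz n i)%:MP); rewrite ty_const tx_yv.
  - by move=> i; apply: (st _ (yv Cx n i)); exact: ty_yv.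
  - by move=> i; apply: (st _ ((yv F n i)%:MP)%:MP); rewrite ty_const tx_const Thz_yv.
by move=> T1; apply/TP; apply: submx_trans T1; exact: submx1.
Qed.

Definition vec (d : (seq nat * seq nat) * (seq nat * seq nat)) (p : Cz) : 'rV[F]_r.+1 :=
  v *m (wop Y d.1.1 * (wop X d.2.1 * tz p)).
Definition rho_of (d : (seq nat * seq nat) * (seq nat * seq nat)) := d.1.2 ++ d.2.2.
Local Notation nul := ([::] : seq nat, [::] : seq nat).

Let Jx rho := idl (cgen gx (fun t => t.1 + t.2)%N (fun t => pmin kb (t.1 + t.2) + pmin rho t.2)%N).

(** Once Y is split off, the sites [rho] constrain Z alone. The remaining relations are again of the
    form [ygen], now for X, so [family_leaves] can be applied a second time. *)
Lemma Jx_ygen rho x : Jx rho x <->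
  idl (ygen (n := n) (fun c : nat => ycur F n ^+ c) id id kb (pmin rho)) x.
Proof.
split; elim=> [|a q y]; try exact: idl0.
  case=> -[s c] [N [h ->]] _ IH; apply: idlMD => //; exists c, s, N; split=> //.
  by move: h => /=; lia.
case=> c [s [N [h ->]]] _ IH; apply: idlMD => //; exists (s, c), N; split=> //=.
by move: h => /=; lia.
Qed.

Lemma y_leaves : (forall u, gen Iy [seq monom Cx n lr.1 | lr <- lv ka] u) /\
  (forall j x, (j < size (lv ka))%N -> Jx (nth nul (lv ka) j).2 x ->
     gen Iy [seq monom Cx n lr.1 | lr <- take j (lv ka)] (x *: monom Cx n (nth nul (lv ka) j).1)).
Proof.
have c0 := char0M n.+1 (char0M n.+1 (char0F char0)).
apply: (family_leaves n c0 _ (lvP ka)).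
- by exists (0%N, 0%N); split => //; rewrite /gx /= !expr0 rmorph1 mulr1.
- by move=> [a c] /= -> /eqP; rewrite addn0 => /eqP ->; rewrite pmin_r0.
Qed.

Lemma x_leaves rho : 
  let I := idl (ygen (n := n) (fun c : nat => ycur F n ^+ c) id id kb (pmin rho)) in
  (forall u, gen I [seq monom Cz n lr.1 | lr <- lv kb] u) /\
  (forall j x, (j < size (lv kb))%N -> Rel (rho ++ (nth nul (lv kb) j).2) x ->
     gen I [seq monom Cz n lr.1 | lr <- take j (lv kb)] (x *: monom Cz n (nth nul (lv kb) j).1)).
Proof.
have c0 := char0M n.+1 (char0F char0).
have [||H1 H2] := family_leaves n c0 (g := fun c : nat => ycur F n ^+ c) (co := id) (of_ := id) _ (lvP kb) (be := pmin rho).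
- by exists 0%N; rewrite expr0.
- by move=> t /= -> _; rewrite pmin_r0.
split=> // j x js jr; apply: H2 => //; elim: jr => [|a q y]; first exact: idl0.
case=> -[] [c [N [h ->]]] _ IH; apply: idlMD => //; exists c, N; rewrite rmorph1 mulr1; split=> //.
by move: h; rewrite !addn0 pmin_cat.
Qed.

Lemma ty_vec dy dx p : v *m ty ((p *: monom Cz n dx.1) *: monom Cx n dy.1) = vec (dy, dx) p.
Proof.
rewrite ty_scale ty_monom tx_scale tx_monom /vec /=; congr (_ *m _).
have W (s : R) l (ops : nat -> R) : (forall i, s * ops i = ops i * s) -> s * wop ops l = wop ops l * s.
  move=> H; rewrite /wop; elim: l => [|i l IH]; first by rewrite big_nil mulr1 mul1r.
  by rewrite big_cons mulrA H -mulrA IH mulrA.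
have tX i : tz p * X i = X i * tz p by exact: tzX.
have tY i : tz p * Y i = Y i * tz p by exact: tzY.
rewrite (W _ _ _ tX) W // => i; rewrite -mulrA tY mulrA [RHS]mulrA; congr (_ * _).
by apply/esym; apply: W => j; rewrite YX.
Qed.

Lemma ty_addl (c c' : Cx) (m : Cy) : v *m ty ((c + c') *: m) = v *m ty (c *: m) + v *m ty (c' *: m).
Proof.
apply: (etrans (congr1 (mulmx v) (ty_scale (c + c') m))).
apply: (etrans _ (esym (congr2 +%R (congr1 (mulmx v) (ty_scale c m)) (congr1 (mulmx v) (ty_scale c' m))))).
by rewrite (rmorphD tx) mulrDl mulmxDr.
Qed.

Section Sub.
Variable T : R.

Lemma gen_below j u : (forall dy c, dy \in take j (lv ka) -> (v *m ty (c *: monom Cx n dy.1) <= T)%MS) ->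
  gen Iy [seq monom Cx n lr.1 | lr <- take j (lv ka)] u -> (v *m ty u <= T)%MS.
Proof.
move=> H; elim=> [y iy|c y x /mapP[dy dyL ->] _ IH]; first by rewrite ty_rel ?sub0mx.
by rewrite rmorphD mulmxDr addmx_sub // H.
Qed.

(** Induction on the Y-leaves: the coefficient of a Y-monomial reduces to X-leaves modulo [Jx], and
    an element of [Jx] times that monomial falls into the earlier Y-leaves. *)
Lemma vec_below j : (j <= size (lv ka))%N ->
  (forall dy dx p, dy \in take j (lv ka) -> dx \in lv kb -> (vec (dy, dx) p <= T)%MS) ->
  forall dy c, dy \in take j (lv ka) -> (v *m ty (c *: monom Cx n dy.1) <= T)%MS.
Proof.
elim: j => [|j IH] js H dy c; first by rewrite take0.
have {}IH := IH (ltnW js) _.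
have sub dy' : dy' \in take j (lv ka) -> dy' \in take j.+1 (lv ka).
  by rewrite (take_nth nul) // mem_rcons inE => ->; rewrite orbT.
have {}IH := IH (fun dy dx p dyj dxk => H dy dx p (sub _ dyj) dxk).
rewrite (take_nth nul) // mem_rcons inE => /orP[/eqP ->|]; last exact: IH.
have [_ Ry] := y_leaves; have [Gx _] := x_leaves (nth nul (lv ka) j).2.
elim: (Gx c) => [x /Jx_ygen jx|p y x /mapP[dx dxL ->] _ IHx].
  by apply: gen_below (Ry _ _ js jx) => dy'; exact: IH.
rewrite ty_addl; apply: addmx_sub; last exact: IHx.
rewrite ty_vec; apply: H; last exact: dxL.
by rewrite (take_nth nul) // mem_rcons inE eqxx.
Qed.

Lemma vec_span :
  (forall dy dx p, dy \in lv ka -> dx \in lv kb -> (vec (dy, dx) p <= T)%MS) -> (1%:M <= T)%MS.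
Proof.
move=> H; apply/rV_subP => w _; have [u ->] := ty_surj w.
have [Gy _] := y_leaves; have := Gy u; rewrite -{1}(take_size (lv ka)); apply: gen_below.
apply: vec_below => // dy dx p; rewrite take_size; exact: H.
Qed.

(** The order is lexicographic. A relation for the joint list of sites carries the X-monomial into
    earlier X-leaves up to an element of [Jx], and the latter carries the Y-monomial into earlier
    Y-leaves. *)
Lemma vec_rel j j' p : (j < size (lv ka))%N -> (j' < size (lv kb))%N ->
  let dy := nth nul (lv ka) j in let dx := nth nul (lv kb) j' in
  (forall dy' dx' q, dy' \in take j (lv ka) -> dx' \in lv kb -> (vec (dy', dx') q <= T)%MS) ->
  (forall dx' q, dx' \in take j' (lv kb) -> (vec (dy, dx') q <= T)%MS) ->
  Rel (dy.2 ++ dx.2) p -> (vec (dy, dx) p <= T)%MS.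
Proof.
move=> js js' dy dx H1 H2 rp; rewrite -ty_vec.
have [_ Ry] := y_leaves; have [_ Rx] := x_leaves dy.2.
have := Rx _ _ js' rp; rewrite -/dx.
elim=> [x /Jx_ygen jx|q y x /mapP[dx' dxL ->] _ IHx].
  by apply: gen_below (Ry _ _ js jx); apply: vec_below => //; exact: ltnW.
rewrite ty_addl; apply: addmx_sub; last exact: IHx.
by rewrite ty_vec; exact: H2.
Qed.

End Sub.
End Module.

(** * Generating functions of leaves *)

Section Counting.
Implicit Types (ka : seq nat) (L : seq (seq nat * seq nat)).

Lemma lvs_size ka L : lvs ka L -> size L = (\prod_(k <- ka) k.+1)%N.
Proof.
elim=> {ka L} [ka|ka k ka' L1 L2 P _ _ IH1 _ IH2].
  by elim: ka => [|x ka IH] /=; rewrite ?big_nil // => /andP[/eqP -> /IH]; rewrite big_cons mul1n.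
rewrite size_cat !size_map IH1 IH2 (perm_big _ P) /= !big_cons; lia.
Qed.

(** C(k+2, 2) is the dimension of Pi_k; the two branches give C(k+3, 2) = (k+2) + C(k+2, 2), the
    factor k + 2 coming from the site k + 1 kept for Z. *)
Lemma lvs_dim ka L : lvs ka L ->
  (\sum_(lr <- L) \prod_(x <- lr.2) x.+1 = \prod_(k <- ka) 'C(k.+2, 2))%N.
Proof.
elim=> {ka L} [ka|ka k ka' L1 L2 P _ _ IH1 _ IH2].
  rewrite big_seq1 big_nil; elim: ka => [|x ka IH] /=; first by rewrite big_nil.
  by case/andP=> /eqP -> /IH; rewrite big_cons => <-.
rewrite big_cat !big_map /= IH2 (perm_big _ P) /= !big_cons.
under eq_bigr => lr _ do rewrite big_cons.
by rewrite -big_distrr /= IH1 [in RHS]binS bin1 mulnDl addnC.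
Qed.

(** Each letter uses up one unit of a site. This makes the numbers of X and Y letters functions of
    the type of the leaf, as the weights D1 and D2 require. *)
Lemma lvs_sum ka L : lvs ka L -> forall lr, lr \in L -> (size lr.1 + sumn lr.2 = sumn ka)%N.
Proof.
elim=> {ka L} [ka z lr|ka k ka' L1 L2 P _ _ IH1 _ IH2 lr].
  rewrite inE => /eqP -> /=; elim: ka z => //= x ka IH /andP[/eqP -> /IH]; lia.
rewrite (perm_sumn P) mem_cat => /orP[] /mapP[lr' h ->] /=.
  by rewrite size_map addnCA (IH1 _ h).
by rewrite !addSn (IH2 _ h).
Qed.

Lemma lvs_rho k0 ka L : lvs ka L -> all (fun x => x <= k0)%N ka -> forall lr, lr \in L ->
  all (fun x => 0 < x <= k0)%N lr.2 /\ (size lr.2 <= size ka)%N.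
Proof.
elim=> {ka L} [ka z|ka k ka' L1 L2 P mx _ IH1 _ IH2] ha lr; first by rewrite inE => /eqP ->.
move: ha; rewrite (perm_all _ P) (perm_size P) /= => /andP[hk ha].
rewrite mem_cat => /orP[] /mapP[lr' h ->] /=.
  by have [-> ?] := IH1 ha _ h; rewrite hk.
have [|-> ?] := IH2 _ _ h; first by rewrite /= ha (ltnW hk).
by split.
Qed.

End Counting.

(** * Gaussian binomials and the q-Pascal rule *)

Section QBinomial.

(** Gaussian binomial without division; where the subtraction m' - n' is truncated, the factor
    [gb m' n'] is zero. *)
Fixpoint gb (m n : nat) : {poly rat} :=
  match m, n with
  | _, 0 => 1
  | 0, _.+1 => 0
  | m'.+1, n'.+1 => 'X^(m' - n') * gb m' n' + gb m' n
  end.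

Lemma gb0 m : gb m 0 = 1. Proof. by case: m. Qed.

Lemma gb_small m n : (m < n)%N -> gb m n = 0.
Proof. by elim: m n => [|m IH] [|n] //= h; rewrite !IH ?mulr0 ?addr0 //; lia. Qed.

Lemma qpochS s n : qpoch s n.+1 = qpoch s n * (1 - 'X^(s + n)).
Proof. by rewrite /qpoch big_ord_recr. Qed.

Lemma qpochSl s n : qpoch s n.+1 = (1 - 'X^s) * qpoch s.+1 n.
Proof.
rewrite /qpoch big_ord_recl /= addn0; congr (_ * _); apply: eq_bigr => i _.
by rewrite /bump /= add1n addnS addSn.
Qed.

Lemma gbE m n : (n <= m)%N -> gb m n * qpoch 1 n = qpoch (m - n).+1 n.
Proof.
elim: m n => [|m IH] [|n] //= nm; try by rewrite /qpoch !big_ord0 mulr1.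
have E : 'X^(m - n) * gb m n * qpoch 1 n.+1 = 'X^(m - n) * (1 - 'X^(n.+1)) * qpoch (m - n).+1 n.
  rewrite qpochS add1n -(IH n); [ring | lia].
rewrite mulrDl E subSS [RHS]qpochS.
have -> : ((m - n).+1 + n = m.+1)%N by lia.
have X1 : 'X^(m.+1) = 'X^(m - n) * 'X^(n.+1) :> {poly rat} by rewrite -exprD; congr ('X^_); lia.
have [nm'|mn] := ltnP n m.
  rewrite (IH n.+1) // qpochSl; have -> : (m - n.+1).+1 = (m - n)%N by lia.
  rewrite X1; ring.
have -> : n = m by lia.
by rewrite gb_small // mul0r addr0 subnn expr0 mul1r mulrC.
Qed.

Lemma qpoch1_neq0 n : qpoch 1 n != 0.
Proof.
rewrite /qpoch; apply/prodf_neq0 => i _; apply/eqP => /(congr1 (fun p : {poly rat} => p`_0)).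
by rewrite coefB coef1 coefXn coef0 add1n /= subr0.
Qed.

Lemma qbinE (l mu mu' : nat) : (mu' <= mu)%N ->
  qbin (l%:Z - mu'%:Z) (mu%:Z - mu'%:Z) = if (mu <= l)%N then gb (l - mu') (mu - mu') else 0.
Proof.
move=> h; rewrite /qbin; have -> : 0 <= mu%:Z - mu'%:Z by lia.
have -> : (mu%:Z - mu'%:Z <= l%:Z - mu'%:Z) = (mu <= l)%N by lia.
rewrite andTb; case: ifP => //= hl.
have -> : absz (mu%:Z - mu'%:Z) = (mu - mu')%N by lia.
have -> : absz (l%:Z - mu'%:Z - (mu%:Z - mu'%:Z) + 1) = (l - mu' - (mu - mu')).+1 by lia.
rewrite -gbE; last by lia.
by rewrite mulpK // qpoch1_neq0.
Qed.

(** F_{M,m} depends only on the partial sums lambda and mu. Taking these as arbitrary functions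
    allows the recursion to lower them directly; the guard restores the zero value that truncated
    subtraction would lose. *)
Definition FL (k : nat) (l mu : nat -> nat) : {poly rat} :=
  'X^(\sum_(1 <= a < k) mu a.+1 * (l a - mu a)) *
  \prod_(1 <= a < k.+1) (if (mu a <= l a)%N then gb (l a - mu a.+1) (mu a - mu a.+1) else 0).

Lemma lam_mono k m a : (lam k m a.+1 <= lam k m a)%N.
Proof.
rewrite /lam; have [h|h] := ltnP a k.+1; first by rewrite [X in (_ <= X)%N]big_ltn ?leq_addl.
by rewrite big_geq // (leq_trans h).
Qed.

Lemma FpolyE k M m : Fpoly k M m = FL k (lam k M) (lam k m).
Proof.
rewrite /Fpoly /FL; congr (_ * _); apply: eq_bigr => a _; exact/qbinE/lam_mono.
Qed.

(* This is the q-Pascal rule; K stands for the largest site, and the two terms for the two branches of lvs. *)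
Lemma FL_step k K (l mu : nat -> nat) : (0 < K <= k)%N -> (forall a, (K < a)%N -> l a = 0%N) ->
  (0 < l K)%N -> (forall a, (l a.+1 <= l a)%N) -> (forall a, (mu a.+1 <= mu a)%N) -> (forall a, (k < a)%N -> mu a = 0%N) ->
  FL k l mu =
    (if (mu K.+1 < mu K)%N then
       'X^(\sum_(1 <= a < k.+1) l a - \sum_(1 <= a < k.+1) mu a) *
       FL k (fun a => l a - (a <= K))%N (fun a => mu a - (a <= K))%N else 0)
    + FL k (fun a => l a - (a == K))%N mu.
Proof.
case/andP=> K0 Kk l0 lK lD muD muk.
(* If mu_{K+1} is positive, all three terms vanish because l_{K+1} = 0; otherwise mu is supported on
   indices up to K. *)
case: (posnP (mu K.+1)) => [muK|muK]; last first.
  have Z (l' mu' : nat -> nat) : l' K.+1 = 0%N -> (0 < mu' K.+1)%N -> (K < k)%N -> FL k l' mu' = 0.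
    move=> l'0 mu'p Kk'; rewrite /FL; apply/eqP; rewrite mulf_eq0; apply/orP; right.
    rewrite (@big_cat_nat _ _ _ K.+1) //=.
    by rewrite [X in _ * X]big_ltn // l'0 leqNgt mu'p /= mul0r mulr0.
  have Kk' : (K < k)%N by rewrite ltnNge; apply/negP => h; move: muK; rewrite muk //; lia.
  rewrite !Z ?l0 //=; last by rewrite ltnn subn0.
  by case: ifP; rewrite ?mulr0 addr0.
have mu0 a : (K < a)%N -> mu a = 0%N.
  move=> h; rewrite -(subnK h); elim: (a - K.+1)%N => [|x IH]; first by rewrite add0n.
  by apply/eqP; rewrite -leqn0 -IH addSn muD.
have ltk a : (1 <= a < k)%N -> (K <= a)%N -> mu a.+1 = 0%N by move=> _ h; rewrite mu0.
pose phi (l' mu' : nat -> nat) a :=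
  if (mu' a <= l' a)%N then gb (l' a - mu' a.+1) (mu' a - mu' a.+1) else 0.
have FLE (l' mu' : nat -> nat) : (forall a, (K < a)%N -> l' a = 0%N) -> (forall a, (K < a)%N -> mu' a = 0%N) ->
    FL k l' mu' = 'X^(\sum_(1 <= a < K) mu' a.+1 * (l' a - mu' a)) *
      ((\prod_(1 <= a < K) phi l' mu' a) * phi l' mu' K).
  move=> l'0 mu'0; rewrite /FL -/(phi l' mu'); congr ('X^_ * _).
    rewrite (@big_cat_nat _ _ _ K) //= [X in (_ + X)%N]big_nat_cond [X in (_ + X)%N]big1 ?addn0 //.
    by move=> a /andP[/andP[h _] _]; rewrite mu'0.
  rewrite (@big_cat_nat _ _ _ K.+1) //= big_nat_recr //= [X in _ * X = _]big_nat_cond [X in _ * X = _]big1 ?mulr1 //.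
  by move=> a /andP[/andP[h _] _]; rewrite l'0 // !mu'0 // ltnW.
rewrite !FLE //; [|by move=> a h; rewrite l0|by move=> a h; rewrite l0|by move=> a h; rewrite mu0].
(* If mu_a > l_a for some a < K, the same inequality persists in all terms and they vanish. *)
have [/hasP[a]|all_le] := boolP (has (fun a => l a < mu a)%N (index_iota 1 K)).
  rewrite mem_index_iota => /andP[a1 aK] la.
  have Z (l' mu' : nat -> nat) : (l' a < mu' a)%N -> \prod_(1 <= i < K) phi l' mu' i = 0.
    move=> h; rewrite (big_cat_nat (n := a)) //=; last exact: ltnW.
    by rewrite [X in _ * X]big_ltn // {2}/phi leqNgt h /= mul0r mulr0.
  rewrite (Z l mu la) (Z (fun a => l a - (a <= K))%N (fun a => mu a - (a <= K))%N).
    rewrite (Z (fun a => l a - (a == K))%N mu); first by case: ifP; rewrite ?mul0r ?mulr0 ?addr0.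
    by rewrite (ltn_eqF aK) subn0.
  have : (l K <= l a)%N.
    rewrite -(subnK (ltnW aK)); elim: (K - a)%N => [|x IH]; first by rewrite add0n.
    exact: leq_trans (lD _) IH.
  by rewrite (ltnW aK); lia.
have le a : (1 <= a < K)%N -> (mu a <= l a)%N.
  move=> h; rewrite leqNgt; apply: (hasPn all_le); by rewrite mem_index_iota.
have -> : \prod_(1 <= a < K) phi (fun a => l a - (a == K))%N mu a = \prod_(1 <= a < K) phi l mu a.
  by apply: eq_big_nat => a /andP[_ aK]; rewrite /phi (ltn_eqF aK) subn0.
have -> : (\sum_(1 <= a < K) mu a.+1 * (l a - (a == K) - mu a) = \sum_(1 <= a < K) mu a.+1 * (l a - mu a))%N.
  by apply: eq_big_nat => a /andP[_ aK]; rewrite (ltn_eqF aK) subn0.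
have pK l' : phi l' mu K = gb (l' K) (mu K).
  by rewrite /phi muK !subn0; case: leqP => // /gb_small ->.
rewrite !pK eqxx muK.
(* The factor at a = K follows the q-Pascal rule, the other binomials are the same in all terms, and
   what remains is a comparison of exponents. *)
have pas : gb (l K) (mu K) = (if (0 < mu K)%N then 'X^(l K - mu K) * gb (l K).-1 (mu K).-1 else 0) + gb (l K - 1) (mu K).
  rewrite -{1}(prednK lK) subn1; case: (mu K) => [|m] /=; first by rewrite !gb0 add0r.
  by congr ('X^_ * _ + _); lia.
rewrite pas mulrDr mulrDr; congr (_ + _); case: ifP => h; last by rewrite !mulr0.
have mp a : (a <= K)%N -> (0 < mu a)%N.
  move=> aK; have : (mu K <= mu a)%N.
    rewrite -(subnK aK); elim: (K - a)%N => [|x IH]; first by rewrite add0n.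
    exact: leq_trans (muD _) IH.
  by lia.
have -> : phi (fun a => l a - (a <= K))%N (fun a => mu a - (a <= K))%N K = gb (l K).-1 (mu K).-1.
  by rewrite /phi leqnn ltnn muK !subn0 !subn1; case: leqP => // hh; rewrite gb_small.
have -> : \prod_(1 <= a < K) phi (fun a => l a - (a <= K))%N (fun a => mu a - (a <= K))%N a
   = \prod_(1 <= a < K) phi l mu a.
  apply: eq_big_nat => a /[dup] ha /andP[_ aK]; rewrite /phi (ltnW aK) aK.
  have := le a ha; have := mp a (ltnW aK); have := mp a.+1 aK; have := muD a => h1 h2 h3 h4.
  have -> : (mu a - true <= l a - true)%N by rewrite leq_sub2r.
  by rewrite h4; congr gb; lia.
case: (leqP (mu K) (l K)) => hl; last first.
  by rewrite (@gb_small (l K).-1) ?mulr0 //; lia.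
rewrite [in RHS]mulrA -exprD mulrCA [in RHS]mulrCA; congr (_ * _); rewrite mulrA -exprD; congr ('X^_ * _).
have S (f g : nat -> nat) : (forall a, (1 <= a < K)%N -> f a = g a) -> (\sum_(1 <= a < K) f a = \sum_(1 <= a < K) g a)%N.
  by move=> e; apply: eq_big_nat.
have spl (f : nat -> nat) : (forall a, (K < a)%N -> f a = 0%N) ->
   (\sum_(1 <= a < k.+1) f a = \sum_(1 <= a < K) f a + f K)%N.
  move=> f0; rewrite (@big_cat_nat _ _ _ K.+1) //= big_nat_recr //= [X in (_ + X)%N]big_nat_cond.
  by rewrite [X in (_ + X)%N]big1 ?addn0 // => a /andP[/andP[ha _] _]; rewrite f0.
rewrite !spl //.
have -> : (\sum_(1 <= a < K) l a = \sum_(1 <= a < K) (l a - mu a) + \sum_(1 <= a < K) mu a)%N.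
  by rewrite -big_split /=; apply: eq_big_nat => a /le h'; rewrite subnK.
(* Lowering each mu_{a+1} by one while l_a - mu_a is unchanged costs the sum of l_a - mu_a over a <
   K; together with l_K - mu_K this is the exponent in front. *)
have -> : (\sum_(1 <= a < K) mu a.+1 * (l a - mu a) = \sum_(1 <= a < K) (l a - mu a) +
   \sum_(1 <= a < K) (mu a.+1 - (a.+1 <= K)) * (l a - (a <= K) - (mu a - (a <= K))))%N.
  rewrite -big_split /=; apply: eq_big_nat => a /[dup] ha /andP[_ aK]; rewrite (ltnW aK) aK.
  have := le a ha; have := mp a (ltnW aK); have := mp a.+1 aK => h1 h2 h3.
  have -> : (l a - true - (mu a - true) = l a - mu a)%N by lia.
  by rewrite -{1}(prednK h1) mulSn subn1.
lia.
Qed.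

End QBinomial.

Section LeafPolynomial.
Variable k : nat.
Hypothesis k1 : (1 <= k)%N.

Definition typ (rho : seq nat) (m : nat -> nat) := all (fun a => count_mem a rho == m a) (iota 1 k).

Lemma sum_delta_nat a b (c : nat) : (\sum_(a <= i < b) (i == c) = ((a <= c) && (c < b)))%N.
Proof.
rewrite -big_mkcond /= sum1_count; have := count_uniq_mem c (iota_uniq a (b - a)).
by rewrite -/(index_iota a b) mem_index_iota => <-; apply: eq_count => i; rewrite /= eq_sym.
Qed.

Lemma lam_count ka a : all (fun x => x <= k)%N ka ->
  lam k (fun a => count_mem a ka) a = count (leq a) ka.
Proof.
elim: ka => [|x ka IH] /=; first by rewrite /lam big1.
case/andP=> xk /IH <-; rewrite /lam big_split /=; congr (_ + _)%N.
under eq_bigr => i _ do rewrite eq_sym.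
by rewrite sum_delta_nat ltnS xk andbT.
Qed.

Lemma sum_lam m : (\sum_(1 <= a < k.+1) lam k m a = tnorm k m)%N.
Proof.
rewrite /tnorm /lam.
transitivity (\sum_(1 <= a < k.+1) \sum_(1 <= i < k.+1 | (a <= i)%N) m i)%N.
  rewrite big_nat_cond [RHS]big_nat_cond; apply: eq_bigr => a /andP[/andP[a1 _] _].
  by rewrite (big_nat_widenl a 1) //; apply: eq_bigl.
rewrite (exchange_big_dep_nat xpredT) //=; apply: eq_big_nat => i /andP[i1 ik].
transitivity (\sum_(1 <= a < i.+1) m i)%N; last by rewrite sum_nat_const_nat subn1.
by rewrite [RHS](big_nat_widen _ _ k.+1) //; apply: eq_bigl.
Qed.

Lemma tnorm_count ka : all (fun x => x <= k)%N ka -> tnorm k (fun a => count_mem a ka) = sumn ka.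
Proof.
elim: ka => [|x ka IH] /=; first by rewrite /tnorm big1 // => a _; rewrite muln0.
case/andP=> hx /IH <-; rewrite /tnorm.
under eq_bigr => a _ do rewrite mulnDr.
rewrite big_split /=; congr (_ + _)%N; case: (posnP x) => [->|x0].
  by rewrite big_nat_cond big1 // => -[|a]; rewrite ?muln0.
rewrite (bigD1_seq x) ?mem_index_iota ?iota_uniq ?ltnS ?x0 //= eqxx muln1 big1 ?addn0 // => a /negbTE.
by rewrite eq_sym => ->; rewrite muln0.
Qed.

Lemma tnorm_typ rho m : all (fun x => x <= k)%N rho -> typ rho m -> tnorm k m = sumn rho.
Proof.
move=> hr ht; rewrite -tnorm_count // /tnorm big_nat_cond [RHS]big_nat_cond; apply: eq_bigr => a /andP[ha _].
by have /allP/(_ a) := ht; rewrite mem_iota add1n => /(_ ha)/eqP ->.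
Qed.

Lemma FL_ext l l' mu mu' : (forall a, (0 < a)%N -> l a = l' a) -> mu =1 mu' -> FL k l mu = FL k l' mu'.
Proof.
move=> el em; rewrite /FL; congr ('X^_ * _); apply: eq_big_nat => a /andP[a1 _]; rewrite el // !em //.
Qed.

Lemma typ_cons K rho m : (0 < K <= k)%N ->
  typ (K :: rho) m = (0 < m K)%N && typ rho (fun a => m a - (a == K))%N.
Proof.
move=> hK; apply/allP/andP => [h|[mK /allP h] a ha].
  have := h K; rewrite mem_iota add1n => /(_ hK) /=; rewrite eqxx => /eqP e; split; first by rewrite -e.
  apply/allP => a ha; have := h a ha => /= /eqP <-.
  by rewrite [a == K]eq_sym addKn.
have /eqP := h a ha => /= ->; rewrite [K == a]eq_sym subnKC //.
by case: (a =P K) => [->|].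
Qed.

(** In the first branch shifting the letters multiplies by q to the number of letters, which is |M|
    - |m| by [lvs_sum], and the entry K added to the sites lowers m_K. In the second branch a letter
    0 has no q-degree and the site K becomes K - 1. These are the two terms of [FL_step]. *)
Theorem leaf_polynomial ka L : lvs ka L -> all (fun x => x <= k)%N ka -> forall m,
  \sum_(lr <- L | typ lr.2 m) 'X^(sumn lr.1) = Fpoly k (fun a => count_mem a ka) m.
Proof.
suff H : lvs ka L -> all (fun x => x <= k)%N ka -> forall m,
    \sum_(lr <- L | typ lr.2 m) 'X^(sumn lr.1) = FL k (fun a => count (leq a) ka) (lam k m).
  move=> hL hk m; rewrite H // FpolyE; apply: FL_ext => // a _; exact/esym/lam_count.
elim=> {ka L} [ka z hk m|ka K' ka' L1 L2 P mx hL1 IH1 _ IH2 hk m].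
  have l0 a : (0 < a)%N -> count (leq a) ka = 0%N.
    move=> a0; apply/eqP; rewrite -leqn0 leqNgt -has_count; apply/hasPn => x /(allP z) /eqP ->.
    by rewrite -ltnNge.
  rewrite big_mkcond big_seq1 /=; case: ifP => ht.
    have m0 a : (0 < a)%N -> lam k m a = 0%N.
      move=> a0; rewrite /lam big_nat_cond big1 // => i /andP[/andP[ai ik] _].
      have /allP/(_ i) := ht; rewrite mem_iota add1n ik (leq_trans a0) // => /(_ isT) /=.
      by move/eqP.
    rewrite /FL big_nat_cond big1 => [|a /andP[/andP[a1 _] _]]; last by rewrite m0 // mul0n.
    rewrite expr0 mul1r big_nat_cond big1 // => a /andP[/andP[a1 _] _].
    by rewrite !m0 // leq0n gb0.
  rewrite /FL [X in _ * X](_ : _ = 0) ?mulr0 // big_ltn // l0 // leqNgt lt0n.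
  case: eqP => [e|]; last by rewrite mul0r.
  case/negP: ht; apply/allP => i; rewrite mem_iota add1n => /andP[i1 ik] /=.
  have : (\sum_(1 <= i < k.+1) m i == 0)%N by rewrite -[X in X == _]/(lam k m 1) e.
  rewrite sum_nat_seq_eq0 => /allP/(_ i); rewrite mem_index_iota i1 ik => /(_ isT) /=.
  by move=> /eqP ->.
set K := K'.+1 in P mx *.
move: hk; rewrite (perm_all _ P) /= => /andP[hK hk'].
have K0k : (0 < K <= k)%N by rewrite hK.
have hk2 : all (fun x => x <= k)%N (K' :: ka') by rewrite /= hk' ltnW.
have cE a : count (leq a) ka = ((a <= K) + count (leq a) ka')%N by rewrite (permP P).
rewrite (FL_step (K := K) K0k); last first.
- by move=> a h; rewrite /lam big_geq.
- by move=> a; exact: lam_mono.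
- by move=> a; apply: sub_count => x /=; exact: ltnW.
- by rewrite cE leqnn.
- move=> a h; rewrite cE leqNgt h add0n; apply/eqP; rewrite -leqn0 leqNgt -has_count.
  by apply/hasPn => x /(allP mx) xK; rewrite -ltnNge (leq_ltn_trans xK).
rewrite big_cat /= !big_map /=; congr (_ + _); last first.
  rewrite IH2 //; apply: FL_ext => // a _ /=; rewrite cE.
  by rewrite [in RHS]leq_eqVlt /K ltnS; case: eqP => [->|_] /=; rewrite ?subn0 // ltnn; lia.
have lK : lam k m K = (m K + lam k m K.+1)%N by rewrite /lam big_ltn.
rewrite lK -{1}[lam k m K.+1]add0n ltn_add2r.
rewrite (eq_bigl (fun lr => (0 < m K)%N && typ lr.2 (fun a => m a - (a == K))%N)) => [|lr]; last exact: typ_cons.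
case: ltnP => mK; last by rewrite big_pred0.
transitivity (\sum_(lr <- L1 | typ lr.2 (fun a => m a - (a == K))%N)
   'X^(\sum_(1 <= a < k.+1) count (leq a) ka - \sum_(1 <= a < k.+1) lam k m a) * 'X^(sumn lr.1) : {poly rat}).
  rewrite big_seq_cond [RHS]big_seq_cond; apply: eq_bigr => lr /andP[lrL ht].
  rewrite -exprD; congr ('X^_); have := lvs_sum hL1 lrL.
  have [hr _] := lvs_rho hL1 hk' lrL.
  rewrite sum_lam (@tnorm_typ (K :: lr.2)); last by rewrite typ_cons // mK.
    have hka : all (fun x => x <= k)%N ka by rewrite (perm_all _ P) /= hK.
    have -> : (\sum_(1 <= a < k.+1) count (leq a) ka = sumn ka)%N.
      by rewrite -tnorm_count // -sum_lam; apply: eq_bigr => a _; rewrite lam_count.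
    rewrite (perm_sumn P) /= => <-; have -> : sumn (map S lr.1) = (sumn lr.1 + size lr.1)%N.
      by elim: (lr.1) => //= x s ->; lia.
    by rewrite subnDl addnK addnC.
  by rewrite /= hK; apply: sub_all hr => x /andP[].
rewrite -big_distrr /= IH1 //; congr (_ * _); apply: FL_ext => a; first by rewrite cE addKn.
have [aK|Ka] := leqP a K; last first.
  rewrite subn0 /lam; apply: eq_big_nat => i /andP[ai _]; case: eqP => [e|]; last by rewrite subn0.
  by move: ai; rewrite e leqNgt Ka.
have -> : lam k m a = (\sum_(a <= i < k.+1) ((m i - (i == K)) + (i == K)))%N.
  by apply: eq_bigr => i _; rewrite subnK //; case: eqP => [->|].
by rewrite big_split /= sum_delta_nat aK ltnS hK addnK.
Qed.

End LeafPolynomial.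

(** * Currents on fusion products *)

Lemma row_base_of_rank (F : fieldType) n (S : 'M[F]_n) m : \rank S = m ->
  exists2 B : 'M[F]_(m, n), row_free B & (B :=: S)%MS.
Proof. by move=> <-; exists (row_base S); [exact: row_base_free | exact: eq_row_base]. Qed.

Section Restriction.
Variables (F : fieldType) (n r : nat) (S : 'M[F]_n) (B : 'M[F]_(r.+1, n)).
Hypotheses (Bf : row_free B) (BS : (B :=: S)%MS).

(** The matrix of [A] on the invariant subspace [S] in the basis [B]; in these coordinates the
    operators form a ring and [S] is the full space. *)
Definition rop (A : 'M[F]_n) : 'M[F]_r.+1 := B *m A *m pinvmx B.
Definition rvec m (u : 'M[F]_(m, n)) : 'M[F]_(m, r.+1) := u *m pinvmx B.

Lemma rvecK m (u : 'M_(m, n)) : (u <= S)%MS -> rvec u *m B = u.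
Proof. by move=> uS; rewrite mulmxKpV // BS. Qed.

Lemma ropB A : (S *m A <= S)%MS -> rop A *m B = B *m A.
Proof. by move=> SA; apply: mulmxKpV; rewrite BS -(eqmxMr A BS) in SA *. Qed.

Lemma rop_eq A A' : (S *m A <= S)%MS -> (S *m A' <= S)%MS ->
  (forall u : 'rV_n, (u <= S)%MS -> u *m A = u *m A') -> rop A = rop A'.
Proof.
move=> SA SA' H; apply: (row_free_inj Bf); rewrite !ropB //; apply/row_matrixP => i.
by rewrite !row_mul H // (submx_trans (row_sub _ _)) // BS.
Qed.

Lemma ropM A A' : (S *m A <= S)%MS -> (S *m A' <= S)%MS -> rop A * rop A' = rop (A *m A').
Proof.
move=> SA SA'; apply: (row_free_inj Bf); rewrite -mulmxA ropB // mulmxA ropB // -mulmxA ropB //.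
by apply: submx_trans SA'; rewrite mulmxA submxMr.
Qed.

Lemma rop_wop (ops : nat -> 'M[F]_n) (u : 'rV_r.+1) l : (forall i, (S *m ops i <= S)%MS) ->
  u *m wop (fun i => rop (ops i)) l *m B = foldl (fun w i => w *m ops i) (u *m B) l.
Proof.
move=> H; elim: l u => [|i l IH] u; first by rewrite /wop big_nil mulmx1.
by rewrite /wop big_cons /= mulmxA IH -mulmxA ropB // mulmxA.
Qed.

End Restriction.

Section PowCur.
Variables (F : fieldType) (r n : nat) (ops : nat -> 'M[F]_r.+1).
Hypothesis ops0 : forall i, (n < i)%N -> ops i = 0.

Lemma coef_cur i : (cur n ops)`_i = ops i.
Proof. by rewrite coef_poly; case: ltnP => // /ops0. Qed.

Lemma powv_cur v a N : v *m (cur n ops ^+ a)`_N = powv ops v a N.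
Proof.
elim: a N => [|a IH] N /=; first by rewrite expr0 coef1; case: eqP; rewrite ?mulmx1 ?mulmx0.
rewrite exprSr coefMr mulmx_sumr; apply: eq_bigr => i _.
by rewrite coef_cur -[_ * _]/(_ *m _) mulmxA IH.
Qed.
End PowCur.

Lemma powv_rop (F : fieldType) n r (S : 'M[F]_n) (B : 'M[F]_(r.+1, n)) (ops : nat -> 'M[F]_n) u a N :
  row_free B -> (B :=: S)%MS -> (forall i, (S *m ops i <= S)%MS) -> (u <= S)%MS ->
  powv (fun i => rop B (ops i)) (rvec B u) a N *m B = powv ops u a N.
Proof.
move=> Bf BS H uS; elim: a N => [|a IH] N /=.
  by case: eqP => _; rewrite ?mul0mx ?(rvecK BS).
by rewrite mulmx_suml; apply: eq_bigr => i _; rewrite -mulmxA (ropB BS) // mulmxA IH.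
Qed.

Section FusionCurrents.
Variables (F : fieldType) (n : nat) (I : finType).
Variables (E : I -> nat -> 'M[F]_n) (v : 'rV[F]_n).
Local Notation Fl := (ufilt E v).

Lemma powv_ufilt x a N : (powv (E x) v a N <= Fl N)%MS.
Proof.
elim: a N => [|a IH] N /=; first by case: eqP => [->|_]; rewrite ?sub0mx ?v_ufilt.
apply: summx_sub => i _; apply: submx_trans (submxMr _ (IH _)) _.
by apply: submx_trans (ufilt_E _ _ _ _ _) _; rewrite subnK // -ltnS.
Qed.

Lemma powv_fus x a N :
  powv (fun i => fus_op E v i (E x i)) v a N = sym Fl N (powv (E x) v a N).
Proof.
elim: a N => [|a IH] N /=.
  case: eqP => [->|_]; first by rewrite (sym0E (ufilt_incr _ _)) ?v_ufilt.
  by rewrite /sym mul0mx.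
rewrite sym_sum; apply: eq_bigr => i _; have iN : (i <= N)%N by rewrite -ltnS.
rewrite IH fus_opE ?powv_ufilt //; last by move=> d; exact: ufilt_E.
by rewrite subnK.
Qed.

(** The recurrence expresses the coefficient of degree N by coefficients of smaller t-degree, so its
    symbol in degree N is zero. *)
Lemma fus_relation x a N (q : nat -> F) :
  powv (E x) v a N = \sum_(1 <= i < N.+1) q i *: powv (E x) v a (N - i) ->
  powv (fun i => fus_op E v i (E x i)) v a N = 0.
Proof.
move=> qE; rewrite powv_fus; apply: sym_low; rewrite qE big_nat_cond summx_sub // => i /andP[/andP[i1 iN] _].
rewrite scalemx_sub //; apply: submx_trans (powv_ufilt _ _ _) _.
by apply: Fl_prevsp; [exact: ufilt_incr | lia].
Qed.

End FusionCurrents.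

Section Sites.
Variables (Site : finType) (es : seq Site) (kk : Site -> nat).
Hypotheses (es_uniq : uniq es) (es_all : forall s, s \in es).
Definition site_seq := flatten [seq nseq (kk s) s | s <- es].

Lemma count_site_seq s : count_mem s site_seq = kk s.
Proof.
rewrite /site_seq count_flatten -map_comp sumnE big_map (bigD1_seq s) //= count_nseq /= eqxx mul1n.
by rewrite big1 ?addn0 // => t ts; rewrite count_nseq /= (negbTE ts).
Qed.

Lemma card_site L (t : L.-tuple Site) s : val t = site_seq -> #|[set j | tnth t j == s]| = kk s.
Proof.
move=> tE; rewrite -count_site_seq -tE -sum1_count -sum1_card big_tuple.
by apply: eq_bigl => j; rewrite inE.
Qed.

End Sites.

(* Evaluating at pairwise distinct points, Lagrange interpolation isolates a single site. *)
Section Interpolation.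
Variables (F : fieldType) (L dd : nat) (Site : finType) (site : 'I_L -> Site) (zeta : Site -> F).
Hypothesis zinj : injective zeta.

Lemma site_operator (rho : 'I_L -> 'M[F]_dd) (T : 'M[F]_(tdim L dd)) s :
  (forall i, (T *m tens_op (fun j => zeta (site j) ^+ i *: rho j) <= T)%MS) ->
  (T *m tens_op (fun j => if site j == s then rho j else 0) <= T)%MS.
Proof.
move=> H; pose P : {poly F} := \prod_(t | t != s) ((zeta s - zeta t)^-1 *: ('X - (zeta t)%:P)).
have Ps : P.[zeta s] = 1.
  rewrite horner_prod big1 // => t ts; rewrite !hornerE mulVf // subr_eq0.
  by apply: contra_neq ts => /zinj.
have Pt t : t != s -> P.[zeta t] = 0.
  by move=> ts; rewrite horner_prod (bigD1 t) //= !hornerE subrr mulr0 mul0r.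
have -> : tens_op (fun j => if site j == s then rho j else 0) =
   \sum_(i < size P) P`_i *: tens_op (fun j => zeta (site j) ^+ i *: rho j).
  rewrite (tens_op_lin (fun i : 'I_(size P) => P`_i)); apply: tens_op_ext => j.
  under eq_bigr => i _ do rewrite scalerA.
  rewrite -scaler_suml -horner_coef; case: eqP => [->|/eqP js]; first by rewrite Ps scale1r.
  by rewrite Pt ?scale0r.
rewrite mulmx_sumr; apply: summx_sub => i _; rewrite -scalemxAr scalemx_sub //.
Qed.
End Interpolation.

Section FusionWords.
Variables (F : fieldType) (n : nat) (I : finType).
Variables (E : I -> nat -> 'M[F]_n) (v : 'rV[F]_n).
Local Notation Fl := (ufilt E v).
Local Notation fop xi := (fus_op E v xi.2 (E xi.1 xi.2)).

Definition eword (w : seq (I * nat)) := foldl (fun u xi => u *m E xi.1 xi.2) v w.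
Definition fword (w : seq (I * nat)) := foldl (fun u xi => u *m fop xi) v w.
Definition wdeg (w : seq (I * nat)) := sumn (unzip2 w).

Lemma eword_ufilt w : (eword w <= Fl (wdeg w))%MS.
Proof.
elim/last_ind: w => [|w xi IH]; first exact: v_ufilt.
rewrite /eword foldl_rcons -/(eword w) /wdeg /unzip2 map_rcons sumn_rcons.
exact: submx_trans (submxMr _ IH) (ufilt_E _ _ _ _ _).
Qed.

Lemma fwordE w : fword w = sym Fl (wdeg w) (eword w).
Proof.
elim/last_ind: w => [|w xi IH]; first by rewrite (sym0E (ufilt_incr _ _)) ?v_ufilt.
rewrite /fword /eword !foldl_rcons -/(fword w) -/(eword w) IH fus_opE ?eword_ufilt //.
  by rewrite /wdeg /unzip2 map_rcons sumn_rcons.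
by move=> d; exact: ufilt_E.
Qed.

Lemma fword_deg w : fword w *m fus_deg E v = (wdeg w)%:R *: fword w.
Proof. by rewrite fwordE fus_degE. Qed.

Lemma fword_eigen w A (al : I -> F) c : v *m A = c *: v ->
  (forall x i, E x i *m A = A *m E x i + al x *: E x i) ->
  fword w *m fus_op E v 0 A = (c + \sum_(xi <- w) al xi.1) *: fword w.
Proof.
move=> vA EA; rewrite fwordE fus_opE ?eword_ufilt //; last exact: (ufilt_D vA EA).
rewrite addn0 -symZ; congr (sym _ _ _).
elim/last_ind: w => [|w xi IH]; first by rewrite /= vA big_nil addr0.
rewrite /eword !foldl_rcons -/(eword w) -mulmxA EA mulmxDr mulmxA IH -scalemxAl -scalemxAr -scalerDl.
by rewrite -cats1 big_cat big_seq1 /= addrA.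
Qed.

Lemma fword_space w : (fword w <= fus_space E v)%MS.
Proof. by rewrite fwordE fus_sym. Qed.

Lemma fus_comm x y i j (G : 'M[F]_n) (e : F) (u : 'rV_n) : (u <= fus_space E v)%MS ->
  E x i *m E y j = E y j *m E x i + e *: G -> 
  (forall d, (Fl d *m G <= Fl (d + (i + j)))%MS) ->
  u *m fus_op E v i (E x i) *m fus_op E v j (E y j) =
  u *m fus_op E v j (E y j) *m fus_op E v i (E x i) + e *: (u *m fus_op E v (i + j) G).
Proof.
move=> uS H HG.
have fE z k d := ufilt_E E v d k z.
pose D := fus_op E v i (E x i) *m fus_op E v j (E y j)
   - fus_op E v j (E y j) *m fus_op E v i (E x i) - e *: fus_op E v (i + j) G.
suff : (fus_space E v <= kermx D)%MS.
  move/(submx_trans uS)/sub_kermxP/eqP; rewrite /D !mulmxBr -scalemxAr !mulmxA subr_eq add0r subr_eq => /eqP ->.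
  by rewrite addrC.
apply: fus_ind => d w wd; apply/sub_kermxP; rewrite /D !mulmxBr -scalemxAr !mulmxA.
have w1 := submx_trans (submxMr (E x i) wd) (fE _ _ _).
have w2 := submx_trans (submxMr (E y j) wd) (fE _ _ _).
rewrite !fus_opE //; rewrite -!addnA [(j + i)%N]addnC -!symB -symZ -symB -!mulmxA scalemxAr -!mulmxBr H.
by rewrite -addrA -opprD subrr mulmx0 /sym mul0mx.
Qed.

End FusionWords.

(** * Fusion products of sl_2 *)

Definition act_word (F : fieldType) n (ops : nat -> 'M[F]_n) (u : 'rV[F]_n) (l : seq nat) : 'rV[F]_n :=
  foldl (fun w i => w *m ops i) u l.

Lemma eq_powv (F : fieldType) n (ops ops' : nat -> 'M[F]_n) : ops =1 ops' ->
  forall v a N, powv ops v a N = powv ops' v a N.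
Proof. by move=> E v; elim=> //= a IH N; apply: eq_bigr => i _; rewrite IH E. Qed.

Lemma foldl_map_pair (A I : Type) (f : A -> I * nat -> A) (x : I) (u : A) l :
  foldl f u [seq (x, i) | i <- l] = foldl (fun w i => f w (x, i)) u l.
Proof. by elim: l u => //= i l IH u; rewrite IH. Qed.

Lemma act_word_fus (F : fieldType) n (I : finType) (E : I -> nat -> 'M[F]_n) v x l :
  act_word (fun i => fus_op E v i (E x i)) v l = fword E v [seq (x, i) | i <- l].
Proof. by rewrite /fword foldl_map_pair. Qed.

Section SL2side.
Variables (F : fieldType) (k : nat) (mv : nat -> nat).
Hypothesis char0 : forall m, m.+1%:R != 0 :> F.
Local Notation fac := (pi_factors k mv).
Local Notation Site := 'I_(size (pi_factors k mv)).
Local Notation L := (L2 F k mv).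
Local Notation n := (n2 F k mv).
Let kk (s : Site) := nth 0%N fac s.
Let zt (s : Site) : F := (val s)%:R.

Lemma natr_inj : injective (fun m : nat => m%:R : F).
Proof.
have H a b : (a <= b)%N -> a%:R = b%:R :> F -> a = b.
  move=> ab /eqP; rewrite eq_sym -subr_eq0 -natrB // -{2}(subnK ab).
  by case: (b - a)%N => // m; rewrite (negbTE (char0 m)).
by move=> a b; case: (leqP a b) => [/H //|/ltnW/H h /esym/h].
Qed.

Let ztinj : injective zt. Proof. by move=> s t /natr_inj /val_inj. Qed.

Let slotsE : slots2 F k mv = map zt (site_seq (enum Site) kk).
Proof.
rewrite /slots2 /site_seq map_flatten -map_comp; congr flatten.
rewrite -val_enum_ord -map_comp; apply: eq_map => s /=; by rewrite map_nseq.
Qed.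

Let site_size : size (site_seq (enum Site) kk) == L.
Proof. by rewrite /L2 slotsE size_map. Qed.
Let st : L.-tuple Site := Tuple site_size.
Let site (j : 'I_L) : Site := tnth st j.

Let slotE (j : 'I_L) : nth 0 (slots2 F k mv) j = zt (site j).
Proof.
have h : (j < size (site_seq (enum Site) kk))%N by rewrite (eqP site_size).
have x0 := site j.
by rewrite slotsE (nth_map x0) // /site (tnth_nth x0).
Qed.

Let card2 s : #|[set j | site j == s]| = kk s.
Proof. by apply: (@card_site _ (enum Site)) => //; [exact: enum_uniq | move=> t; rewrite mem_enum]. Qed.

Let rho (j : 'I_L) : 'M[F]_2 := (e2 F)^T.
Let E2E x i : E2 F k mv x i = tens_op (fun j => zt (site j) ^+ i *: rho j).
Proof. by rewrite /E2 /act2; apply: tens_op_ext => j; rewrite slotE. Qed.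

Let vac : tidx L 2 := [ffun => 1].
Let tgt : tidx L 2 := [ffun => 0].
Lemma e2T a b : (e2 F)^T a b = ((a == 1) && (b == 0))%:R.
Proof. by rewrite !mxE andbC. Qed.

Lemma pi_current a N : (pmin fac a < N + a)%N ->
  powv (pi_e F k mv) (u2 F k mv) a N = 0.
Proof.
move=> h.
have [|||||q qE] := @current_recurrence F L 2 Site site zt rho vac tgt [set: 'I_L] (fun=> 1) _ _ _ kk _ a N.
- by move=> j b; rewrite !ffunE e2T eqxx in_setT; case: eqP.
- by move=> j b _; rewrite ffunE e2T.
- by move=> j _; rewrite !ffunE.
- by move=> s; rewrite -card2; apply: subset_leq_card; apply/subsetP => j; rewrite !inE.
- move: h; rewrite /pmin (big_nth 0%N) big_mkord; congr (_ < _)%N.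
apply: (fus_relation (x := tt) (q := q)).
rewrite (eq_powv (E2E tt)) qE; apply: eq_bigr => i _; by rewrite (eq_powv (E2E tt)).
Qed.

Lemma pi_rank : (\prod_(x <- fac) x.+1 <= \rank (pi_space F k mv))%N.
Proof.
pose K := {dffun forall s : Site, 'I_(kk s).+1}.
have -> : (\prod_(x <- fac) x.+1)%N = #|K|.
  rewrite card_dep_ffun foldrE big_image /= (big_nth 0%N) big_mkord.
  by apply: eq_bigr => s _; rewrite card_ord.
apply: (@rank_lower_bound F L 2 _ unit site vac (fun=> tgt) _ char0 _ _ _ _ _ K (fun f s _ => val (f s))).
- by move=> _ j; rewrite !ffunE.
- by move=> [] [].
- by move=> j b; rewrite ffunE => b1; exists tt; rewrite ffunE; case: b b1 => [[|[|b]]] hb // _; apply/val_inj.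
- exact: v_fus.
- move=> s _; exists 1; first exact: oner_neq0.
  have -> : tens_op (fun j => if site j == s then 1 *: delta_mx (vac j) (tgt j) else 0) =
     tens_op (fun j => if site j == s then rho j else 0).
    apply: tens_op_ext => j; case: eqP => // _; rewrite scale1r; apply/matrixP => a b.
    by rewrite e2T mxE !ffunE.
  apply: (site_operator ztinj) => i; rewrite -(E2E tt); exact: fus_space_E.
- by move=> f s; rewrite big_const card_unit /= addn0 card2 -ltnS ltn_ord.
- by move=> f f' H; apply/ffunP => s; apply/val_inj/(H s tt).
Qed.

Let EE x i j : E2 F k mv x i *m E2 F k mv x j = E2 F k mv x j *m E2 F k mv x i.
Proof.
apply/eqP; rewrite -subr_eq0 !E2E tens_comm; apply/eqP.
rewrite -[RHS](tens_op0 F L 2); apply: tens_op_ext => j'.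
by rewrite -!scalemxAl -!scalemxAr !scalerA mulrC subrr.
Qed.

Lemma pi_comm (u : 'rV_n) i j : (u <= pi_space F k mv)%MS ->
  u *m pi_e F k mv i *m pi_e F k mv j = u *m pi_e F k mv j *m pi_e F k mv i.
Proof.
move=> uS; have := @fus_comm _ _ _ (E2 F k mv) (u2 F k mv) tt tt i j 0 0 u uS.
rewrite scale0r !addr0 => ->; rewrite ?scale0r ?addr0 // => d.
by rewrite mulmx0 sub0mx.
Qed.

Variable nn : nat.
Hypothesis nnP : (stab (ufilt (E2 F k mv) (u2 F k mv)) <= nn)%N.
Local Notation zl := (zb fac).

Definition pi_w (l : seq nat) : 'rV[F]_n := act_word (pi_e F k mv) (u2 F k mv) l.

(** The relations hold in pi by [pi_current], so a congruence in the polynomial ring becomes an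
    identity of vectors. *)
Lemma pi_rel l (c : nat -> F) :
  Rel (n := nn) fac (monom F nn l - \sum_(j < size zl) c j *: monom F nn (nth [::] zl j)) ->
  pi_w l = \sum_(j < size zl) c j *: pi_w (nth [::] zl j).
Proof.
set S := pi_space F k mv => hR.
have uS : (u2 F k mv <= S)%MS by exact: v_fus.
(* The matrix ring needs positive size, which the nonzero cyclic vector provides. *)
have [r rE] : exists r, \rank S = r.+1.
  case: (posnP (\rank S)) => [r0|/prednK <-]; last by eexists.
  move: uS; have -> : S = 0 by apply/eqP; rewrite -mxrank_eq0 r0.
  rewrite submx0 => /eqP /(congr1 (fun u => co u [ffun => 1])).
  by rewrite co_tbasis /co mxE eqxx => /eqP; rewrite oner_eq0.
have [B Bf BS] := row_base_of_rank rE.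
have St i' : (S *m pi_e F k mv i' <= S)%MS by exact: fus_op_sub.
pose Z i' := rop B (pi_e F k mv i').
have Z0 i' : (nn < i')%N -> Z i' = 0.
  move=> h; rewrite /Z /pi_e fus_op_high ?(leq_ltn_trans nnP h) //.
  by rewrite /rop mulmx0 mul0mx.
have ZZ i' j : Z i' * Z j = Z j * Z i'.
  rewrite /Z !(ropM Bf BS) //; apply: (rop_eq Bf BS); rewrite ?mulmxA ?(submx_trans (submxMr _ (St _))) //.
  by move=> u us; rewrite !mulmxA pi_comm.
have vr : forall c N, (pmin fac c < N + c)%N -> rvec B (u2 F k mv) *m (cur nn Z ^+ c)`_N = 0.
  move=> c' N h; rewrite powv_cur //; apply: (row_free_inj Bf).
  by rewrite mul0mx (powv_rop _ _ Bf BS) // pi_current.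
have := Thz_Rel Z0 ZZ vr hR.
rewrite rmorphB rmorph_sum mulmxBr Thz_monom // => /eqP; rewrite subr_eq0 => /eqP H.
have wE l' : rvec B (u2 F k mv) *m wop Z l' *m B = pi_w l'.
  by rewrite (rop_wop BS) // (rvecK BS).
rewrite -wE H mulmx_sumr mulmx_suml; apply: eq_bigr => j _.
by rewrite Thz_scale Thz_monom // -scalemxAr -scalemxAl wE.
Qed.

Lemma pi_w_space l : (pi_w l <= pi_space F k mv)%MS.
Proof.
rewrite /pi_w /act_word; elim/last_ind: l => [|l i IH]; first exact: v_fus.
by rewrite foldl_rcons; exact: fus_op_sub.
Qed.

Lemma pi_w_cons i l : pi_w (i :: l) = pi_w l *m pi_e F k mv i.
Proof.
rewrite /pi_w /act_word /=; move: (v_fus (E2 F k mv) (u2 F k mv)) => hu.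
elim/last_ind: l => [|l j IH] //; rewrite !foldl_rcons IH pi_comm //.
exact: (pi_w_space l).
Qed.

(** The relations make these vectors span, and their number prod (x + 1) is the lower bound
    [pi_rank]. *)
Lemma pi_basis (W := \matrix_(j < size zl) pi_w (nth [::] zl j)) :
  row_free W /\ (W :=: pi_space F k mv)%MS.
Proof.
have WS : (W <= pi_space F k mv)%MS by apply/row_subP => j; rewrite rowK pi_w_space.
have Wj l : (pi_w l <= W)%MS.
  have [c hc] := zb_span (n := nn) char0 fac (monom F nn l); rewrite (pi_rel hc).
  apply: summx_sub => j _; rewrite scalemx_sub //.
  by rewrite (_ : pi_w _ = row j W) ?row_sub // rowK.
have SW : (pi_space F k mv <= W)%MS.
  rewrite -(genmxE W); apply: fus_min; first by rewrite genmxE; exact: (Wj [::]).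
  move=> [] i; rewrite (eqmxMr _ (genmxE W)) genmxE; apply/row_subP => j; rewrite row_mul rowK.
  by rewrite -[fus_op _ _ _ _]/(pi_e F k mv i) -pi_w_cons.
have e : (W :=: pi_space F k mv)%MS by apply/eqmxP; rewrite WS SW.
split=> //; rewrite /row_free eqn_leq rank_leq_row /= e; apply: leq_trans _ pi_rank.
by rewrite size_map (lvs_size (lvP _)).
Qed.

Lemma pi_w_fword l : pi_w l = fword (E2 F k mv) (u2 F k mv) [seq (tt, i) | i <- l].
Proof. exact: act_word_fus. Qed.

Lemma pi_w_D0 l : pi_w l *m pi_D0 F k mv = (sumn l)%:R *: pi_w l.
Proof. by rewrite pi_w_fword fword_deg /wdeg /unzip2 -map_comp map_id. Qed.

Lemma pi_w_Dw l : pi_w l *m pi_Dw F k mv = ((size l)%:R - (sumn fac)%:R / 2%:R) *: pi_w l.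
Proof.
have n2z : 2%:R != 0 :> F by exact: char0.
have hE a b : (2%:R^-1 *: h2 F)^T a b = if a == b then (if a == 0 then 2%:R^-1 else - 2%:R^-1) else 0.
  rewrite !mxE; case: a b => [[|[|a]] ha] [[|[|b]] hb] //=; rewrite ?andbF ?subr0 ?sub0r ?mulr1 ?mulrN1 ?mulr0 //.
rewrite pi_w_fword (@fword_eigen _ _ _ _ _ _ _ (fun=> 1) (- ((sumn fac)%:R / 2%:R))).
- by rewrite big_map big_const_seq count_predT iter_addr_0 addrC.
- have -> : u2 F k mv = tbasis F vac by rewrite /u2; congr tbasis; apply/ffunP => j; rewrite !ffunE.
  rewrite /act2 tbasis_eigen.
    congr (_ *: _); under eq_bigr => j _ do rewrite expr0 scale1r hE eqxx ffunE /=.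
    rewrite sumr_const card_ord mulNrn; congr (- _); rewrite -[LHS]mulr_natl; congr (_%:R / _).
    by rewrite /L2 /slots2 size_flatten /shape -map_comp sumnE big_map [in RHS]sumnE [in RHS](big_nth 0%N) /index_iota subn0;
      apply: eq_bigr => i _ /=; rewrite size_nseq.
  by move=> j b; rewrite ffunE => bj; rewrite expr0 scale1r hE eq_sym (negbTE bj).
move=> x i; apply/eqP; rewrite addrC -subr_eq scale1r /E2 /act2 tens_comm; apply/eqP/tens_op_ext => j.
rewrite expr0 scale1r -scalemxAl -scalemxAr -scalerBr; congr (_ *: _); apply/matrixP => a b.
rewrite !mxE !big_ord_recl !big_ord0 !e2T !hE.
case: a b => [[|[|a]] ha] [[|[|b]] hb] //=; rewrite ?mulr0 ?mul0r ?mulr1 ?mul1r ?addr0 ?add0r ?subr0 ?sub0r ?oppr0 //.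
by rewrite opprK -[X in X + _]mul1r -[X in _ + X]mul1r -mulrDl -mulr2n mulfV.
Qed.

End SL2side.

(** * Fusion products of sl_3 *)

Section SL3side.
Variables (F : fieldType) (p pbar : nat) (ks : 'I_p -> nat) (kbs : 'I_pbar -> nat)
          (zeta : 'I_(p + pbar) -> F).
Hypothesis char0 : forall m, m.+1%:R != 0 :> F.
Hypothesis zinj : injective zeta.
Local Notation Site := 'I_(p + pbar).
Local Notation L := (L3 ks kbs zeta).
Local Notation n := (n3 ks kbs zeta).
Local Notation E := (@E3 F p pbar ks kbs zeta).
Local Notation v := (v3 ks kbs zeta).
Local Notation VS := (V_space ks kbs zeta).
Local Notation Vop := (@V_op F p pbar ks kbs zeta).

Definition kal := [seq ks i | i <- enum 'I_p].
Definition kbl := [seq kbs i | i <- enum 'I_pbar].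

Let es : seq Site := map (@lshift p pbar) (enum 'I_p) ++ map (@rshift p pbar) (enum 'I_pbar).
Let kk (s : Site) := match split s with inl i => ks i | inr i => kbs i end.
Let dual (s : Site) := match split s with inl _ => false | inr _ => true end.

Let kkl i : kk (lshift pbar i) = ks i. Proof. by rewrite /kk (unsplitK (inl i)). Qed.
Let kkr i : kk (rshift p i) = kbs i. Proof. by rewrite /kk (unsplitK (inr i)). Qed.
Let dul i : dual (lshift pbar i) = false. Proof. by rewrite /dual (unsplitK (inl i)). Qed.
Let dur i : dual (rshift p i) = true. Proof. by rewrite /dual (unsplitK (inr i)). Qed.

Let slotsE : slots3 ks kbs zeta = [seq (dual s, zeta s) | s <- site_seq es kk].
Proof.
rewrite /slots3 /site_seq [in RHS]map_flatten -[in RHS]map_comp /es [in RHS]map_cat.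
rewrite [in RHS]flatten_cat -!map_comp; congr (flatten _ ++ flatten _).
  by apply: eq_map => i /=; rewrite map_nseq kkl dul.
by apply: eq_map => i /=; rewrite map_nseq kkr dur.
Qed.

Let site_size : size (site_seq es kk) == L.
Proof. by rewrite /L3 slotsE size_map. Qed.
Let st : L.-tuple Site := Tuple site_size.
Let site (j : 'I_L) : Site := tnth st j.

Let slotE (j : 'I_L) : slot3 j = (dual (site j), zeta (site j)).
Proof.
have h : (j < size (site_seq es kk))%N by rewrite (eqP site_size).
have x0 := site j.
by rewrite /slot3 slotsE (nth_map x0) // /site (tnth_nth x0).
Qed.

Let card3 s : #|[set j | site j == s]| = kk s.
Proof.
apply: (@card_site _ es) => //.
  rewrite cat_uniq (map_inj_uniq (@lshift_inj _ _)) (map_inj_uniq (@rshift_inj _ _)) !enum_uniq andbT /=.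
  apply/hasPn => _ /mapP[i _ ->]; apply/negP => /mapP[j _ /eqP]; by rewrite eq_rlshift.
move=> t; rewrite mem_cat; case: (split_ordP t) => i ->; apply/orP; [left|right]; apply: map_f; exact: mem_enum.
Qed.

Let rep (x : 'M[F]_3) (j : 'I_L) := slot_rep (dual (site j)) x.
Let act3E x i : act3 ks kbs zeta x i = tens_op (fun j => zeta (site j) ^+ i *: rep x j).
Proof. by rewrite /act3; apply: tens_op_ext => j; rewrite slotE. Qed.

Lemma slot_rep_comm d (x y : 'M[F]_3) :
  slot_rep d y *m slot_rep d x - slot_rep d x *m slot_rep d y = slot_rep d (x *m y - y *m x).
Proof.
case: d => /=; first by rewrite !mulNmx !mulmxN !opprK opprB.
by rewrite -!trmx_mul linearB.
Qed.

Lemma act3_comm x y i j :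
  act3 ks kbs zeta y j *m act3 ks kbs zeta x i =
  act3 ks kbs zeta x i *m act3 ks kbs zeta y j + act3 ks kbs zeta (x *m y - y *m x) (i + j).
Proof.
apply/eqP; rewrite addrC -subr_eq !act3E tens_comm; apply/eqP/tens_op_ext => l.
by rewrite -!scalemxAl -!scalemxAr !scalerA [_ * zeta _ ^+ j]mulrC -scalerBr slot_rep_comm addnC exprD.
Qed.

Lemma act3_0 i : act3 ks kbs zeta 0 i = 0.
Proof.
rewrite act3E -[RHS](tens_op0 F L 3); apply: tens_op_ext => j; rewrite /rep.
by case: (dual _); rewrite /= ?oppr0 ?trmx0 scaler0.
Qed.

Local Notation lX := (inord 0 : 'I_3).
Local Notation lZ := (inord 1 : 'I_3).
Local Notation lY := (inord 2 : 'I_3).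

Lemma nletterX : nletter F lX = delta_mx (inord 0) (inord 1).
Proof. by rewrite /nletter /= inordK. Qed.
Lemma nletterZ : nletter F lZ = delta_mx (inord 0) (inord 2).
Proof. by rewrite /nletter /= inordK. Qed.
Lemma nletterY : nletter F lY = delta_mx (inord 1) (inord 2).
Proof. by rewrite /nletter /= inordK. Qed.

Lemma inord3_eq a b : (a < 3)%N -> (b < 3)%N -> ((inord a : 'I_3) == inord b) = (a == b).
Proof. by move=> ha hb; rewrite -val_eqE /= !inordK. Qed.

Lemma letterP (P : 'I_3 -> Prop) : P lX -> P lZ -> P lY -> forall x, P x.
Proof.
move=> h0 h1 h2 [[|[|[|x]]] hx] //.
- by rewrite (_ : Ordinal hx = lX) //; apply/val_inj; rewrite /= inordK.
- by rewrite (_ : Ordinal hx = lZ) //; apply/val_inj; rewrite /= inordK.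
- by rewrite (_ : Ordinal hx = lY) //; apply/val_inj; rewrite /= inordK.
Qed.

Lemma E3_YX i j : E lY j *m E lX i = E lX i *m E lY j + E lZ (i + j).
Proof.
rewrite /E3 act3_comm nletterX nletterY nletterZ !mul_delta_mx_cond !inord3_eq //=.
by rewrite mulr1n mulr0n subr0.
Qed.

Lemma E3_ZC x i j : E lZ i *m E x j = E x j *m E lZ i.
Proof.
rewrite /E3 act3_comm -[RHS]addr0; congr (_ + _); rewrite -(act3_0 (j + i)); congr act3.
 move: x; apply: letterP; rewrite ?nletterX ?nletterY ?nletterZ !mul_delta_mx_cond !inord3_eq //=;
by rewrite !mulr0n subr0.
Qed.

Lemma E3_C x i j : E x i *m E x j = E x j *m E x i.
Proof. by rewrite /E3 act3_comm subrr act3_0 addr0. Qed.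

Lemma V_opS m x i (u : 'M_(m, n)) : (u *m Vop x i <= VS)%MS. Proof. exact: fus_op_sub. Qed.

Let fus_comm0 x y i j (u : 'rV_n) : (u <= VS)%MS -> E x i *m E y j = E y j *m E x i ->
  u *m Vop x i *m Vop y j = u *m Vop y j *m Vop x i.
Proof.
move=> uS H; have := @fus_comm _ _ _ E v x y i j 0 0 u uS.
rewrite scale0r !addr0 => ->; rewrite ?scale0r ?addr0 // => d.
by rewrite mulmx0 sub0mx.
Qed.

Lemma V_ZC x i j (u : 'rV_n) : (u <= VS)%MS -> u *m Vop lZ i *m Vop x j = u *m Vop x j *m Vop lZ i.
Proof. by move=> uS; apply: fus_comm0 => //; exact: E3_ZC. Qed.
Lemma V_C x i j (u : 'rV_n) : (u <= VS)%MS -> u *m Vop x i *m Vop x j = u *m Vop x j *m Vop x i.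
Proof. by move=> uS; apply: fus_comm0 => //; exact: E3_C. Qed.
Lemma V_YX i j (u : 'rV_n) : (u <= VS)%MS ->
  u *m Vop lY j *m Vop lX i = u *m Vop lX i *m Vop lY j + u *m Vop lZ (i + j).
Proof.
move=> uS; have := @fus_comm _ _ _ E v lY lX j i (E lZ (i + j)) 1 u uS.
rewrite !scale1r [(j + i)%N]addnC; apply; first exact: E3_YX.
by move=> d; exact: ufilt_E.
Qed.

Let vac : tidx L 3 := [ffun j => if dual (site j) then inord 0 else inord 2].
Let vE : v = tbasis F vac.
Proof. by rewrite /v3; congr tbasis; apply/ffunP => j; rewrite !ffunE slotE. Qed.

(** [act] selects the kind of slot on which the letter moves the cyclic vector: e_12 moves only dual
    slots and e_23 only the others. So X sees the sites of [kbl] and Y those of [kal]. *)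
Let cur_rel x (act : pred bool) (eps : F) :
  (forall d b, slot_rep d (nletter F x) (if d then inord 0 else inord 2) b =
     if act d && (b == inord 1) then eps else 0) ->
  (forall d b, act d -> slot_rep d (nletter F x) (inord 1) b = 0) ->
  forall a N,
  (\sum_s minn (if act (dual s) then kk s else 0%N) a < N + a)%N ->
  powv (Vop x) v a N = 0.
Proof.
move=> hv ht a N h.
pose tgt : tidx L 3 := [ffun => inord 1].
have [|||||q qE] := @current_recurrence F L 3 Site site zeta (rep (nletter F x)) vac tgt
   [set j | act (dual (site j))] (fun=> eps) _ _ _ (fun s => if act (dual s) then kk s else 0%N) _ a N.
- by move=> j b; rewrite !ffunE inE /rep hv.
- by move=> j b; rewrite !ffunE inE => aj; apply: ht.
- by move=> j _; rewrite !ffunE; case: (dual _); rewrite inord3_eq.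
- move=> s; case: ifP => as_.
    by rewrite -card3; apply: subset_leq_card; apply/subsetP => j; rewrite !inE => /andP[].
  rewrite leqn0 cards_eq0; apply/eqP/setP => j; rewrite !inE; apply/negbTE; apply/negP.
  by case/andP=> aj /eqP js; rewrite js as_ in aj.
- exact: h.
apply: (fus_relation (x := x) (q := q)).
have EE i : E x i = tens_op (fun j => zeta (site j) ^+ i *: rep (nletter F x) j) by exact: act3E.
by rewrite (eq_powv EE) vE qE; apply: eq_bigr => i _; rewrite (eq_powv EE).
Qed.

Lemma V_X_rel a N : (pmin kbl a < N + a)%N -> powv (Vop lX) v a N = 0.
Proof.
move=> h; apply: (@cur_rel lX id (-1)) => //.
- by case=> b; rewrite nletterX /= !mxE ?inord3_eq //= ?andbF //; case: eqP; rewrite ?oppr0.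
- by case=> b; rewrite nletterX //= !mxE inord3_eq //= oppr0.
- move: h; congr (_ < _)%N; rewrite big_split_ord /= big1 ?add0n => [|i _]; last by rewrite dul min0n.
  by rewrite /pmin /kbl big_map big_enum; apply: eq_bigr => i _; rewrite dur kkr.
Qed.

Lemma V_Y_rel a N : (pmin kal a < N + a)%N -> powv (Vop lY) v a N = 0.
Proof.
move=> h; apply: (@cur_rel lY negb 1) => //.
- by case=> b; rewrite nletterY /= !mxE ?inord3_eq //= ?andbF ?oppr0 // andbT; case: eqP.
- by case=> b; rewrite nletterY //= !mxE inord3_eq //= andbF.
- move: h; congr (_ < _)%N; rewrite big_split_ord /= [X in (_ + X)%N]big1 ?addn0 => [|i _]; last by rewrite dur min0n.
  by rewrite /pmin /kal big_map big_enum; apply: eq_bigr => i _; rewrite dul kkl.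
Qed.

Lemma sum_bin2 k : (\sum_(b < k.+1) (k - b).+1 = 'C(k.+2, 2))%N.
Proof.
elim: k => [|k IH]; first by rewrite big_ord1.
by rewrite big_ord_recl subn0 /= binS bin1 -IH addnC; congr (_ + _)%N.
Qed.

(** One vector for each choice, at every site s, of a pair of counts with sum at most k_s; there are
    C(k_s + 2, 2) such pairs. *)
Lemma V_rank : (\prod_(x <- kal) 'C(x.+2, 2) * \prod_(x <- kbl) 'C(x.+2, 2) <= \rank VS)%N.
Proof.
pose K := {dffun forall s : Site, {b : 'I_(kk s).+1 & 'I_(kk s - b).+1}}.
have -> : (\prod_(x <- kal) 'C(x.+2, 2) * \prod_(x <- kbl) 'C(x.+2, 2) = #|K|)%N.
  rewrite card_dep_ffun foldrE [in RHS]big_image /= big_split_ord /= /kal /kbl !big_image.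
  congr (_ * _)%N; apply: eq_bigr => i _; rewrite ?kkl ?kkr card_tagged sumnE big_map big_enum -sum_bin2;
  by apply: eq_bigr => b _; rewrite card_ord ?kkl ?kkr.
pose tgt (x : bool) : tidx L 3 :=
  [ffun j => if x then (if dual (site j) then inord 2 else inord 0) else inord 1].
apply: (@rank_lower_bound F L 3 _ bool site vac tgt _ char0 _ _ _ _ _ K
   (fun f s x => if x then val (tag (f s)) else val (tagged (f s)))).
- by move=> [] j; rewrite !ffunE; case: (dual _); rewrite inord3_eq.
- by move=> [] [] j; rewrite !ffunE //; case: (dual _) => /eqP; rewrite inord3_eq.
- move=> j b; rewrite !ffunE; case e: (dual _).
    move: b; apply: letterP => //; rewrite ?inord3_eq // => _; [exists false|exists true]; rewrite ffunE ?e //.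
  move: b; apply: letterP => //; rewrite ?inord3_eq // => _; [exists true|exists false]; rewrite ffunE ?e //.
- rewrite -vE; exact: v_fus.
- move=> s x; exists (if dual s then -1 else 1); first by case: ifP; rewrite ?oppr_eq0 oner_neq0.
  (* The letter that takes the cyclic state to the wanted one: e_13 reaches the far state, and the
     middle one is reached by e_12 in a dual slot and by e_23 otherwise. *)
  pose y : 'I_3 := if x then lZ else if dual s then lX else lY.
  have -> : tens_op (fun j => if site j == s then (if dual s then -1 else 1) *: delta_mx (vac j) (tgt x j) else 0) =
     tens_op (fun j => if site j == s then rep (nletter F y) j else 0).
    apply: tens_op_ext => j; case: eqP => // js; rewrite /rep js /vac /tgt !ffunE js /y.
    by move: x (dual s) {y} => [] [] /=; rewrite ?nletterX ?nletterY ?nletterZ ?trmx_delta ?scaleN1r ?scale1r.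
  apply: (site_operator zinj) => i; rewrite -act3E; exact: fus_space_E.
- move=> f s; rewrite big_bool card3 /=.
  by case: (f s) => b c /=; rewrite -leq_subRL -ltnS.
- move=> f f' H; apply/ffunP => s.
  have := H s true; have := H s false => /=; case: (f s) (f' s) => b c [b' c'] /= h h'.
  have e : b = b' by exact: val_inj.
  by case: _ / e c' h => c' h; congr existT; exact: val_inj.
Qed.

Lemma act3Z (c : F) x i : act3 ks kbs zeta (c *: x) i = c *: act3 ks kbs zeta x i.
Proof.
rewrite /act3 tens_opZ; apply: tens_op_ext => j; rewrite scalerA mulrC -scalerA; congr (_ *: _).
by rewrite /slot_rep; case: ifP; rewrite ?scalerN // linearZ.
Qed.

Lemma act3_diag (d : 'rV[F]_3) x i (c : F) : diag_mx d *m nletter F x - nletter F x *m diag_mx d = c *: nletter F x ->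
  E x i *m act3 ks kbs zeta (diag_mx d) 0 = act3 ks kbs zeta (diag_mx d) 0 *m E x i + c *: E x i.
Proof. by move=> h; rewrite /E3 act3_comm h act3Z add0n. Qed.

Lemma v_diag (d : 'rV[F]_3) : v *m act3 ks kbs zeta (diag_mx d) 0 =
  ((sumn kal)%:R * d 0 (inord 2) - (sumn kbl)%:R * d 0 (inord 0)) *: v.
Proof.
have rE j b : rep (diag_mx d) j (vac j) b =
    if b == vac j then (if dual (site j) then - d 0 (inord 0) else d 0 (inord 2)) else 0.
  rewrite /rep /vac ffunE /slot_rep; case: (dual _); rewrite !mxE 1?[inord 0 == b]eq_sym; case: eqP => [e|_];
  by rewrite ?e ?mulr0n ?mulr1n ?oppr0.
rewrite vE act3E tbasis_eigen; last by move=> j b bj; rewrite expr0 scale1r rE (negbTE bj).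
congr (_ *: _); under eq_bigr => j _ do rewrite expr0 scale1r rE eqxx.
rewrite (partition_big site predT) //=.
under eq_bigr => s _.
  rewrite (eq_bigr (fun=> if dual s then - d 0 (inord 0) else d 0 (inord 2))) => [|j /eqP -> //].
  rewrite sumr_const (_ : #|_| = kk s); last by rewrite -card3 cardsE.
  over.
rewrite big_split_ord /= /kal /kbl !sumnE !big_image !natr_sum !big_distrl /= -sumrN.
by congr (_ + _); apply: eq_bigr => i _; rewrite ?dul ?dur ?kkl ?kkr ?mulNrn -[_ *+ _]mulr_natl.
Qed.

Definition dg3 (a b c : F) : 'rV[F]_3 := \row_j (if val j == 0%N then a else if val j == 1%N then b else c).

(** The division in the definition of the gradings takes place in the ring of 3 x 3 matrices. *)
Lemma div3E (A : 'M[F]_3) : A / 3%:R = 3%:R^-1 *: A.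
Proof.
have -> : (3%:R : 'M[F]_3) = (3%:R : F)%:M by rewrite rmorph_nat.
by rewrite -[_^-1]/(invmx _) invmx_scalar -[_ * _]/(_ *m _) mul_mx_scalar.
Qed.

Let n3z : 3%:R != 0 :> F. Proof. exact: char0. Qed.

Let D1E : D1amb ks kbs zeta = act3 ks kbs zeta (diag_mx (dg3 (2%:R / 3%:R) (- 3%:R^-1) (- 3%:R^-1))) 0.
Proof.
rewrite /D1amb div3E; congr act3; apply/matrixP => a b; rewrite /hab /eab !mxE.
by move: a b; do 2 apply: letterP; rewrite !inord3_eq //= ?inordK //= ?mulr1n ?mulr0n; field; apply: n3z.
Qed.

Let D2E : D2amb ks kbs zeta = act3 ks kbs zeta (diag_mx (dg3 3%:R^-1 3%:R^-1 (- (2%:R / 3%:R)))) 0.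
Proof.
rewrite /D2amb div3E; congr act3; apply/matrixP => a b; rewrite /hab /eab !mxE.
by move: a b; do 2 apply: letterP; rewrite !inord3_eq //= ?inordK //= ?mulr1n ?mulr0n; field; apply: n3z.
Qed.

Lemma diag_delta (d : 'rV[F]_3) i j :
  diag_mx d *m delta_mx i j - delta_mx i j *m diag_mx d = (d 0 i - d 0 j) *: delta_mx i j.
Proof.
apply/matrixP => a b; rewrite mul_diag_mx mul_mx_diag !mxE.
by case: eqP => [->|_]; case: eqP => [->|_]; rewrite /= ?mulr1 ?mulr0 ?mul1r ?mul0r ?subrr.
Qed.

Definition vw (l l' z : seq nat) : 'rV[F]_n :=
  fword E v ([seq (lY, i) | i <- l] ++ [seq (lX, i) | i <- l'] ++ [seq (lZ, i) | i <- z]).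

Lemma vw_D0 l l' z : vw l l' z *m V_D0 ks kbs zeta = (sumn l + sumn l' + sumn z)%:R *: vw l l' z.
Proof.
rewrite /vw fword_deg /wdeg /unzip2 !map_cat -!map_comp !sumn_cat addnA.
by rewrite /comp /= !map_id.
Qed.

Let vw_al l l' z (al : 'I_3 -> F) :
  \sum_(xi <- [seq (lY, i) | i <- l] ++ [seq (lX, i) | i <- l'] ++ [seq (lZ, i) | i <- z]) al (xi : 'I_3 * nat).1
  = al lY *+ size l + al lX *+ size l' + al lZ *+ size z.
Proof. by rewrite !big_cat !big_map /= !big_const_seq !count_predT !iter_addr_0 addrA. Qed.

Lemma fword_D1 w : exists c, fword E v w *m V_D1 ks kbs zeta = c *: fword E v w /\
  c = (sumn kal)%:R * - 3%:R^-1 - (sumn kbl)%:R * (2%:R / 3%:R)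
      + \sum_(xi <- w) (if (xi : 'I_3 * nat).1 == lY then 0 else 1).
Proof.
eexists; split; last reflexivity; rewrite /V_D1 D1E.
rewrite (@fword_eigen _ _ _ _ _ _ _ (fun x : 'I_3 => if x == lY then 0 else 1) _ (v_diag _)).
  by rewrite !mxE /= !inordK.
move=> x i; apply: act3_diag; move: x; apply: letterP; rewrite ?inord3_eq //= ?nletterX ?nletterY ?nletterZ diag_delta;
congr (_ *: _); rewrite !mxE /= ?inordK //=; field; apply: n3z.
Qed.

Lemma fword_D2 w : exists c, fword E v w *m V_D2 ks kbs zeta = c *: fword E v w /\
  c = (sumn kal)%:R * - (2%:R / 3%:R) - (sumn kbl)%:R * 3%:R^-1
      + \sum_(xi <- w) (if (xi : 'I_3 * nat).1 == lX then 0 else 1).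
Proof.
eexists; split; last reflexivity; rewrite /V_D2 D2E.
rewrite (@fword_eigen _ _ _ _ _ _ _ (fun x : 'I_3 => if x == lX then 0 else 1) _ (v_diag _)).
  by rewrite !mxE /= !inordK.
move=> x i; apply: act3_diag; move: x; apply: letterP; rewrite ?inord3_eq //= ?nletterX ?nletterY ?nletterZ diag_delta;
congr (_ *: _); rewrite !mxE /= ?inordK //=; field; apply: n3z.
Qed.

Lemma vw_D1 l l' z : vw l l' z *m V_D1 ks kbs zeta =
  ((size l')%:R + (size z)%:R - (sumn kal + 2 * sumn kbl)%:R / 3%:R) *: vw l l' z.
Proof.
rewrite /vw; set w := _ ++ _; have [c [-> ->]] := fword_D1 w; congr (_ *: _); rewrite /w.
rewrite (vw_al l l' z (fun x : 'I_3 => if x == lY then 0 else 1)) !inord3_eq //=.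
by rewrite natrD natrM; field; apply: n3z.
Qed.

Lemma vw_D2 l l' z : vw l l' z *m V_D2 ks kbs zeta =
  ((size l)%:R + (size z)%:R - (2 * sumn kal + sumn kbl)%:R / 3%:R) *: vw l l' z.
Proof.
rewrite /vw; set w := _ ++ _; have [c [-> ->]] := fword_D2 w; congr (_ *: _); rewrite /w.
rewrite (vw_al l l' z (fun x : 'I_3 => if x == lX then 0 else 1)) !inord3_eq //=.
by rewrite natrD natrM; field; apply: n3z.
Qed.

End SL3side.

(** * The filtration G *)

Definition preim_mx (F : fieldType) m n (A : 'M[F]_(m, n)) (T : 'M[F]_n) : 'M[F]_m :=
  kermx (A *m cokermx T).

Lemma sub_preim_mx (F : fieldType) q m n (A : 'M[F]_(m, n)) T (u : 'M_(q, m)) :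
  (u <= preim_mx A T)%MS = (u *m A <= T)%MS.
Proof. by rewrite /preim_mx sub_kermx mulmxA submxE. Qed.

(** Matrix coefficients are the functionals to which [mixed_relation] is applied. *)
Definition mx_form (F : fieldType) r (u : 'rV[F]_r.+1) (c : 'cV[F]_r.+1) (M : 'M[F]_r.+1) : F := (u *m M *m c) 0 0.
Lemma mx_form_additive (F : fieldType) r u c : additive (@mx_form F r u c).
Proof. by move=> M N; rewrite /mx_form mulmxBr mulmxBl !mxE. Qed.
HB.instance Definition _ (F : fieldType) r u c :=
  GRing.isAdditive.Build _ _ (@mx_form F r u c) (@mx_form_additive F r u c).

Lemma Rel_perm (F : fieldType) m rho rho' (q : {mpoly F[m.+1]}) :
  perm_eq rho rho' -> Rel rho q -> Rel rho' q.
Proof. by move=> P; apply: idl_perm. Qed.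

(** The list of pairs is in lexicographic order, so the pairs needed by [vec_rel] do come before
    position j. *)
Lemma allpairs_split (T S : eqType) (x0 : T) (y0 : S) (A : seq T) (B : seq S) j :
  (j < size [seq (x, y) | x <- A, y <- B])%N ->
  exists jA jB, [/\ (jA < size A)%N, (jB < size B)%N,
    nth (x0, y0) [seq (x, y) | x <- A, y <- B] j = (nth x0 A jA, nth y0 B jB),
    forall x y, x \in take jA A -> y \in B -> (x, y) \in take j [seq (x, y) | x <- A, y <- B] &
    forall y, y \in take jB B -> (nth x0 A jA, y) \in take j [seq (x, y) | x <- A, y <- B]].
Proof.
elim: A j => //= a A IH j; rewrite size_cat size_map nth_cat take_cat size_map.
case: (ltnP j (size B)) => jB hj.
  exists 0%N, j; split=> //; first by rewrite (nth_map y0).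
  by move=> y yB; rewrite -map_take map_f.
have [|jA [jB' [hA hB E H1 H2]]] := IH (j - size B)%N; first by rewrite ltn_subLR.
exists jA.+1, jB'; split=> // [x y|y yB]; last by rewrite mem_cat H2 ?orbT.
rewrite /= inE mem_cat => /orP[/eqP -> yB|xA yB]; first by rewrite map_f.
by rewrite H1 ?orbT.
Qed.

Section GFiltration.
Variables (F : fieldType) (p pbar : nat) (ks : 'I_p -> nat) (kbs : 'I_pbar -> nat)
          (zeta : 'I_(p + pbar) -> F).
Hypothesis char0 : forall m, m.+1%:R != 0 :> F.
Hypothesis zinj : injective zeta.
Local Notation n := (n3 ks kbs zeta).
Local Notation E := (@E3 F p pbar ks kbs zeta).
Local Notation v := (v3 ks kbs zeta).
Local Notation VS := (V_space ks kbs zeta).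
Local Notation Vop := (@V_op F p pbar ks kbs zeta).
Local Notation lX := (inord 0 : 'I_3).
Local Notation lZ := (inord 1 : 'I_3).
Local Notation lY := (inord 2 : 'I_3).
Local Notation G := (@Gfilt F p pbar ks kbs zeta).
Local Notation zsp := (@zspan F p pbar ks kbs zeta).
Local Notation JG := (stab G).

Lemma zspan_v r : (v <= zsp r)%MS.
Proof.
case: r => [|r] /=; first by rewrite genmxE.
by apply: submx_trans (addsmxSl _ _); rewrite genmxE.
Qed.

Lemma zspan_Z r i : (i <= r)%N -> (zsp r *m Vop lZ i <= zsp r.+1)%MS.
Proof.
by move=> ir; apply: submx_trans (addsmxSr _ _); apply: (sumsmx_sup (Ordinal (ir : i < r.+1)%N)).
Qed.

Lemma zspan_incr r : (zsp r <= zsp r.+1)%MS.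
Proof.
elim: r => [|r IH]; first by rewrite [X in (X <= _)%MS]/= genmxE zspan_v.
rewrite [X in (X <= _)%MS]/= addsmx_sub genmxE zspan_v /=; apply/sumsmx_subP => i _.
by apply: submx_trans (submxMr _ IH) _; apply: zspan_Z; rewrite ltnW.
Qed.

Let Gstep j r := (G j + \sum_(i < r) \sum_(b : bool) (G j *m V_L ks kbs zeta b i))%MS.
Let Gstep_incr j r : (Gstep j r <= Gstep j r.+1)%MS.
Proof. by rewrite /Gstep big_ord_recr addsmxS //= addsmxSl. Qed.

Lemma G_incr j : (G j <= G j.+1)%MS.
Proof. by apply: submx_trans (eventual_sup (Gstep_incr j) 0); rewrite addsmxSl. Qed.

Lemma G_L j b i : (G j *m V_L ks kbs zeta b i <= G j.+1)%MS.
Proof.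
apply: submx_trans (eventual_sup (Gstep_incr j) i.+1); apply: submx_trans (addsmxSr _ _).
by apply: (sumsmx_sup ord_max) => //; apply: (sumsmx_sup b).
Qed.

Lemma G_v j : (v <= G j)%MS.
Proof.
elim: j => [|j IH]; last exact: submx_trans IH (G_incr j).
exact: submx_trans (zspan_v 0) (eventual_sup zspan_incr 0).
Qed.

Definition lsh (x : 'I_3) : nat := x != lZ.
Definition ldeg (w : seq ('I_3 * nat)) : nat := sumn [seq lsh xi.1 | xi <- w].

Lemma ldeg_rcons w xi : ldeg (rcons w xi) = (ldeg w + lsh xi.1)%N.
Proof. by rewrite /ldeg map_rcons sumn_rcons. Qed.

Lemma fword_rcons w xi : fword E v (rcons w xi) = fword E v w *m Vop xi.1 xi.2.
Proof. by rewrite /fword foldl_rcons. Qed.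

(** An induction principle that reduces claims about [G] to words: the condition on [T] is pulled
    back along the last letter by [preim_mx]. *)
Lemma G_words j (T : 'M_n) : (forall w, (ldeg w <= j)%N -> (fword E v w <= T)%MS) -> (G j <= T)%MS.
Proof.
elim: j T => [|j IH] T H.
  rewrite /= /eventual; move: (stab _) => r; elim: r T H => [|r IH] T H /=.
    by rewrite genmxE; exact: (H [::]).
  rewrite addsmx_sub genmxE (H [::]) //=; apply/sumsmx_subP => i _; rewrite -sub_preim_mx.
  apply: IH => w hw; rewrite sub_preim_mx -[V_Z _ _ _ _]/(Vop (lZ, val i).1 (lZ, val i).2) -fword_rcons.
  by apply: H; rewrite ldeg_rcons /lsh /= eqxx addn0.
rewrite /= /eventual; move: (stab _) => r; rewrite addsmx_sub IH => [|w hw]; last by rewrite H // ltnW.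
apply/sumsmx_subP => i _; apply/sumsmx_subP => b _; rewrite -sub_preim_mx; apply: IH => w hw.
rewrite sub_preim_mx -[V_L _ _ _ _ _]/(Vop (if b then lX else lY, val i).1 (if b then lX else lY, val i).2) -fword_rcons.
apply: H; rewrite ldeg_rcons; apply: (@leq_trans (ldeg w + 1)); rewrite ?leq_add2l ?leq_b1 //.
by rewrite addn1.
Qed.

Lemma G_Z0 i : (G 0 *m Vop lZ i <= G 0)%MS.
Proof.
rewrite {1}/Gfilt /eventual; apply: submx_trans (submxMr _ (chain_le zspan_incr (leq_maxl _ i))) _.
apply: submx_trans (zspan_Z (leq_maxr _ _)) _; exact: eventual_sup zspan_incr _.
Qed.

Lemma letter_L x : x != lZ -> exists b, forall i, Vop x i = V_L ks kbs zeta b i.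
Proof. by move: x; apply: letterP; rewrite ?eqxx // => _; [exists true|exists false]. Qed.

Lemma G_VS j : (G j <= VS)%MS.
Proof. by apply: G_words => w _; exact: fword_space. Qed.

(** Z commutes with the letters of L, so it can be moved down to [G 0]. *)
Lemma G_Z j i : (G j *m Vop lZ i <= G j)%MS.
Proof.
elim: j => [|j IH]; first exact: G_Z0.
rewrite [X in (X *m _ <= _)%MS]/= /eventual; move: (stab _) => r; rewrite addsmxMr addsmx_sub.
rewrite (submx_trans IH (G_incr _)) /= sumsmxMr; apply/sumsmx_subP => i' _.
rewrite sumsmxMr; apply/sumsmx_subP => b _; apply: submx_trans (G_L j b i').
apply/row_subP => q; rewrite !row_mul -V_ZC; last exact: submx_trans (row_sub _ _) (G_VS j).
by rewrite -row_mul submxMr // (submx_trans _ IH) // row_sub.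
Qed.

Lemma G_op x j i : (G j *m Vop x i <= G (j + lsh x))%MS.
Proof.
rewrite /lsh; case: eqP => [->|/eqP /letter_L[b ->]]; first by rewrite addn0 G_Z.
by rewrite addn1 G_L.
Qed.

Lemma fword_G w : (fword E v w <= G (ldeg w))%MS.
Proof.
elim/last_ind: w => [|w xi IH]; first exact: G_v.
by rewrite fword_rcons ldeg_rcons; apply: submx_trans (submxMr _ IH) (G_op _ _ _).
Qed.

Lemma G_eigen (D : 'M_n) : (forall w, exists c, fword E v w *m D = c *: fword E v w) ->
  forall j, (G j *m D <= G (j + 0))%MS.
Proof.
move=> H j; rewrite -sub_preim_mx; apply: G_words => w wj; rewrite sub_preim_mx addn0.
have [c ->] := H w; rewrite scalemx_sub //; apply: submx_trans (fword_G w) _; exact: chain_le G_incr _ _ wj.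
Qed.

Lemma G_top_incr j : (JG <= j)%N -> (G j.+1 <= G j)%MS.
Proof.
move=> Jj; have /andP[h _] := stabP G_incr (leqW Jj).
have /andP[_ h'] := stabP G_incr Jj; exact: submx_trans h h'.
Qed.

Lemma G_all : (G JG :=: VS)%MS.
Proof.
apply/eqmxP; rewrite G_VS /=; apply: fus_min; first exact: G_v.
move=> x i; apply: submx_trans (G_op x JG i) _; exact: (chain_top G_incr G_top_incr).
Qed.

Definition gop x i := gr_op (G_top ks kbs zeta) G (lsh x) (Vop x i).
Definition gword (w : seq ('I_3 * nat)) := foldl (fun u xi => u *m gop xi.1 xi.2) v w.

Lemma gopZ i : gop lZ i = grG_Z ks kbs zeta i.
Proof. by rewrite /gop /lsh eqxx. Qed.

Lemma gop_sub m x i (u : 'M_(m, n)) : (u *m gop x i <= VS)%MS.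
Proof. by rewrite -G_all; apply: (gr_op_sub G_incr G_top_incr). Qed.

Lemma gword_rcons w xi : gword (rcons w xi) = gword w *m gop xi.1 xi.2.
Proof. by rewrite /gword foldl_rcons. Qed.

Lemma gop_sym m x i j (u : 'M_(m, n)) : (u <= G j)%MS ->
  sym G j u *m gop x i = sym G (j + lsh x) (u *m Vop x i).
Proof. by apply: (gr_opE G_incr G_top_incr) => k; exact: G_op. Qed.

Lemma gwordE w : gword w = sym G (ldeg w) (fword E v w).
Proof.
elim/last_ind: w => [|w xi IH]; first by rewrite (sym0E G_incr) ?G_v.
by rewrite gword_rcons IH gop_sym ?fword_G // fword_rcons ldeg_rcons.
Qed.

Lemma gword_VS w : (gword w <= VS)%MS.
Proof.
by elim/last_ind: w => [|w xi IH]; rewrite ?gword_rcons ?gop_sub //; exact: v_fus.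
Qed.

Lemma gop_high x i : (stab (ufilt E v) < i)%N -> gop x i = 0.
Proof. by move=> h; rewrite /gop /V_op fus_op_high // gr_op0. Qed.

(** The only nonzero commutator, that of X and Y, is a Z, which does not raise the level in [G],
    while the product of two letters of L raises it by two. *)
Lemma gop_comm x y i j (u : 'rV_n) : (u <= VS)%MS ->
  u *m gop x i *m gop y j = u *m gop y j *m gop x i.
Proof.
rewrite -G_all => uJ; apply: (gr_comm G_incr G_top_incr) => //; try by move=> k; exact: G_op.
move=> k w wk; have wV := submx_trans wk (G_VS k).
suff : w *m Vop x i *m Vop y j = w *m Vop y j *m Vop x i \/
    (lsh x = 1%N /\ lsh y = 1%N) /\ exists e : F, w *m Vop x i *m Vop y j - w *m Vop y j *m Vop x i = e *: (w *m Vop lZ (i + j)).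
  case=> [->|[[-> ->] [e ->]]]; first by rewrite subrr sub0mx.
  rewrite scalemx_sub //; apply: submx_trans (submxMr _ wk) _; apply: submx_trans (G_Z k _) _.
  by apply: (Fl_prevsp G_incr); lia.
have [->|nxy] := eqVneq x y; first by left; exact: V_C.
have [->|nx] := eqVneq x lZ; first by left; exact: V_ZC.
have [->|ny] := eqVneq y lZ; first by left; rewrite V_ZC.
right; rewrite /lsh nx ny; split=> //.
move: x y nxy nx ny; do 2 apply: letterP; rewrite ?eqxx // => _ _ _.
  by exists (-1); rewrite V_YX // opprD addrA subrr add0r scaleN1r.
by exists 1; rewrite V_YX // addrC addKr scale1r addnC.
Qed.

Lemma gr_cyclic (T : 'M_n) : (v <= T)%MS -> (forall x i, (T *m gop x i <= T)%MS) -> (VS <= T)%MS.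
Proof.
move=> vT HT; rewrite -G_all; apply: (gr_ind G_incr) => j u uj.
rewrite -[sym _ _ _]/(u *m grQ G j) -sub_preim_mx; apply: submx_trans uj _.
apply: G_words => w; rewrite sub_preim_mx -[_ *m _]/(sym G j (fword E v w)) leq_eqVlt => /orP[/eqP <-|h].
  rewrite -gwordE; elim/last_ind: w => [|w xi IH] //.
  by rewrite gword_rcons; apply: submx_trans (submxMr _ IH) (HT _ _).
rewrite sym_low ?sub0mx //; apply: submx_trans (fword_G w) _; exact: Fl_prevsp G_incr _ _ h.
Qed.

Section Coordinates.
Variables (r : nat) (B : 'M[F]_(r.+1, n)) (nn : nat).
Variables (Xv Xg : 'I_3 -> nat -> 'M[F]_r.+1) (vr : 'rV[F]_r.+1).
Hypotheses (Bf : row_free B) (BS : (B :=: VS)%MS) (nnP : (stab (ufilt E v) <= nn)%N).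
Hypotheses (vrB : vr *m B = v) (XvB : forall x i, Xv x i *m B = B *m Vop x i)
  (XgB : forall x i, Xg x i *m B = B *m gop x i).
Let BVS m (w : 'M_(m, r.+1)) : (w *m B <= VS)%MS. Proof. by rewrite -BS submxMl. Qed.

Let XvM m (w : 'M_(m, r.+1)) x i : w *m Xv x i *m B = w *m B *m Vop x i.
Proof. by rewrite -mulmxA XvB mulmxA. Qed.
Let XgM m (w : 'M_(m, r.+1)) x i : w *m Xg x i *m B = w *m B *m gop x i.
Proof. by rewrite -mulmxA XgB mulmxA. Qed.

Let Xv0 x i : (nn < i)%N -> Xv x i = 0.
Proof.
move=> h; apply: (row_free_inj Bf); rewrite XvB mul0mx.
by rewrite /V_op fus_op_high ?(leq_ltn_trans nnP h) // mulmx0.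
Qed.
Let Xg0 x i : (nn < i)%N -> Xg x i = 0.
Proof.
by move=> h; apply: (row_free_inj Bf); rewrite XgB mul0mx gop_high ?mulmx0 // (leq_ltn_trans nnP h).
Qed.

Let mx_eqP (A A' : 'M[F]_r.+1) : (forall w : 'rV_r.+1, w *m A *m B = w *m A' *m B) -> A = A'.
Proof. by move=> H; apply: (row_free_inj Bf); apply/row_matrixP => q; rewrite !rowE !mulmxA. Qed.

Let XgC x y i j : Xg x i * Xg y j = Xg y j * Xg x i.
Proof. by apply: mx_eqP => w; rewrite -!mulmxE !mulmxA !XgM gop_comm ?BVS. Qed.
Let XvZC x i j : Xv lZ i * Xv x j = Xv x j * Xv lZ i.
Proof. by apply: mx_eqP => w; rewrite -!mulmxE !mulmxA !XvM V_ZC ?BVS. Qed.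
Let XvYX i j : Xv lY j * Xv lX i = Xv lX i * Xv lY j + Xv lZ (i + j).
Proof.
apply: mx_eqP => w; rewrite mulmxDr -!mulmxE !mulmxA mulmxDl !XvM V_YX //.
Qed.

Let cv x := cur nn (Xv x).
Let cg x := cur nn (Xg x).

Let G_pow (w : 'rV_r.+1) d x a N : (w *m B <= G d)%MS -> (w *m (cv x ^+ a)`_N *m B <= G (d + lsh x * a))%MS.
Proof.
move=> wd; elim: a N => [|a IH] N.
  by rewrite expr0 coef1 muln0 addn0; case: eqP; rewrite ?mulmx1 // mulmx0 mul0mx sub0mx.
rewrite exprSr coefMr mulmx_sumr mulmx_suml; apply: summx_sub => i _.
rewrite (coef_cur (Xv0 x)) -mulmxE mulmxA XvM mulnS addnCA addnC.
exact: submx_trans (submxMr _ (IH _)) (G_op _ _ _).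
Qed.

(** Coefficientwise, the vector obtained from [P] on V has the one obtained from [Pg] on gr^G V as
    its symbol of degree [d]. *)
Let cmp d (P Pg : {poly 'M[F]_r.+1}) := forall N,
  (vr *m P`_N *m B <= G d)%MS /\ sym G d (vr *m P`_N *m B) = vr *m Pg`_N *m B.

Let cmp1 : cmp 0 1 1.
Proof.
move=> N; rewrite !coef1; case: eqP => _.
  by rewrite mulmx1 vrB (sym0E G_incr) ?G_v.
have -> : vr *m false%:R *m B = 0 by rewrite mulmx0 mul0mx.
by rewrite sub0mx /sym mul0mx.
Qed.

Let cmpM d P Pg x a : cmp d P Pg -> cmp (d + lsh x * a) (P * cv x ^+ a) (Pg * cg x ^+ a).
Proof.
move=> H; elim: a => [|a IH]; first by rewrite muln0 addn0 !mulr1.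
move=> N; rewrite !exprSr !mulrA !coefMr !mulmx_sumr !mulmx_suml mulnS addnCA addnC; split.
  apply: summx_sub => i _; rewrite (coef_cur (Xv0 x)) -mulmxE mulmxA XvM.
  have [h _] := IH (N - i)%N; exact: submx_trans (submxMr _ h) (G_op _ _ _).
rewrite sym_sum; apply: eq_bigr => i _; rewrite (coef_cur (Xv0 x)) (coef_cur (Xg0 x)) -!mulmxE !mulmxA XvM XgM.
by have [h <-] := IH (N - i)%N; rewrite gop_sym.
Qed.

(** Membership in the previous step is tested by the functionals that vanish on it, the columns of a
    cokernel. Each kills all words with fewer than a + b letters X and Y, as [mixed_relation]
    demands. *)
Let Gmixed a b c N : (pmin (kal ks) (b + c) + pmin (kbl kbs) (a + c) < N + a + b + c)%N ->
  (vr *m (cv lY ^+ b * cv lX ^+ a * cv lZ ^+ c)`_N *m B <= prevsp G (a + b))%MS.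
Proof.
move=> h; rewrite submxE -mulmxA; set C := B *m _; apply/eqP/rowP => q; rewrite [RHS]mxE.
have colE (M : 'M[F]_r.+1) : (vr *m M *m C) 0 q = mx_form vr (col q C) M.
  by rewrite /mx_form colE mulmxA -colE [RHS]mxE.
have low M : (vr *m M *m B <= prevsp G (a + b))%MS -> mx_form vr (col q C) M = 0.
  by rewrite submxE -colE -[X in X == 0]mulmxA -/C => /eqP ->; rewrite mxE.
have rel0 x a' N' u : powv (Vop x) v a' N' = 0 -> mx_form vr (col q C) ((cv x ^+ a')`_N' * u) = 0.
  move=> h0; apply: low; rewrite -mulmxE mulmxA (_ : vr *m _ = 0) ?mul0mx ?sub0mx //.
  rewrite (powv_cur (Xv0 x)); apply: (row_free_inj Bf); rewrite mul0mx -h0.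
  elim: a' N' {h0} => [|a' IH] N' /=; first by case: eqP => _; rewrite ?mul0mx.
  by rewrite mulmx_suml; apply: eq_bigr => i _; rewrite XvM IH.
rewrite colE; apply: (@mixed_relation F _ (mx_form vr (col q C)) nn.+1 (Xv lX) (Xv lY) (Xv lZ)
  _ _ _ _ _ _ _ (pmin (kbl kbs)) (pmin (kal ks))) => //; try solve [exact: Xv0 | exact: XvZC | exact: XvYX | by move=> i; exact: pmin_mono].
- by move=> a' N' u h'; apply: rel0; exact: V_X_rel.
- by move=> a' N' u h'; apply: rel0; exact: V_Y_rel.
- move=> a' b' c' h' i j k; apply: low; rewrite -!mulmxE !mulmxA.
  have := G_pow lZ c' k (G_pow lX a' j (G_pow lY b' i (eq_ind_r (fun u => u <= G 0)%MS (G_v 0) vrB))).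
  move/submx_trans; apply; apply: Fl_prevsp; first exact: G_incr.
  by rewrite /lsh !inord3_eq //; lia.
- by rewrite addnC.
Qed.

Let Grel a b c N : (pmin (kal ks) (b + c) + pmin (kbl kbs) (a + c) < N + a + b + c)%N ->
  vr *m (cg lY ^+ b * cg lX ^+ a * cg lZ ^+ c)`_N = 0.
Proof.
move=> h; apply: (row_free_inj Bf); rewrite mul0mx.
have [_] := cmpM lZ c (cmpM lX a (cmpM lY b cmp1)) N; rewrite !mul1r => <-; apply: sym_low.
by rewrite /lsh !inord3_eq //= mul0n !mul1n addn0 add0n addnC Gmixed.
Qed.

Let Gcyc (T : 'M[F]_r.+1) : (vr <= T)%MS -> (forall x i, (T *m Xg x i <= T)%MS) -> (1%:M <= T)%MS.
Proof.
move=> vT HT; have : (VS <= T *m B)%MS.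
  rewrite -(genmxE (T *m B)); apply: gr_cyclic; first by rewrite genmxE -vrB submxMr.
  by move=> x i; rewrite (eqmxMr _ (genmxE _)) genmxE -XgM submxMr.
by rewrite -BS -{1}[B]mul1mx => /submxP[D]; rewrite mulmxA => /(row_free_inj Bf) ->; exact: submxMl.
Qed.

Local Notation nul := ([::] : seq nat, [::] : seq nat).
Local Notation leaves := [seq (dy, dx) | dy <- lv (kal ks), dx <- lv (kbl kbs)].
Let ve d q := @vec F r nn (Xg lX) (Xg lY) (Xg lZ) vr (XgC lZ lZ) d q.
Let leaf := ((seq nat * seq nat) * (seq nat * seq nat))%type.

Definition gw (l l' z : seq nat) : 'rV[F]_n :=
  gword ([seq (lY, i) | i <- l] ++ [seq (lX, i) | i <- l'] ++ [seq (lZ, i) | i <- z]).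

Let ve_monom d z : ve d (monom F nn z) *m B = gw d.1.1 d.2.1 z.
Proof.
have W x (u : 'rV_r.+1) l : u *m wop (Xg x) l *m B = foldl (fun w xi => w *m gop xi.1 xi.2) (u *m B) [seq (x, i) | i <- l].
  elim: l u => [|i l IH] u; first by rewrite /wop big_nil mulmx1.
  by rewrite /wop big_cons -mulmxE mulmxA IH XgM.
rewrite /ve /vec (Thz_monom (Xg0 lZ)) -!mulmxE !mulmxA !W vrB /gw /gword !foldl_cat //.
Qed.

Let ve_lin d q q' (c : F) : ve d (q - c *: q') = ve d q - c *: ve d q'.
Proof. by rewrite /ve /vec rmorphB Thz_scale !mulrBr mulmxBr -!scalerAr -scalemxAr. Qed.

Let ve_sum d q m (c : nat -> F) (zl : seq (seq nat)) :
  ve d (q - \sum_(i < m) c i *: monom F nn (nth [::] zl i)) *m B =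
  ve d q *m B - \sum_(i < m) c i *: gw d.1.1 d.2.1 (nth [::] zl i).
Proof.
elim: m => [|m IH]; first by rewrite !big_ord0 !subr0.
by rewrite !big_ord_recr !opprD !addrA -IH ve_lin mulmxBl -scalemxAl ve_monom.
Qed.

Let ve_rel (T : 'M_n) j q : (j < size leaves)%N ->
  (forall d q', d \in take j leaves -> (ve d q' *m B <= T)%MS) ->
  Rel (rho_of (nth (nul, nul) leaves j)) q -> (ve (nth (nul, nul) leaves j) q *m B <= T)%MS.
Proof.
move=> jl H; have [jA [jB [hA hB -> H1 H2]]] := allpairs_split nul nul jl => hq.
rewrite -sub_preim_mx; apply: (vec_rel char0 (Xg0 lX) (Xg0 lY) (Xg0 lZ) (XgC lX lX) (XgC lY lY)
  (XgC lX lY) (XgC lZ lX) (XgC lZ lY) Grel hA hB) => // [dy dx q' hy hx|dx q' hx];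
  rewrite sub_preim_mx; [exact: H (H1 _ _ hy hx) | exact: H (H2 _ hx)].
Qed.

(** [pi_factors] lists the factors by increasing size, whereas [rho_of] keeps the order in which the
    leaves produce them; [fc] stands for any rearrangement. *)
Variable fc : leaf -> seq nat.
Hypothesis fcP : forall d, d \in leaves -> perm_eq (fc d) (rho_of d).

Let ve_all (T : 'M_n) j : (j <= size leaves)%N ->
  (forall d z, d \in take j leaves -> z \in zb (fc d) -> (gw d.1.1 d.2.1 z <= T)%MS) ->
  forall d q, d \in take j leaves -> (ve d q *m B <= T)%MS.
Proof.
elim: j => [|j IH] jl H d q; first by rewrite take0.
rewrite (take_nth (nul, nul)) // in H *;
have low d' q' : d' \in take j leaves -> (ve d' q' *m B <= T)%MS.
  by apply: IH => // [|d0 z h]; [exact: ltnW | apply: H; rewrite mem_rcons inE h orbT].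
rewrite mem_rcons inE => /orP[/eqP ->|]; last exact: low.
set d0 := nth _ _ _; have [c hc] := zb_span (n := nn) char0 (fc d0) q.
have d0L : d0 \in leaves by rewrite mem_nth.
have := ve_rel jl low (Rel_perm (fcP d0L) hc); rewrite ve_sum => h.
rewrite -(subrK (\sum_(i < size (zb (fc d0))) c i *: gw d0.1.1 d0.2.1 (nth [::] (zb (fc d0)) i)) (ve d0 q *m B)).
rewrite addmx_sub //; apply: summx_sub => i _; rewrite scalemx_sub // H //; last exact: mem_nth.
by rewrite mem_rcons inE eqxx.
Qed.

Lemma leaf_rel_coord (T : 'M_n) j l (c : nat -> F) (d := nth (nul, nul) leaves j) : (j < size leaves)%N ->
  (forall d' z, d' \in take j leaves -> z \in zb (fc d') -> (gw d'.1.1 d'.2.1 z <= T)%MS) ->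
  Rel (n := nn) (fc d) (monom F nn l - \sum_(i < size (zb (fc d))) c i *: monom F nn (nth [::] (zb (fc d)) i)) ->
  (gw d.1.1 d.2.1 l - \sum_(i < size (zb (fc d))) c i *: gw d.1.1 d.2.1 (nth [::] (zb (fc d)) i) <= T)%MS.
Proof.
move=> jl H hR; rewrite -ve_monom -ve_sum; apply: ve_rel => //; first by apply: ve_all => //; exact: ltnW.
by apply: Rel_perm hR; apply: fcP; exact: mem_nth.
Qed.

Lemma leaf_span_coord (T : 'M_n) :
  (forall d z, d \in leaves -> z \in zb (fc d) -> (gw d.1.1 d.2.1 z <= T)%MS) -> (VS <= T)%MS.
Proof.
move=> H; rewrite -BS -[B]mul1mx -sub_preim_mx.
apply: (vec_span char0 (Xg0 lX) (Xg0 lY) (Xg0 lZ) (XgC lX lX) (XgC lY lY)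
  (XgC lX lY) (XgC lZ lX) (XgC lZ lY) _ Grel) => [T' vT hX hY hZ|dy dx q hy hx].
  by apply: Gcyc => // x i; move: x; apply: letterP.
rewrite sub_preim_mx; apply: (@ve_all T (size leaves)) => //; rewrite take_size //.
by apply/allpairsP; exists (dy, dx).
Qed.

End Coordinates.

Local Notation nul := ([::] : seq nat, [::] : seq nat).
Local Notation leaves := [seq (dy, dx) | dy <- lv (kal ks), dx <- lv (kbl kbs)].

Section Leaves.
Variables (nn : nat) (fc : (seq nat * seq nat) * (seq nat * seq nat) -> seq nat).
Hypotheses (nnP : (stab (ufilt E v) <= nn)%N)
  (fcP : forall d, d \in leaves -> perm_eq (fc d) (rho_of d)).

Let coordinates : exists r, exists2 B : 'M[F]_(r.+1, n), row_free B & (B :=: VS)%MS.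
Proof.
have [r rE] : exists r, \rank VS = r.+1.
  have := V_rank ks kbs char0 zinj.
  case: (\rank VS) => [|r _]; last by exists r.
  rewrite leqNgt muln_gt0 !prodn_gt0 // => i; exact: bin_gt0.
by exists r; apply: row_base_of_rank.
Qed.

Lemma leaf_rel (T : 'M_n) j l (c : nat -> F) (d := nth (nul, nul) leaves j) : (j < size leaves)%N ->
  (forall d' z, d' \in take j leaves -> z \in zb (fc d') -> (gw d'.1.1 d'.2.1 z <= T)%MS) ->
  Rel (n := nn) (fc d) (monom F nn l - \sum_(i < size (zb (fc d))) c i *: monom F nn (nth [::] (zb (fc d)) i)) ->
  (gw d.1.1 d.2.1 l - \sum_(i < size (zb (fc d))) c i *: gw d.1.1 d.2.1 (nth [::] (zb (fc d)) i) <= T)%MS.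
Proof.
have [r [B Bf BS]] := coordinates.
apply: (leaf_rel_coord (Xv := fun x i => rop B (Vop x i)) (Xg := fun x i => rop B (gop x i)) (vr := rvec B v)
  Bf BS nnP _ _ _ fcP).
- by rewrite (rvecK BS) // v_fus.
- by move=> x i; rewrite (ropB BS) // V_opS.
- by move=> x i; rewrite (ropB BS) // gop_sub.
Qed.

Lemma leaf_span (T : 'M_n) :
  (forall d z, d \in leaves -> z \in zb (fc d) -> (gw d.1.1 d.2.1 z <= T)%MS) -> (VS <= T)%MS.
Proof.
have [r [B Bf BS]] := coordinates.
apply: (leaf_span_coord (Xv := fun x i => rop B (Vop x i)) (Xg := fun x i => rop B (gop x i)) (vr := rvec B v)
  Bf BS nnP _ _ _ fcP).
- by rewrite (rvecK BS) // v_fus.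
- by move=> x i; rewrite (ropB BS) // V_opS.
- by move=> x i; rewrite (ropB BS) // gop_sub.
Qed.

End Leaves.

Lemma gw_VS l l' z : (gw l l' z <= VS)%MS. Proof. exact: gword_VS. Qed.

Lemma gw_cons l l' i z : gw l l' (i :: z) = gw l l' z *m grG_Z ks kbs zeta i.
Proof.
rewrite -gopZ /gw; set w := map _ l; set w' := map _ l'.
elim/last_ind: z => [|z j IH]; first by rewrite cats0 catA cats1 gword_rcons.
rewrite -rcons_cons !map_rcons -!rcons_cat !gword_rcons IH /=.
by rewrite gop_comm ?gword_VS.
Qed.

Lemma ldeg_gw l l' z : ldeg ([seq (lY, i) | i <- l] ++ [seq (lX, i) | i <- l'] ++ [seq (lZ, i) | i <- z]) =
  (size l + size l')%N.
Proof.
rewrite /ldeg !map_cat !sumn_cat -!map_comp /= /comp /lsh /= !inord3_eq //=.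
have H c (s : seq nat) : sumn [seq c | _ <- s] = (c * size s)%N by elim: s => [|_ s /= ->]; rewrite ?muln0 ?mulnS.
by rewrite !H mul0n addn0 !mul1n.
Qed.

Lemma gwE l l' z : gw l l' z = sym G (size l + size l') (vw ks kbs zeta l l' z).
Proof. by rewrite /gw gwordE ldeg_gw. Qed.

Lemma vw_G l l' z : (vw ks kbs zeta l l' z <= G (size l + size l'))%MS.
Proof. by rewrite /vw -(ldeg_gw l l' z) fword_G. Qed.

Lemma vw_VS l l' z : (vw ks kbs zeta l l' z <= VS)%MS.
Proof. exact: submx_trans (vw_G _ _ _) (G_VS _). Qed.

Let gw_eigen D l l' z c : (forall w, exists c, fword E v w *m D = c *: fword E v w) ->
  vw ks kbs zeta l l' z *m D = c *: vw ks kbs zeta l l' z ->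
  gw l l' z *m gr_op (G_top ks kbs zeta) G 0 D = c *: gw l l' z.
Proof.
move=> HD h; rewrite gwE (gr_opE G_incr G_top_incr) ?vw_G //; last exact: G_eigen.
by rewrite addn0 h symZ.
Qed.

Lemma gw_D0 l l' z : gw l l' z *m grG_D0 ks kbs zeta = (sumn l + sumn l' + sumn z)%:R *: gw l l' z.
Proof. by apply: gw_eigen (vw_D0 _ _ _ _ _ _) => w; exists (wdeg w)%:R; exact: fword_deg. Qed.

Lemma gw_D1 l l' z : gw l l' z *m grG_D1 ks kbs zeta =
  ((size l')%:R + (size z)%:R - (sumn (kal ks) + 2 * sumn (kbl kbs))%:R / 3%:R) *: gw l l' z.
Proof. by apply: gw_eigen (vw_D1 _ _ _ _ _ _ _) => // w; by have [c [hc _]] := fword_D1 ks kbs zeta char0 w; exists c. Qed.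

Lemma gw_D2 l l' z : gw l l' z *m grG_D2 ks kbs zeta =
  ((size l)%:R + (size z)%:R - (2 * sumn (kal ks) + sumn (kbl kbs))%:R / 3%:R) *: gw l l' z.
Proof. by apply: gw_eigen (vw_D2 _ _ _ _ _ _ _) => // w; by have [c [hc _]] := fword_D2 ks kbs zeta char0 w; exists c. Qed.

End GFiltration.

(** * Bases of eigenvectors and block filtrations *)

Section Families.
Variables (F : fieldType) (n : nat) (I : finType) (e : I -> 'rV[F]_n).

Definition fam_mx : 'M[F]_(#|I|, n) := \matrix_r e (enum_val r).

Lemma row_fam i : row (enum_rank i) fam_mx = e i.
Proof. by rewrite rowK enum_rankK. Qed.

Lemma fam_sub i : (e i <= fam_mx)%MS.
Proof. by rewrite -row_fam row_sub. Qed.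

Lemma fam_mx_sub m (S : 'M_(m, n)) : (forall i, e i <= S)%MS -> (fam_mx <= S)%MS.
Proof. by move=> H; apply/row_subP => r; rewrite rowK. Qed.

Lemma fam_basis (S : 'M_n) : (forall i, e i <= S)%MS -> (S <= \sum_i <<e i>>)%MS -> (#|I| <= \rank S)%N ->
  row_free fam_mx /\ (fam_mx :=: S)%MS.
Proof.
move=> eS sp cnt; have E : (fam_mx :=: S)%MS.
  apply/eqmxP; rewrite fam_mx_sub //=; apply: submx_trans sp _; apply/sumsmx_subP => i _.
  by rewrite genmxE fam_sub.
by split=> //; rewrite /row_free eqn_leq rank_leq_row /= E.
Qed.

Lemma fam_sum (c : I -> F) : \sum_i c i *: e i = (\row_r c (enum_val r)) *m fam_mx.
Proof.
rewrite mulmx_sum_row (reindex_onto enum_rank enum_val) => [|r _]; last exact: enum_valK.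
by apply: eq_big => [i|i _]; rewrite ?enum_rankK ?eqxx // mxE enum_rankK row_fam.
Qed.

Lemma fam_free (c : I -> F) : row_free fam_mx -> \sum_i c i *: e i = 0 -> forall i, c i = 0.
Proof.
rewrite fam_sum => fr /eqP; rewrite -(mul0mx _ fam_mx) => /eqP /(row_free_inj fr) /rowP h i.
by have := h (enum_rank i); rewrite !mxE enum_rankK.
Qed.

Lemma fam_coef m (P : pred I) (u : 'M_(m, n)) : (u <= \sum_(i | P i) <<e i>>)%MS ->
  forall q, exists c : I -> F, (forall i, ~~ P i -> c i = 0) /\ row q u = \sum_i c i *: e i.
Proof.
move=> h q; have /sub_sumsmxP[w wE] := submx_trans (row_sub q u) h.
have D i : exists a : F, w i *m <<e i>>%MS = a *: e i.
  apply/sub_rVP; by rewrite mulmx_sub // genmxE.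
have [a aE] := fin_all_exists D.
exists (fun i => if P i then a i else 0); split=> [i /negbTE -> //|].
by rewrite wE big_mkcond; apply: eq_bigr => i _; case: ifP; rewrite ?scale0r // aE.
Qed.

Hypothesis fr : row_free fam_mx.

Lemma rank_fam (P : pred I) : \rank (\sum_(i | P i) <<e i>>)%MS = #|[set i | P i]|.
Proof.
suff dir : mxdirect (\sum_(i | P i) <<e i>>).
  rewrite (mxdirectP dir) /= -sum1dep_card; apply: eq_bigr => i Pi; rewrite genmxE.
  rewrite rank_rV; case: eqP => // ei; have := @fam_free (fun j => (j == i)%:R) fr _ i.
  rewrite eqxx => h; have /eqP : (1 : F) = 0; last by rewrite oner_eq0.
  apply: h; rewrite (bigD1 i) //= eqxx scale1r ei add0r big1 // => j /negbTE ->; by rewrite scale0r.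
apply/mxdirect_sumsP => i Pi; apply/eqP; rewrite -submx0; apply/rV_subP => u; rewrite sub_capmx genmxE.
case/andP=> /sub_rVP[a ->] h; have [c [c0 /=]] := fam_coef h 0; rewrite row_id => cE.
have /(fam_free fr)/(_ i) : \sum_j ((if j == i then a else 0) - c j) *: e j = 0.
  under eq_bigr => j _ do rewrite scalerBl.
  rewrite sumrB -cE (bigD1 i) //= eqxx big1 ?addr0 ?subrr // => j /negbTE ->; by rewrite scale0r.
by rewrite eqxx c0 ?eqxx ?andbF // subr0 => ->; rewrite scale0r sub0mx.
Qed.

Lemma eigen_cap (P : pred I) (D : 'M_n) (lam : I -> F) (l : F) :
  (forall i, e i *m D = lam i *: e i) ->
  ((\sum_(i | P i) <<e i>> :&: kermx (D - l%:M)) :=: \sum_(i | P i && (lam i == l)) <<e i>>)%MS.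
Proof.
move=> H; have He i : e i *m (D - l%:M) = (lam i - l) *: e i.
  by rewrite mulmxBr H mul_mx_scalar scalerBl.
apply/eqmxP/andP; split; last first.
  apply/sumsmx_subP => i /andP[Pi /eqP il]; rewrite sub_capmx genmxE (sumsmx_sup i) //= ?genmxE //.
  by apply/sub_kermxP; rewrite He il subrr scale0r.
apply/row_subP => q; set u := row q _.
have : (u <= \sum_(i | P i) <<e i>> :&: kermx (D - l%:M))%MS by exact: row_sub.
rewrite sub_capmx => /andP[uP /sub_kermxP uk]; have [c [c0]] := fam_coef uP 0; rewrite row_id => uE.
have : \sum_i (c i * (lam i - l)) *: e i = 0.
  rewrite -[RHS]uk uE mulmx_suml; apply: eq_bigr => i _; by rewrite -scalemxAl He scalerA.
move/(fam_free fr) => h; rewrite uE; apply: summx_sub => i _.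
case Pi: (P i); last by rewrite c0 ?Pi // scale0r sub0mx.
case: (eqVneq (lam i) l) => il; first by rewrite scalemx_sub // (sumsmx_sup i) ?Pi ?il ?eqxx ?genmxE.
have /eqP := h i; rewrite mulf_eq0 subr_eq0 (negbTE il) orbF => /eqP ->; by rewrite scale0r sub0mx.
Qed.

(** On a basis of common eigenvectors, each kernel in [joint_dim] just selects the basis vectors
    with the prescribed eigenvalue. *)
Lemma joint_dim_count (S : 'M_n) (Ds : seq ('M_n * F)) (lam : I -> seq F) : (fam_mx :=: S)%MS ->
  (forall i, size (lam i) = size Ds) ->
  (forall i q, (q < size Ds)%N -> e i *m (nth (0, 0) Ds q).1 = nth 0 (lam i) q *: e i) ->
  joint_dim S Ds = #|[set i | lam i == unzip2 Ds]|.
Proof.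
move=> eS; rewrite /joint_dim.
suff H (Ds' : seq ('M[F]_n * F)) (la : I -> seq F) : (forall i, size (la i) = size Ds') ->
   (forall i q, (q < size Ds')%N -> e i *m (nth (0, 0) Ds' q).1 = nth 0 (la i) q *: e i) ->
   (foldr (fun Dl W => W :&: kermx (Dl.1 - Dl.2%:M))%MS S Ds' :=: \sum_(i | la i == unzip2 Ds') <<e i>>)%MS.
  by move=> h1 h2; rewrite (H Ds lam h1 h2) rank_fam.
elim: Ds' la => [|D Ds' IH] la hs hD /=.
  apply: eqmx_trans (eqmx_sym eS) _; apply/eqmxP/andP; split.
    by apply: fam_mx_sub => i; rewrite (sumsmx_sup i) ?genmxE // -size_eq0 hs.
  by apply/sumsmx_subP => i _; rewrite genmxE fam_sub.
have h1 i : size (behead (la i)) = size Ds' by rewrite size_behead hs.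
have h2 i q : (q < size Ds')%N -> e i *m (nth (0, 0) Ds' q).1 = nth 0 (behead (la i)) q *: e i.
  by move=> h; rewrite nth_behead -(hD i q.+1).
apply: eqmx_trans (cap_eqmx (IH _ h1 h2) (eqmx_refl _)) _.
apply: eqmx_trans (eigen_cap _ _ (lam := fun i => nth 0 (la i) 0) _) _ => [i|]; first exact: (hD i 0%N).
rewrite [X in (X :=: _)%MS](eq_bigl (fun i => la i == unzip2 (D :: Ds'))) // => i /=.
by have := hs i; case: (la i) => //= x t _; rewrite eqseq_cons andbC.
Qed.

End Families.

(** * From matching structure constants to an isomorphism of graded modules *)

Section Assembly.
Variables (F : fieldType) (n m N : nat) (s : 'I_N -> nat) (K : Type).
Variables (S : 'M[F]_n) (e : 'I_N -> nat -> 'rV[F]_n) (A : K -> 'M[F]_n).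
Variables (T : 'M[F]_m) (f : 'I_N -> nat -> 'rV[F]_m) (B : K -> 'M[F]_m).

Definition leaf_filt (j : nat) : 'M[F]_n := (\sum_(i < N | (i < j)%N) \sum_(q < s i) <<e i q>>)%MS.
Local Notation H := leaf_filt.

Hypotheses (eS : forall i (q : 'I_(s i)), (e i q <= S)%MS) (eSp : (S <= H N)%MS)
  (eN : (\sum_i s i <= \rank S)%N).
Hypotheses (fT : forall i (q : 'I_(s i)), (f i q <= T)%MS)
  (fN : (\sum_i s i = \rank T)%N) (fSp : (T <= \sum_i \sum_(q < s i) <<f i q>>)%MS).
Hypothesis str : forall x i (q : 'I_(s i)), exists c : nat -> F,
  (e i q *m A x - \sum_(q' < s i) c q' *: e i q' <= H i)%MS /\
  f i q *m B x = \sum_(q' < s i) c q' *: f i q'.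

Lemma leaf_filt_incr j : (H j <= H j.+1)%MS.
Proof.
apply/sumsmx_subP => i ij; rewrite (sumsmx_sup i) //; exact: ltnW.
Qed.

Lemma e_leaf_filt i (q : 'I_(s i)) j : (i < j)%N -> (e i q <= H j)%MS.
Proof. by move=> ij; rewrite (sumsmx_sup i) // (sumsmx_sup q) // genmxE. Qed.

Lemma leaf_filt_min j (U : 'M_n) : (forall i (q : 'I_(s i)), (i < j)%N -> (e i q <= U)%MS) -> (H j <= U)%MS.
Proof.
move=> h; apply/sumsmx_subP => i ij; apply/sumsmx_subP => q _; rewrite genmxE; exact: h.
Qed.

Lemma leaf_filt_sub j : (H j <= S)%MS.
Proof. by apply: leaf_filt_min => i q _. Qed.

Lemma leaf_filt_top j : (N <= j)%N -> (H j.+1 <= H j)%MS.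
Proof. by move=> Nj; apply: leaf_filt_min => i q _; apply: e_leaf_filt; exact: leq_trans Nj. Qed.

Lemma leaf_filt_eq : (H N == S)%MS.
Proof. by rewrite leaf_filt_sub eSp. Qed.

Lemma leaf_filt_stable j x : (H j *m A x <= H j)%MS.
Proof.
rewrite -sub_preim_mx; apply: leaf_filt_min => i q ij; rewrite sub_preim_mx.
have [c [h _]] := str x q; rewrite -(subrK (\sum_(q' < s i) c q' *: e i q') (e i q *m A x)) addmx_sub //.
  by apply: submx_trans h _; apply: chain_le; [exact: leaf_filt_incr | exact: ltnW].
by apply: summx_sub => q' _; rewrite scalemx_sub // e_leaf_filt.
Qed.

Let I : finType := {i : 'I_N & 'I_(s i)}.
(** Vectors of leaf i first occur in step i + 1 of the filtration, whence the level of the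
    symbol. *)
Let be (y : I) : 'rV[F]_n := sym H (tag y).+1 (e (tag y) (tagged y)).
Let bf (y : I) : 'rV[F]_m := f (tag y) (tagged y).

Let cardI : #|{: I}| = (\sum_i s i)%N.
Proof.
by rewrite card_tagged sumnE big_map big_enum; apply: eq_bigr => i _; rewrite card_ord.
Qed.

Let be_basis : row_free (fam_mx be) /\ (fam_mx be :=: S)%MS.
Proof.
apply: fam_basis; rewrite ?cardI //.
  move=> y; apply: submx_trans (sym_sub _ _ _) _; exact: submx_trans (grC_sub _ _) (leaf_filt_sub _).
apply: submx_trans eSp _; apply: (gr_ind leaf_filt_incr) => j u uj.
rewrite -[sym _ _ _]/(u *m grQ H j) -sub_preim_mx; apply: submx_trans uj _.
apply: leaf_filt_min => i q ij; rewrite sub_preim_mx -[_ *m _]/(sym H j (e i q)).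
have [ji|ji] := leqP j i.+1; last by rewrite sym_low ?sub0mx //; case: j ji {ij} => // j ji; exact: e_leaf_filt.
have -> : j = i.+1 by apply/eqP; rewrite eqn_leq ji.
by rewrite (sumsmx_sup (Tagged (fun i => 'I_(s i)) q)) // genmxE.
Qed.

Let bf_basis : row_free (fam_mx bf) /\ (fam_mx bf :=: T)%MS.
Proof.
apply: fam_basis; rewrite ?cardI ?fN //; first by move=> y; exact: fT.
apply: submx_trans fSp _; apply/sumsmx_subP => i _; apply/sumsmx_subP => q _.
by rewrite (sumsmx_sup (Tagged (fun i => 'I_(s i)) q)).
Qed.

(** By [str] an operator acts on leaf i, modulo the earlier leaves, by the same coefficients as on
    block i of the target; so matching the symbols of the [e i q] with the [f i q] intertwines. *)
Lemma assembly : exists Phi, intertwining_iso S (fun x => gr_op N.+1 H 0 (A x)) T B Phi.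
Proof.
have [ef eE] := be_basis; have [ff fE] := bf_basis.
have [Phi MPhi] : exists Phi, fam_mx be *m Phi = fam_mx bf.
  by exists (pinvmx (fam_mx be) *m fam_mx bf); rewrite mulmxA mulmxVp // mul1mx.
have ePhi y : be y *m Phi = bf y by rewrite -(row_fam be) -row_mul MPhi row_fam.
have SPhi : (S *m Phi :=: T)%MS.
  by apply: eqmx_trans (eqmxMr _ (eqmx_sym eE)) _; rewrite MPhi.
exists Phi; split=> [||x]; first by apply/eqmxP.
  by rewrite SPhi -fE -eE (eqP ef) (eqP ff).
apply/eqP; rewrite -submx0; have /submxP[W ->] : (S <= fam_mx be)%MS by rewrite eE.
rewrite -mulmxA mulmx_sub //; apply/row_subP => r; rewrite row_mul rowK; case: (enum_val r) => i q.
rewrite submx0 mulmxBr !mulmxA ePhi subr_eq0 /bf /=; have [c [hc ->]] := str x q.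
rewrite /be /= (gr_opE leaf_filt_incr leaf_filt_top); first last.
- exact: e_leaf_filt.
- by move=> j; rewrite addn0 leaf_filt_stable.
rewrite addn0 -[e i q *m A x](subrK (\sum_(q' < s i) c q' *: e i q')) symD sym_low // add0r.
rewrite sym_sum mulmx_suml; apply/eqP/eq_bigr => q' _.
by rewrite symZ -scalemxAl; congr (_ *: _); exact: (ePhi (Tagged (fun i => 'I_(s i)) q')).
Qed.

End Assembly.

(** * Types of leaves *)

Section Blocks.
Variables (F : fieldType) (N : nat) (dm : 'I_N -> nat).

Definition blk_inc (j : 'I_N) : 'M[F]_(dm j, \sum_i dm i) := submxcol 1%:M j.

Lemma mxdiag_mxcol (C : forall i, 'M[F]_(dm i)) : mxdiag C = \mxcol_i (C i *m blk_inc i).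
Proof. by rewrite -mul_mxdiag_mxcol submxcolK mulmx1. Qed.

Lemma blk_inc_mxdiag C j : blk_inc j *m mxdiag C = C j *m blk_inc j.
Proof. by rewrite /blk_inc submxcol_mul mul1mx {1}mxdiag_mxcol mxcolK. Qed.

Lemma mxdiag_sub C (T : 'M[F]_(\sum_i dm i)) : (forall j, C j *m blk_inc j <= T)%MS -> (mxdiag C <= T)%MS.
Proof.
move=> h; rewrite mxdiag_mxcol -[X in (X <= _)%MS]mul1mx -{1}[1%:M]submxrowK mul_mxrow_mxcol.
by apply: summx_sub => j _; exact: mulmx_sub.
Qed.

Lemma blk_sub C j : (C j *m blk_inc j <= mxdiag C)%MS.
Proof. by rewrite -blk_inc_mxdiag submxMl. Qed.
End Blocks.

(** Leaves come in lexicographic order, the summands of the target grouped by type; this is the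
    rearrangement between the two. *)
Lemma perm_classify (T : eqType) (M : finType) (s : seq T) (f : T -> M) (g : T -> nat) :
  perm_eq [seq (f x, g x) | x <- s]
    (flatten [seq [seq (mm, d) | d <- [seq g x | x <- s & f x == mm]] | mm <- enum M]).
Proof.
apply/permP => a; rewrite count_flatten -map_comp sumnE big_map big_enum /=.
elim: s => [|x s IH] /=; first by rewrite big1.
rewrite IH [in LHS](bigD1 (f x)) //= [in RHS](bigD1 (f x)) //= eqxx /= addnA; congr (_ + _)%N.
by apply: eq_bigr => mm /negbTE; rewrite eq_sym => ->.
Qed.

Lemma perm_bijection (T : eqType) (x0 : T) (s t : seq T) n : size s = n -> perm_eq s t ->
  exists2 sg : 'I_n -> 'I_(size t), bijective sg & forall i, nth x0 t (sg i) = nth x0 s i.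
Proof.
move=> sn st; have sz := perm_size st; have /(perm_iotaP x0)[Is Ip sE] := st.
have Isz : size Is = n by rewrite -sn sE size_map.
have lt (i : 'I_n) : (nth 0%N Is i < size t)%N.
  have : nth 0%N Is i \in iota 0 (size t) by rewrite -(perm_mem Ip) mem_nth // Isz.
  by rewrite mem_iota.
exists (fun i => Ordinal (lt i)); last by move=> i /=; rewrite sE (nth_map 0%N) ?Isz.
apply: inj_card_bij; last by rewrite !card_ord -sz sn.
move=> i j /(congr1 val) /= /eqP; rewrite nth_uniq ?Isz // ?(perm_uniq Ip) ?iota_uniq //.
by move/eqP/val_inj.
Qed.

Section LeafTypes.
Variables (k p pbar : nat) (ks : 'I_p -> nat) (kbs : 'I_pbar -> nat).
Hypotheses (k1 : (1 <= k)%N) (ksk : forall i, (ks i <= k)%N) (kbsk : forall i, (kbs i <= k)%N).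
Local Notation leaves := [seq (dy, dx) | dy <- lv (kal ks), dx <- lv (kbl kbs)].
Local Notation leaf := ((seq nat * seq nat) * (seq nat * seq nat))%type.

(** The use of [inord] loses nothing: a leaf has at most p (resp. pbar) entries in its site list, so
    the counts are in range. *)
Definition leaf_type (d : leaf) : midx k p pbar :=
  ([ffun i : 'I_k => inord (count_mem i.+1 d.1.2)], [ffun i : 'I_k => inord (count_mem i.+1 d.2.2)]).
Definition leaf_deg (d : leaf) : nat := sumn d.1.1 + sumn d.2.1.
Definition leaf_fac (d : leaf) : seq nat := pi_factors k (mpl (leaf_type d)).

Let kal_k : all (fun x => x <= k)%N (kal ks).
Proof. by apply/allP => _ /mapP[i _ ->]. Qed.
Let kbl_k : all (fun x => x <= k)%N (kbl kbs).
Proof. by apply/allP => _ /mapP[i _ ->]. Qed.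

Lemma tupE B (m : {ffun 'I_k -> 'I_B}) (i : 'I_k) : tup m i.+1 = m i.
Proof. by rewrite /= insubT // => h; congr (val (m _)); exact: val_inj. Qed.

Lemma typ_tup B rho (m : {ffun 'I_k -> 'I_B.+1}) : (size rho <= B)%N ->
  typ k rho (tup m) = (m == [ffun i : 'I_k => inord (count_mem i.+1 rho)]).
Proof.
move=> sB; have cB a : (count_mem a rho < B.+1)%N by rewrite ltnS (leq_trans (count_size _ _)).
apply/allP/eqP => [h|-> a].
  apply/ffunP => i; apply/val_inj; rewrite ffunE /= inordK // -tupE; apply/esym/eqP/h.
  by rewrite mem_iota /= add1n ltnS ltn_ord.
rewrite mem_iota add1n ltnS; case: a => // a /andP[_ ak].
by rewrite (tupE _ (Ordinal ak)) ffunE inordK.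
Qed.

Lemma leaf_bounds d : d \in leaves ->
  [/\ d.1 \in lv (kal ks), d.2 \in lv (kbl kbs), (size d.1.2 <= p)%N & (size d.2.2 <= pbar)%N] /\
  (all (fun x => 0 < x <= k)%N d.1.2 /\ all (fun x => 0 < x <= k)%N d.2.2).
Proof.
case/allpairsP=> -[dy dx] [/= hy hx ->].
have [? h] := lvs_rho (lvP _) kal_k hy; have [? h'] := lvs_rho (lvP _) kbl_k hx.
by rewrite /kal size_map -cardE card_ord in h; rewrite /kbl size_map -cardE card_ord in h'.
Qed.

Lemma leaf_typeP d : d \in leaves -> forall mm,
  (leaf_type d == mm) = typ k d.1.2 (tup mm.1) && typ k d.2.2 (tup mm.2).
Proof.
move=> /leaf_bounds[[_ _ h1 h2] _] mm; by rewrite !typ_tup // eq_sym.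
Qed.

Lemma count_pi_factors mv a : count_mem a (pi_factors k mv) = if (0 < a <= k)%N then mv a else 0%N.
Proof.
rewrite /pi_factors count_flatten -map_comp sumnE big_map.
case: ifP => h.
  rewrite (bigD1_seq a) ?iota_uniq ?mem_iota ?add1n //= count_nseq /= eqxx mul1n big1 ?addn0 // => b ba.
  by rewrite count_nseq /= (negbTE ba).
rewrite big_seq big1 // => b; rewrite mem_iota add1n ltnS => hb; rewrite /= count_nseq /=.
by case: eqP => // e; rewrite -e hb in h.
Qed.

Lemma leaf_facP d : d \in leaves -> perm_eq (leaf_fac d) (rho_of d).
Proof.
move=> dL; have [_ [/allP h1 /allP h2]] := leaf_bounds dL.
have /esym := leaf_typeP dL (leaf_type d); rewrite eqxx => /andP[/allP t1 /allP t2].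
apply/allP => a _ /=; rewrite /leaf_fac count_pi_factors /rho_of count_cat; apply/eqP.
case: ifP => ha.
  have ai : a \in iota 1 k by rewrite mem_iota add1n ltnS.
  by rewrite /mpl (eqP (t1 _ ai)) (eqP (t2 _ ai)).
have c0 rho : (forall x, x \in rho -> (0 < x <= k)%N) -> count_mem a rho = 0%N.
  by move=> h; apply/count_memPn/negP => /h; rewrite ha.
by rewrite !c0.
Qed.

Definition leaf_Ms (mm : midx k p pbar) : seq nat := [seq leaf_deg d | d <- leaves & leaf_type d == mm].

Lemma mult_count q (ls : 'I_q -> nat) a : mult ls a = count_mem a [seq ls i | i <- enum 'I_q].
Proof. by rewrite /mult -sum1_card -sum1_count big_map big_enum_cond; apply: eq_bigl => i; rewrite inE. Qed.

Lemma leaf_Ms_poly mm : \sum_(d <- leaf_Ms mm) 'X^d = FF (mult ks) (mult kbs) mm.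
Proof.
have FE q (ls : 'I_q -> nat) m : Fpoly k (mult ls) m = Fpoly k (fun a => count_mem a [seq ls i | i <- enum 'I_q]) m.
  rewrite !FpolyE; apply: FL_ext => // a _; rewrite /lam; apply: eq_bigr => i _; exact: mult_count.
rewrite /FF !FE -(leaf_polynomial k1 (lvP _) kal_k) -(leaf_polynomial k1 (lvP _) kbl_k).
rewrite /leaf_Ms big_map big_filter big_seq_cond.
rewrite (eq_bigl (fun d => (d \in leaves) && (typ k d.1.2 (tup mm.1) && typ k d.2.2 (tup mm.2)))); last first.
  by move=> d; case dL: (d \in leaves) => //=; rewrite leaf_typeP.
rewrite -big_seq_cond big_mkcond big_allpairs big_distrl [RHS]big_mkcond /=.
apply: eq_bigr => dy _; case: ifP => h1; last by rewrite big1.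
rewrite big_distrr [RHS]big_mkcond /=; apply: eq_bigr => dx _.
by case: ifP => // _; rewrite /leaf_deg exprD.
Qed.

Lemma leaf_sum (g : seq nat -> nat) : (forall r r', perm_eq r r' -> g r = g r') ->
  (forall r r', g (r ++ r') = g r * g r')%N ->
  (\sum_(d <- leaves) g (leaf_fac d) = (\sum_(dy <- lv (kal ks)) g dy.2) * (\sum_(dx <- lv (kbl kbs)) g dx.2))%N.
Proof.
move=> gp gM; rewrite big_seq (eq_bigr (fun d : leaf => g d.1.2 * g d.2.2)%N) => [|d dL]; last first.
  by rewrite (gp _ _ (leaf_facP dL)) gM.
rewrite -big_seq big_allpairs big_distrl; apply: eq_bigr => dy _.
by rewrite big_distrr.
Qed.

Lemma leaf_dim : (\sum_(d <- leaves) size (zb (leaf_fac d)) =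
  \prod_(x <- kal ks) 'C(x.+2, 2) * \prod_(x <- kbl kbs) 'C(x.+2, 2))%N.
Proof.
rewrite -(lvs_dim (lvP (kal ks))) -(lvs_dim (lvP (kbl kbs))).
rewrite -(leaf_sum (g := fun r => (\prod_(x <- r) x.+1)%N)) => [|r r' h|r r'].
- by apply: eq_bigr => d _; rewrite size_map (lvs_size (lvP _)).
- exact: perm_big.
- by rewrite big_cat.
Qed.

Lemma leaf_size1 d : d \in leaves -> (size d.1.1 + sumn d.1.2 = sumn (kal ks))%N.
Proof. by case/leaf_bounds=> -[h _ _ _] _; apply: lvs_sum h; exact: lvP. Qed.
Lemma leaf_size2 d : d \in leaves -> (size d.2.1 + sumn d.2.2 = sumn (kbl kbs))%N.
Proof. by case/leaf_bounds=> -[_ h _ _] _; apply: lvs_sum h; exact: lvP. Qed.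

Lemma leaf_cexp d : d \in leaves -> cexp (mult ks) (mult kbs) (leaf_type d) =
  ((sumn (kal ks))%:R - (sumn (kbl kbs))%:R) / 3%:R - ((sumn d.1.2)%:R - (sumn d.2.2)%:R) / 2%:R.
Proof.
move=> dL; have [_ [/allP h1 /allP h2]] := leaf_bounds dL.
have /esym := leaf_typeP dL (leaf_type d); rewrite eqxx => /andP[t1 t2].
have a1 : all (fun x => x <= k)%N d.1.2 by apply/allP => x /h1 /andP[].
have a2 : all (fun x => x <= k)%N d.2.2 by apply/allP => x /h2 /andP[].
have TE q (ls : 'I_q -> nat) : (forall i, ls i <= k)%N -> tnorm k (mult ls) = sumn [seq ls i | i <- enum 'I_q].
  move=> h; rewrite -(@tnorm_count k); last by apply/allP => _ /mapP[i _ ->].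
  by rewrite /tnorm; apply: eq_bigr => a _; rewrite mult_count.
by rewrite /cexp !TE // (tnorm_typ a1 t1) (tnorm_typ a2 t2).
Qed.

Lemma leaf_fac_sumn d : d \in leaves -> sumn (leaf_fac d) = (sumn d.1.2 + sumn d.2.2)%N.
Proof. by move=> /leaf_facP /perm_sumn ->; rewrite sumn_cat. Qed.

End LeafTypes.

(** * The filtration H and the character *)

Section Main.
Variables (F : numFieldType) (k p pbar : nat) (ks : 'I_p -> nat) (kbs : 'I_pbar -> nat)
          (zeta : 'I_(p + pbar) -> F).
Hypotheses (k1 : (1 <= k)%N) (ksk : forall i, (ks i <= k)%N) (kbsk : forall i, (kbs i <= k)%N)
  (zinj : injective zeta).
Local Notation nul := ([::] : seq nat, [::] : seq nat).
Local Notation leaves := [seq (dy, dx) | dy <- lv (kal ks), dx <- lv (kbl kbs)].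
Local Notation VS := (V_space ks kbs zeta).
Local Notation Ms := (@leaf_Ms k p pbar ks kbs).
Local Notation leaf_fac := (@leaf_fac k p pbar).
Local Notation leaf_type := (@leaf_type k p pbar).
Local Notation M := (mult ks).
Local Notation Mb := (mult kbs).

Let char0 m : m.+1%:R != 0 :> F. Proof. by rewrite pnatr_eq0. Qed.

Let N := size leaves.
Let dl (i : 'I_N) := nth (nul, nul) leaves i.
Let dlL i : dl i \in leaves. Proof. exact: mem_nth. Qed.
Let zl i := zb (leaf_fac (dl i)).
Let s (i : 'I_N) := size (zl i).

(** A common bound for the nonzero operators on V and on all summands, so that one polynomial ring
    serves both sides. *)
Let nn := (stab (ufilt (@E3 F p pbar ks kbs zeta) (v3 ks kbs zeta))
  + \sum_(mm : midx k p pbar) stab (ufilt (E2 F k (mpl mm)) (u2 F k (mpl mm))))%N.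
Let nnV : (stab (ufilt (@E3 F p pbar ks kbs zeta) (v3 ks kbs zeta)) <= nn)%N.
Proof. exact: leq_addr. Qed.
Let nnP (mm : midx k p pbar) : (stab (ufilt (E2 F k (mpl mm)) (u2 F k (mpl mm))) <= nn)%N.
Proof. by rewrite /nn (bigD1 mm) //= addnCA leq_addr. Qed.

Let sN : (\sum_i s i = \prod_(x <- kal ks) 'C(x.+2, 2) * \prod_(x <- kbl kbs) 'C(x.+2, 2))%N.
Proof. by rewrite -(leaf_dim ksk kbsk) (big_nth (nul, nul)) big_mkord. Qed.

Let e (i : 'I_N) (q : nat) := gw ks kbs zeta (dl i).1.1 (dl i).2.1 (nth [::] (zl i) q).

Lemma leaf_bijection : exists2 sg : 'I_N -> 'I_(size (summands Ms)), bijective sg &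
  forall i, summand (sg i) = (leaf_type (dl i), leaf_deg (dl i)).
Proof.
have P := perm_classify leaves leaf_type leaf_deg.
have [|sg sgb sgE] := perm_bijection (n := N) (dflt_midx k p pbar, 0%N) _ P; first by rewrite size_map.
by exists sg => // i; rewrite /summand sgE (nth_map (nul, nul)).
Qed.

Section Target.
Variable sg : 'I_N -> 'I_(size (summands Ms)).
Hypotheses (sgb : bijective sg) (sgE : forall i, summand (sg i) = (leaf_type (dl i), leaf_deg (dl i))).
Local Notation mv i := (mpl (summand (sg i)).1).

Let f (i : 'I_N) (q : nat) := pi_w F k (mv i) (nth [::] (zl i) q) *m blk_inc F (@tgt_dim k p pbar F Ms) (sg i).

Let zlE i : zl i = zb (pi_factors k (mv i)). Proof. by rewrite /zl sgE. Qed.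
Let nni i : (stab (ufilt (E2 F k (mv i)) (u2 F k (mv i))) <= nn)%N. Proof. exact: nnP. Qed.

Let A (x : nat + 'I_3) : 'M[F]_(n3 ks kbs zeta) :=
  match x with
  | inl i => @grG_Z F p pbar ks kbs zeta i
  | inr y => if val y == 0%N then grG_D0 ks kbs zeta
             else if val y == 1%N then grG_D1 ks kbs zeta
             else grG_D2 ks kbs zeta
  end.

Let H := leaf_filt s e.

Let eS i (q : 'I_(s i)) : (e i q <= VS)%MS. Proof. exact: gw_VS. Qed.

Let H_low j d z : (j <= N)%N -> d \in take j leaves -> z \in zb (leaf_fac d) ->
  (gw ks kbs zeta d.1.1 d.2.1 z <= H j)%MS.
Proof.
move=> jN /(nthP (nul, nul))[ i ]; rewrite size_take -/N => ij dE zd.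
have ij' : (i < j)%N by move: ij; case: (ltnP j N) => // h h'; exact: leq_trans h' h.
have iN : (i < N)%N := leq_trans ij' jN.
rewrite nth_take // in dE; have := @e_leaf_filt F _ N s e (Ordinal iN).
rewrite /e /s /zl /dl /= dE => h; have hz : (index z (zb (leaf_fac d)) < size (zb (leaf_fac d)))%N by rewrite index_mem.
by have := h (Ordinal hz) j ij'; rewrite /= nth_index.
Qed.

Let eSp : (VS <= H N)%MS.
Proof.
apply: (leaf_span char0 zinj (nn := nn) (fc := leaf_fac)) => // [d dL|d z dL zd].
  exact: leaf_facP.
by apply: H_low; rewrite ?take_size.
Qed.

Let eN : (\sum_i s i <= \rank VS)%N. Proof. by rewrite sN V_rank. Qed.

Let fT i (q : 'I_(s i)) : (f i q <= tgt_space F Ms)%MS.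
Proof.
apply: submx_trans (blk_sub _ (sg i)); rewrite submxMr //; exact: pi_w_space.
Qed.

Let rank_pi j : \rank (pi_space F k (mpl (summand j).1)) = size (zb (pi_factors k (mpl (@summand k p pbar Ms j).1))).
Proof. by have [/eqP fr <-] := pi_basis char0 (nnP (summand j).1). Qed.

Let fN : (\sum_i s i)%N = \rank (tgt_space F Ms).
Proof.
rewrite rank_mxdiag (reindex sg) /=; last by apply: onW_bij.
by apply: eq_bigr => i _; rewrite rank_pi /s zlE.
Qed.

Let fSp : (tgt_space F Ms <= \sum_i \sum_(q < s i) <<f i q>>)%MS.
Proof.
apply: mxdiag_sub => j; have [si sgK siK] := sgb.
have [i ->] : exists i, j = sg i by exists (si j); rewrite siK.
have [_ E] := pi_basis char0 (nni i).
rewrite -(eqmxMr _ E); apply/row_subP => q; rewrite row_mul rowK.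
have q' : (q < s i)%N by rewrite /s zlE.
by rewrite (sumsmx_sup i) // (sumsmx_sup (Ordinal q')) // genmxE /f /= zlE.
Qed.

(** For Z the coefficients are found in F[Z] modulo [Rel], hence hold in pi exactly and in gr^G V
    modulo earlier leaves. For the gradings both vectors are eigenvectors, and the eigenvalues agree
    by [leaf_size1], [leaf_size2] and [leaf_cexp]. *)
Let block_action x (i : 'I_N) (q : 'I_(s i)) : exists c : nat -> F,
  (e i q *m A x - \sum_(q' < s i) c q' *: e i q' <= H i)%MS /\
  f i q *m tgt_op M Mb F Ms x = \sum_(q' < s i) c q' *: f i q'.
Proof.
have eig (a : F) (u : nat -> 'rV[F]_(n3 ks kbs zeta)) (w : nat -> 'rV[F]_(\sum_j @tgt_dim k p pbar F Ms j)) X Y :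
    u q *m X = a *: u q -> w q *m Y = a *: w q -> exists c : nat -> F,
   (u q *m X - \sum_(q' < s i) c q' *: u q' <= H i)%MS /\ w q *m Y = \sum_(q' < s i) c q' *: w q'.
  move=> -> ->; exists (fun q' : nat => if q' == q :> nat then a else 0).
  have S m' (g : nat -> 'rV[F]_m') : \sum_(q' < s i) (if q' == q :> nat then a else 0) *: g q' = a *: g q.
    rewrite (bigD1 q) //= eqxx big1 ?addr0 // => q' /negbTE h; have -> : (q' == q :> nat) = false by [].
    by rewrite scale0r.
  by rewrite !S subrr sub0mx.
have fM (C : forall j, 'M[F]_(@tgt_dim k p pbar F Ms j)) : f i q *m mxdiag C = pi_w F k (mv i) (nth [::] (zl i) q) *m C (sg i) *m blk_inc F _ (sg i).
  by rewrite /f -mulmxA blk_inc_mxdiag mulmxA.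
have [size1 size2] := (leaf_size1 ksk kbsk (dlL i), leaf_size2 ksk kbsk (dlL i)).
case: x => [a|y] /=.
  have [c hc] := zb_span (n := nn) char0 (leaf_fac (dl i)) (monom F nn (a :: nth [::] (zl i) q)).
  exists c; split.
    rewrite /e -gw_cons; apply: (leaf_rel char0 zinj (nn := nn) (fc := leaf_fac)) => // [d dL|d z dL zd].
      exact: leaf_facP.
    by apply: H_low => //; exact: ltnW.
  rewrite fM -pi_w_cons.
  have E : leaf_fac (dl i) = pi_factors k (mv i) by rewrite sgE.
  move: hc; move: (val q) => q0; rewrite /f /s /zl E => hc; rewrite (pi_rel (nni i) hc) mulmx_suml.
  by apply: eq_bigr => q' _; rewrite scalemxAl.
have fsum : sumn (pi_factors k (mv i)) = (sumn (dl i).1.2 + sumn (dl i).2.2)%N.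
  by rewrite sgE; exact: leaf_fac_sumn.
have c1 := leaf_cexp ksk kbsk (dlL i).
have n2z : 2%:R != 0 :> F by [].
have n3z : 3%:R != 0 :> F by [].
case: ifP => _; last case: ifP => _; (apply: eig; [by rewrite /e ?gw_D0 ?gw_D1 ?gw_D2 | ]); rewrite fM.
- rewrite mulmxDr pi_w_D0 mul_mx_scalar -scalerDl -scalemxAl; congr (_ *: _).
  by rewrite sgE /= -natrD addnC.
- rewrite mulmxBr pi_w_Dw // mul_mx_scalar -scalerBl -scalemxAl; congr (_ *: _).
  rewrite fsum sgE /= c1 -size1 -size2 !rmorphB /= !fmorph_div !rmorphB /= !ratr_nat mul2n -addnn !natrD.
  by field.
- rewrite mulmxDr pi_w_Dw // mul_mx_scalar -scalerDl -scalemxAl; congr (_ *: _).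
  rewrite fsum sgE /= c1 -size1 -size2 !rmorphB /= !fmorph_div !rmorphB /= !ratr_nat mul2n -addnn !natrD.
  by field.
Qed.

Lemma leaf_filtration_iso : exists (H : nat -> 'M[F]_(n3 ks kbs zeta)) (J : nat),
  is_Zfiltration H J /\
  exists Phi : 'M[F]_(n3 ks kbs zeta, \sum_i @tgt_dim k p pbar F Ms i),
    intertwining_iso VS (grH_op H J) (tgt_space F Ms) (tgt_op M Mb F Ms) Phi.
Proof.
exists H, N; split; last exact: (assembly eS eSp eN fT fN fSp block_action).
have st := leaf_filt_stable block_action; split.
- exact: leaf_filt_incr.
- by move=> j; exact: leaf_filt_sub.
- exact: leaf_filt_eq.
- by move=> j i; exact: (st j (inl i)).
- move=> j; split; [have := st j (inr (inord 0)) | have := st j (inr (inord 1)) | have := st j (inr (inord 2))];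
  by rewrite /= inordK.
Qed.

End Target.

Lemma chpi_count mm d s' (zs := zb (pi_factors k (mpl (mm : midx k p pbar)))) :
  chpi F k (mpl mm) d s' = #|[set q : 'I_(size zs) | (sumn (nth [::] zs q) == d) &&
     ((size (nth [::] zs q))%:R - (sumn (pi_factors k (mpl mm)))%:R / 2%:R == s')]|.
Proof.
pose b (q : 'I_(size zs)) := pi_w F k (mpl mm) (nth [::] zs q).
have [Wf WS] := pi_basis char0 (nnP mm).
have [|||bf bS] := @fam_basis F _ _ b (pi_space F k (mpl mm)).
- by move=> q; exact: pi_w_space.
- by rewrite -WS; apply/row_subP => q; rewrite rowK (sumsmx_sup q) // genmxE.
- by rewrite -WS (eqP Wf) card_ord.
pose la (q : 'I_(size zs)) : seq F := [:: (sumn (nth [::] zs q))%:R;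
  (size (nth [::] zs q))%:R - (sumn (pi_factors k (mpl mm)))%:R / 2%:R].
rewrite /chpi (joint_dim_count bf (lam := la) bS) //; last first.
  by move=> q [|[|]] // _; rewrite /= ?pi_w_D0 // pi_w_Dw.
apply: eq_card => q; rewrite !inE /la /= !eqseq_cons eqxx andbT eqr_nat; congr (_ && _).
by rewrite -(inj_eq (fmorph_inj (@ratr F))) rmorphB /= fmorph_div /= !ratr_nat.
Qed.

Let w1 (i : 'I_N) (z : seq nat) : rat :=
  (size (dl i).2.1)%:R + (size z)%:R - (sumn (kal ks) + 2 * sumn (kbl kbs))%:R / 3%:R.
Let w2 (i : 'I_N) (z : seq nat) : rat :=
  (size (dl i).1.1)%:R + (size z)%:R - (2 * sumn (kal ks) + sumn (kbl kbs))%:R / 3%:R.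

(** The count is made in V itself, on the basis of words whose G-symbols are the leaf vectors; the
    three gradings are diagonal in it. *)
Lemma chV_count d s1 s2 : chV ks kbs zeta d s1 s2 =
  (\sum_(i < N) \sum_(q < s i) [&& leaf_deg (dl i) + sumn (nth [::] (zl i) q) == d,
     w1 i (nth [::] (zl i) q) == s1 & w2 i (nth [::] (zl i) q) == s2])%N.
Proof.
pose b (y : {i : 'I_N & 'I_(s i)}) := vw ks kbs zeta (dl (tag y)).1.1 (dl (tag y)).2.1 (nth [::] (zl (tag y)) (tagged y)).
have [|||bf bS] := @fam_basis F _ _ b VS.
- by move=> y; exact: vw_VS.
- rewrite -(G_all ks kbs zeta).
  apply: (span_of_symbols (@G_incr F p pbar ks kbs zeta) (@G_top_incr F p pbar ks kbs zeta)
    (lv := fun y : {i : 'I_N & 'I_(s i)} => (size (dl (tag y)).1.1 + size (dl (tag y)).2.1)%N)).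
    by move=> y; exact: vw_G.
  rewrite (G_all ks kbs zeta).
  apply: (leaf_span char0 zinj (nn := nn) (fc := leaf_fac)) => // [d' dL|d' z dL zd]; first exact: leaf_facP.
  have hi : (index d' leaves < N)%N by rewrite index_mem.
  have dE : dl (Ordinal hi) = d' by rewrite /dl /= nth_index.
  have hz : (index z (zl (Ordinal hi)) < s (Ordinal hi))%N by rewrite index_mem /zl dE.
  rewrite (sumsmx_sup (Tagged (fun i => 'I_(s i)) (Ordinal hz))) //= genmxE -gwE.
  by rewrite nth_index /zl dE.
- rewrite card_tagged sumnE big_map big_enum (eq_bigr s) => [|i _]; last by rewrite card_ord.
  by rewrite sN V_rank.
pose la (y : {i : 'I_N & 'I_(s i)}) : seq F := let z := nth [::] (zl (tag y)) (tagged y) in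
  [:: (sumn (dl (tag y)).1.1 + sumn (dl (tag y)).2.1 + sumn z)%:R; ratr (w1 (tag y) z); ratr (w2 (tag y) z)].
rewrite /chV (joint_dim_count bf (lam := la) bS) //; last first.
  move=> y [|[|[|]]] // _ /=; rewrite /b ?vw_D0 ?vw_D1 ?vw_D2 //; congr (_ *: _);
  by rewrite /w1 /w2 rmorphB /= [ratr (_ + _)]rmorphD /= fmorph_div /= !ratr_nat.
rewrite -sum1dep_card big_mkcond /= sig_big_dep /=; apply: eq_bigr => -[i q] _.
rewrite /la /= !eqseq_cons !eqxx andbT eqr_nat !(inj_eq (fmorph_inj (@ratr F))) /leaf_deg.
by case: ifP.
Qed.

Lemma character_formula d (s1 s2 : rat) : ((chV ks kbs zeta d s1 s2)%:R : rat) =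
  \sum_(mm : midx k p pbar) \sum_(d1 < d.+1)
    (FF M Mb mm)`_d1 *
    (if s2 - s1 == 2%:R * cexp M Mb mm
     then (chpi F k (mpl mm) (d - d1) ((s1 + s2) / 2%:R))%:R else 0).
Proof.
(* Both sides are rewritten as a sum over leaves, [g] being the contribution of a leaf of type [mm]
   and q-degree [d1]. *)
pose g (mm : midx k p pbar) := if s2 - s1 == 2%:R * cexp M Mb mm then
  (fun d1 => (chpi F k (mpl mm) (d - d1) ((s1 + s2) / 2%:R))%:R) else (fun=> 0 : rat).
transitivity (\sum_(dd <- leaves) if (leaf_deg dd <= d)%N then g (leaf_type dd) (leaf_deg dd) else 0); last first.
  transitivity (\sum_(mm : midx k p pbar) \sum_(dd <- leaves | leaf_type dd == mm)
      if (leaf_deg dd <= d)%N then g mm (leaf_deg dd) else 0).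
    rewrite [RHS](exchange_big_dep predT) //=; apply: eq_bigr => dd _.
    by rewrite (eq_bigl (pred1 (leaf_type dd))) ?big_pred1_eq // => mm; rewrite eq_sym.
  apply: eq_bigr => mm _; rewrite -(leaf_Ms_poly k1 ksk kbsk) /leaf_Ms big_map big_filter.
  under [RHS]eq_bigr => d1 _ do rewrite coef_sum big_distrl /=.
  rewrite exchange_big /=; apply: eq_bigr => dd _.
  case: leqP => h; last first.
    rewrite big1 // => d1 _; rewrite coefXn (_ : (d1 == _ :> nat) = false) ?mul0r //.
    by apply/negbTE; rewrite neq_ltn (leq_trans _ h) // ltnS -ltnS.
  rewrite (bigD1 (Ordinal (h : leaf_deg dd < d.+1)%N)) //= coefXn eqxx mul1r big1 ?addr0 => [|d1 ne].
    by rewrite /g; case: ifP.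
  by rewrite coefXn (_ : (d1 == _ :> nat) = false) ?mul0r //; exact: negbTE.
rewrite chV_count natr_sum (big_nth (nul, nul)) big_mkord; apply: eq_bigr => i _.
rewrite -/(dl i) natr_sum /g.
have fE := leaf_fac_sumn ksk kbsk (dlL i); have cE := leaf_cexp ksk kbsk (dlL i).
have z1 := leaf_size1 ksk kbsk (dlL i); have z2 := leaf_size2 ksk kbsk (dlL i).
set c := cexp _ _ _; pose t (z : seq nat) : rat := (size z)%:R - (sumn (leaf_fac (dl i)))%:R / 2%:R.
(* With s the weight on pi and c the exponent [cexp], a vector has D1 = s - c and D2 = s + c; so s2
   - s1 = 2c and s = (s1 + s2) / 2. *)
have wE z : (w1 i z == s1) && (w2 i z == s2) = (s2 - s1 == 2%:R * c) && (t z == (s1 + s2) / 2%:R).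
  have -> : w1 i z = t z - c.
    by rewrite /w1 /t /c cE fE -z1 -z2 mul2n -addnn !natrD; field.
  have -> : w2 i z = t z + c.
    by rewrite /w2 /t /c cE fE -z1 -z2 mul2n -addnn !natrD; field.
  apply/andP/andP => -[/eqP h1 /eqP h2]; split; apply/eqP; lra.
case: leqP => hd; last first.
  rewrite big1 // => q _; rewrite (_ : (_ == d) = false) //; apply/negbTE; rewrite neq_ltn.
  by rewrite (leq_trans hd) ?orbT // leq_addr.
case: ifP => hc; last first.
  by rewrite big1 // => q _; rewrite wE hc andbF.
rewrite chpi_count -sum1dep_card natr_sum [RHS]big_mkcond /=; apply: eq_bigr => q _.
rewrite wE hc -[X in _ = if X && _ then _ else _](eqn_add2l (leaf_deg (dl i))) subnKC //=.
by rewrite -/(t _) -/(leaf_fac (dl i)) -/(zl i); case: (_ && _).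
Qed.

End Main.

Theorem theorem4p5 (R : realType) (k p pbar : nat)
    (ks : 'I_p -> nat) (kbs : 'I_pbar -> nat) (zeta : 'I_(p + pbar) -> R[i]) :
  (1 <= k)%N ->
  (forall i, (ks i <= k)%N) -> (forall i, (kbs i <= k)%N) ->
  injective zeta ->
  let M := mult ks in
  let Mb := mult kbs in
  (* the filtration H and the module isomorphism *)
  (exists Ms : midx k p pbar -> seq nat,
     (forall mm, \sum_(d <- Ms mm) 'X^d = FF M Mb mm) /\
     exists (H : nat -> 'M[R[i]]_(n3 ks kbs zeta)) (J : nat),
       is_Zfiltration H J /\
       exists Phi : 'M[R[i]]_(n3 ks kbs zeta, \sum_i @tgt_dim k p pbar R[i] Ms i),
         intertwining_iso (V_space ks kbs zeta) (grH_op H J)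
                          (tgt_space R[i] Ms) (tgt_op M Mb R[i] Ms) Phi)
  /\
  (* the character formula, coefficientwise in q^d z1^s1 z2^s2 *)
  (forall (d : nat) (s1 s2 : rat),
     ((chV ks kbs zeta d s1 s2)%:R : rat) =
     \sum_(mm : midx k p pbar) \sum_(d1 < d.+1)
        (FF M Mb mm)`_d1 *
        (if s2 - s1 == 2%:R * cexp M Mb mm
         then (chpi R[i] k (mpl mm) (d - d1) ((s1 + s2) / 2%:R))%:R
         else 0)).
Proof.
move=> k1 ksk kbsk zinj M Mb; split; last exact: character_formula.
exists (leaf_Ms ks kbs); split; first exact: leaf_Ms_poly.
have [sg sgb sgE] := leaf_bijection k ks kbs.
exact: leaf_filtration_iso sgb sgE.
Qed.
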